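(* Let $\Delta$ be a locally finite thick Euclidean building and $G$ a closed group of type-preserving automorphisms of $\Delta$ with a strongly transitive action on $\Delta$. Let $c_+,c_-$ be two opposite ideal chambers of $\partial_\infty\Delta$, $\mathcal{A}$ the unique apartment of $\Delta$ with $c_+,c_-\subset\partial_\infty\mathcal{A}$, and $T:=G_{c_+}\cap G_{c_-}$. Let $\sigma_-$ be a sub-simplex of $c_-$ and $\sigma_+$ the sub-simplex of $c_+$ opposite $\sigma_-$. Let $T_{\sigma_\pm}$ be the set of all strongly $I_{\sigma_+}$-regular hyperbolic elements in $T$, where $I_{\sigma_+}$ is the type of $\sigma_+$, and assume $T_{\sigma_\pm}\neq\emptyset$. Let $H$ be a closed subgroup of $G$ such that $HG_{\sigma_-}$ is open in $G$. Let $\{a_n\}_{n\in\mathbb{N}}$ be any sequence in $T_{\sigma_\pm}$ with the following properties. (1) Every $a_n$ has $\sigma_+$ as its attracting simplex, $\lim_{n\to\infty}|a_n|=\infty$, the sequence $\{a_nHa_n^{-1}\}_{n\in\mathbb{N}}$ converges to $L$ in the Chabauty topology on $\mathcal{S}(G)$, $L$ is a subgroup of $G_{\sigma_+}$ (in particular $L$ fixes $\sigma_+$ pointwise), and $L$ is normalized by an element $\gamma\in T_{\sigma_\pm}$. (2) For every $\sigma'\in\mathrm{Opp}(\sigma_+)$ there are $N>0$ and elements $g_n\in a_nHa_n^{-1}$, $n\geq N$, with $g_n(\sigma_-)=\sigma'$, and the sequence of subsets $\{g_na_nH_{\sigma_-}a_n^{-1}\}_{n\geq N}$ admits a convergent subsequence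 of elements: there are a strictly increasing sequence of indices $\{n_k\}_k$, $n_k\geq N$, and elements $p_{n_k}\in g_{n_k}a_{n_k}H_{\sigma_-}a_{n_k}^{-1}$ such that $\{p_{n_k}\}_k$ converges in $G$. Then the corresponding Chabauty limit $L$ of $H$ with respect to $\{a_n\}_{n\in\mathbb{N}}$ admits the decomposition $$L=U_\gamma^{+}(L)\,L_{\sigma_-},$$ where $\gamma\in T_{\sigma_\pm}$ is the element from (1) normalizing $L$, $U_\gamma^{+}(L):=L\cap U_\gamma^{+}$ is normal in $L$ with a transitive action on $\mathrm{Opp}(\sigma_+)$, and $L_{\sigma_-}:=L\cap G_{\sigma_+,\sigma_-}$. If moreover $U_\gamma^{+}$ acts simple-transitively on $\mathrm{Opp}(\sigma_+)$, then $U_\gamma^{+}(L)=U_\gamma^{+}$ and $L=U_\gamma^{+}\rtimes L_{\sigma_-}$.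
   Context: Buildings are irreducible, of dimension $\geq 1$, with their complete system of apartments. The visual boundary $\partial_\infty \Delta$ is a spherical building with finite irreducible Coxeter system $(W,S)$, whose apartments are the boundaries of the apartments of $\Delta$. Simplices are open (without their proper faces); a sub-simplex of a chamber is a face of it, possibly the chamber itself. $\mathrm{Aut}(\Delta)$ carries its usual locally compact topology; type-preserving automorphisms preserve the coloring of the vertices of the chambers of $\Delta$. $G$ acts strongly transitively on $\Delta$ if it acts transitively on the pairs consisting of an apartment and a chamber of that apartment. Types: identify $S$ with the walls through the panels of $c_+$. A face of $c_+$ has as type the set of walls in $S$ containing it (chambers have type $\emptyset$). ''Two opposite ideal simplices of type $I$'' is meant with respect to the walls of the affine building: two opposite simplices lie in exactly the same walls of any ideal apartment containing both, and one of the two has type $I$ (the other may have a different type with respect to $(W,S)$). For a hyperbolic automorphism $\gamma$, $|\gamma|=\inf_{x} d(x,\gamma(x))$ and $\mathrm{Min}(\gamma)=\{x : d(x,\gamma(x))=|\gamma|\}$. With $n=\dim\Delta$ and $I\subsetneq S$, $\gamma$ is strongly $I$-regular hyperbolic if $\mathrm{Min}(\gamma)$ contains a flat of dimension $n-|I|$ and the two endpoints of some (hence every) translation axis of $\gamma$ lie, respectively, in the interior of two opposite ideal simplices of type $I$. Its attracting simplex is the ideal simplex containing its attracting endpoint in its interior. For an ideal simplex $\sigma$, $G_\sigma=\{g\in G : g(\sigma)=\sigma \text{ pointwise}\}$; $G_{\sigma_+,\sigma_-}=G_{\sigma_+}\cap G_{\sigma_-}$; $H_{\sigma_-}=\{h\in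 H : h(\sigma_-)=\sigma_- \text{ pointwise}\}$. $\mathrm{Opp}(\sigma_+)$ is the set of all simplices of $\partial_\infty\Delta$ opposite $\sigma_+$. $\mathcal{S}(G)$ is the space of closed subgroups of $G$ with the Chabauty topology. The positive contraction subgroup is $U_\gamma^{+}=\{g\in G : \lim_{n\to\infty}\gamma^{-n}g\gamma^{n}=e\}$.
   Formalization: The element γ normalizing L is additionally assumed to have σ_+ as its attracting simplex; without this the claim fails (replace γ by γ^{-1} for SL_2(Q_p) acting on its tree). *)

(* Defs.v *)
From HB Require Import structures.
From mathcomp Require Import all_boot all_order all_algebra.
From mathcomp Require Import all_classical all_reals topology normedtype.
Set Implicit Arguments.
Unset Strict Implicit.
Unset Printing Implicit Defensive.
Import Order.TTheory GRing.Theory Num.Theory.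
Import numFieldNormedType.Exports.
Local Open Scope classical_set_scope.
Local Open Scope ring_scope.

Section Euclidean.
Context {R : realType} {n : nat}.
Implicit Types (a x y : 'rV[R]_n) (b : R).

(* The norm that MathComp-Analysis puts on row vectors is the sup norm, hence
   the explicit Euclidean structure. *)
Definition dot x y : R := \sum_i x ord0 i * y ord0 i.
Definition edist x y : R := Num.sqrt (dot (x - y) (x - y)).

Definition hyperplane a b : set 'rV[R]_n := [set x | dot a x = b].
Definition reflection a b x : 'rV[R]_n :=
  x - (2 * (dot a x - b) / dot a a) *: a.

End Euclidean.

(* The affine Coxeter complex of an irreducible, essential and infinite group
   generated by affine reflections of R^n, given by the set of its walls,
   together with a chamber {v | 0 < dot (normal i) v for all i} of the
   associated vectorial arrangement.  The linear parts of the affine Weyl group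
   and the n reflections in the walls of that vectorial chamber form the
   spherical Coxeter system (W, S), whose set S is thus identified with 'I_n;
   two of these reflections commute exactly when their normals are
   orthogonal. *)
Record affine_coxeter (R : realType) (n : nat) := AffineCoxeter {
  wall : set (set 'rV[R]_n);
  dim_gt0 : (0 < n)%N;
  wall_hyperplane : forall H, wall H ->
    exists a b, a != 0 /\ H = hyperplane a b;
  wall_reflection : forall a b H, a != 0 ->
    wall (hyperplane a b) -> wall H -> wall (reflection a b @` H);
  wall_locally_finite : forall x (r : R),
    finite_set [set H | wall H /\ exists2 y, H y & edist x y <= r];
  wall_infinite : infinite_set wall;
  normal : 'I_n -> 'rV[R]_n;
  normal_free : \matrix_i normal i \in unitmx;
  normal_wall : forall i, exists b, wall (hyperplane (normal i) b);
  normal_chamber : forall a b, a != 0 -> wall (hyperplane a b) ->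
    forall v, (forall i, 0 < dot (normal i) v) -> dot a v != 0;
  normal_irreducible : forall I : {set 'I_n}, I != finset.set0 ->
    I != [set: 'I_n]%SET ->
    exists i j, [/\ i \in I, j \notin I & dot (normal i) (normal j) != 0]
}.

Section Model.
Context {R : realType} {n : nat} (M : affine_coxeter R n).

Inductive weyl : ('rV[R]_n -> 'rV[R]_n) -> Prop :=
| weyl_id : weyl id
| weyl_reflection a b w : a != 0 -> wall M (hyperplane a b) -> weyl w ->
    weyl (reflection a b \o w).

(* The open simplex of the complex containing y.  Since (a, b) and (- a, - b)
   define the same wall, the condition on the points with b < dot a y also
   covers those on the other side. *)
Definition facet (y : 'rV[R]_n) : set 'rV[R]_n :=
  [set x | forall a b, a != 0 -> wall M (hyperplane a b) ->
     (dot a y = b -> dot a x = b) /\ (b < dot a y -> b < dot a x)].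

Definition closed_facet (y : 'rV[R]_n) : set 'rV[R]_n :=
  [set x | forall a b, a != 0 -> wall M (hyperplane a b) ->
     (dot a y = b -> dot a x = b) /\ (b < dot a y -> b <= dot a x)].

Definition in_chamber (x : 'rV[R]_n) : Prop := forall H, wall M H -> ~ H x.
Definition in_panel (x : 'rV[R]_n) : Prop := exists! H, wall M H /\ H x.

(* The open face of the vectorial chamber whose set of walls is I. *)
Definition face (I : {set 'I_n}) : set 'rV[R]_n :=
  [set v | forall i, if i \in I then dot (normal M i) v = 0
                     else 0 < dot (normal M i) v].

(* A system of apartments on the geometric realization X (with metric d) of a
   simplicial complex: a chart is the realization of a type-preserving
   isomorphism from the Coxeter complex onto an apartment.  The last two fields
   are the building axioms; [charts_compat] is the axiom asking for an
   isomorphism between two apartments that fixes their intersection. *)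
Record apartment_system (X : Type) (d : X -> X -> R)
    (charts : set ('rV[R]_n -> X)) : Prop := ApartmentSystem {
  charts_nonempty : charts !=set0;
  charts_cover : forall p : X, exists2 f, charts f & range f p;
  charts_isometry : forall f x y, charts f -> d (f x) (f y) = edist x y;
  charts_weyl : forall f w, charts f -> weyl w -> charts (f \o w);
  charts_subcomplex : forall f g x y, charts f -> charts g -> f x = g y ->
    f @` closed_facet x `<=` range g;
  charts_join : forall f g x y, charts f -> charts g ->
    exists h, [/\ charts h, f @` facet x `<=` range h
                & g @` facet y `<=` range h];
  charts_compat : forall f g, charts f -> charts g ->
    exists2 w, weyl w & forall x y, f x = g y -> y = w x
}.

(* The complete apartment system is the largest one. *)
Record building := Building {
  carrier :> Type;
  dist : carrier -> carrier -> R;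
  chart : set ('rV[R]_n -> carrier);
  chart_system : apartment_system dist chart;
  chart_complete : forall charts, apartment_system dist charts ->
    chart `<=` charts -> charts `<=` chart
}.

End Model.

Arguments dist {R n M b}.
Arguments chart {R n M} b.

Section Building.
Context {R : realType} {n : nat} {M : affine_coxeter R n} (B : building M).

Definition apartment (A : set B) : Prop := exists2 f, chart B f & A = range f.

Definition simplex (F : set B) : Prop :=
  exists f x, chart B f /\ F = f @` facet M x.
Definition chamber (C : set B) : Prop :=
  exists f x, [/\ chart B f, in_chamber M x & C = f @` facet M x].
Definition panel (P : set B) : Prop :=
  exists f x, [/\ chart B f, in_panel M x & P = f @` facet M x].
Definition vertex (v : B) : Prop := simplex [set v].
Definition is_face (F C : set B) : Prop :=
  exists f x y, [/\ chart B f, F = f @` facet M x, C = f @` facet M y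
                  & closed_facet M y x].

Definition thick : Prop := forall P, panel P ->
  exists C1 C2 C3 : set B,
    [/\ chamber C1 /\ is_face P C1, chamber C2 /\ is_face P C2,
        chamber C3 /\ is_face P C3 & [/\ C1 <> C2, C1 <> C3 & C2 <> C3]].

Definition locally_finite : Prop := forall F, simplex F ->
  finite_set [set C | chamber C /\ is_face F C].

(* The colors are the orbits of the affine Weyl group on the vertices of the
   model. *)
Definition same_color (v w : B) : Prop :=
  exists f g x, [/\ chart B f, chart B g, v = f x & w = g x].

(* Preservation of apartments is automatic for the complete system. *)
Record automorphism (g : B -> B) : Prop := Automorphism {
  automorphism_bij : bijective g;
  automorphism_isometry : forall p q, dist (g p) (g q) = dist p q;
  automorphism_simplex : forall F, simplex (g @` F) <-> simplex F;
  automorphism_apartment : forall A, apartment (g @` A) <-> apartment A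
}.

Record aut := Aut { aut_fun :> B -> B; autP : automorphism aut_fun }.

Lemma aut_inj (g h : aut) : aut_fun g = aut_fun h -> g = h.
Proof.
case: g h => [g gP] [h hP] /= gh; rewrite gh in gP *.
by congr Aut; exact: Prop_irrelevance.
Qed.

Lemma automorphism_id : automorphism id.
Proof. by split=> //; [exists id | move=> F; rewrite image_id ..]. Qed.

Lemma automorphism_comp g h :
  automorphism g -> automorphism h -> automorphism (g \o h).
Proof.
move=> [gb gd gs ga] [hb hd hs ha]; split.
- exact: bij_comp.
- by move=> p q /=; rewrite gd hd.
- by move=> F; rewrite -image_comp gs hs.
- by move=> A; rewrite -image_comp ga ha.
Qed.

Lemma automorphism_inv g : automorphism g ->
  {h | [/\ automorphism h, cancel g h & cancel h g]}.
Proof.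
move=> gP; apply: cid; have [gb gd gs ga] := gP.
have [h gK hK] := gb; exists h; split=> //.
have imK F : g @` (h @` F) = F.
  rewrite image_comp (_ : g \o h = id) ?image_id //.
  by apply/funext => x /=; rewrite hK.
split; first by exists g.
- by move=> p q; rewrite -gd !hK.
- by move=> F; rewrite -gs imK.
- by move=> A; rewrite -ga imK.
Qed.

Definition aut1 : aut := Aut automorphism_id.
Definition autM (g h : aut) : aut := Aut (automorphism_comp (autP g) (autP h)).
Definition autV (g : aut) : aut :=
  let: exist h hP := automorphism_inv (autP g) in
  let: And3 hA _ _ := hP in Aut hA.

Lemma autMA : associative autM.
Proof. by move=> f g h; apply: aut_inj. Qed.
Lemma aut1M : left_id aut1 autM.
Proof. by move=> f; apply: aut_inj. Qed.
Lemma autM1 : right_id aut1 autM.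
Proof. by move=> f; apply: aut_inj. Qed.
Lemma autVM : left_inverse aut1 autV autM.
Proof.
move=> g; apply: aut_inj; rewrite /autV; case: automorphism_inv => h [] hA gK hK.
by apply/funext => x /=; rewrite gK.
Qed.
Lemma autMV : right_inverse aut1 autV autM.
Proof.
move=> g; apply: aut_inj; rewrite /autV; case: automorphism_inv => h [] hA gK hK.
by apply/funext => x /=; rewrite hK.
Qed.

HB.instance Definition _ := gen_eqMixin aut.
HB.instance Definition _ := gen_choiceMixin aut.
HB.instance Definition _ := isGroup.Build aut autMA aut1M autM1 autVM autMV.

(* The permutation topology.  An automorphism moves the points of a simplex
   rigidly, so agreement on finite sets of points and agreement on finite sets
   of vertices give the same topology; when the building is locally finite, it
   is also the compact-open topology. *)
HB.instance Definition _ := isSubBaseTopological.Build aut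
  [set U | exists p q : B, U = [set g : aut | g p = q]] id.

Definition type_preserving (g : aut) : Prop :=
  forall v, vertex v -> same_color v (g v).

Definition strongly_transitive (G : set aut) : Prop :=
  forall A C A' C', apartment A -> chamber C -> C `<=` A ->
    apartment A' -> chamber C' -> C' `<=` A' ->
    exists g, [/\ G g, g @` A = A' & g @` C = C'].

(* Rays are the restrictions to [0, +oo[ of functions on R.  An ideal point is
   represented by its class of asymptotic rays, all values on negative numbers
   being allowed. *)
Definition ray (r : R -> B) : Prop :=
  forall s t, 0 <= s -> 0 <= t -> dist (r s) (r t) = `|s - t|.
Definition asymptotic (r r' : R -> B) : Prop :=
  exists K, forall t, 0 <= t -> dist (r t) (r' t) <= K.
Definition endpoint (r : R -> B) : set (R -> B) :=
  [set r' | ray r' /\ asymptotic r r'].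

Definition boundary (A : set B) : set (set (R -> B)) :=
  [set endpoint r | r in [set r | ray r /\ forall t, 0 <= t -> A (r t)]].

Definition ideal_facet (f : 'rV[R]_n -> B) (F : set 'rV[R]_n) :
    set (set (R -> B)) :=
  [set endpoint (fun t => f (t *: v)) | v in [set v | F v /\ dot v v = 1]].

(* Every (nonempty, open) simplex of the visual boundary has this form for
   exactly one I, as charts can be precomposed with the affine Weyl group. *)
Definition ideal_type (I : {set 'I_n}) (s : set (set (R -> B))) : Prop :=
  (I \proper [set: 'I_n])%SET /\
  exists2 f, chart B f & s = ideal_facet f (face M I).
Definition ideal_simplex s : Prop := exists I, ideal_type I s.
Definition ideal_chamber s : Prop := ideal_type finset.set0 s.

Definition sub_simplex (s c : set (set (R -> B))) : Prop :=
  exists f (I : {set 'I_n}), [/\ chart B f, (I \proper [set: 'I_n])%SET,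
    s = ideal_facet f (face M I) & c = ideal_facet f (face M finset.set0)].

(* Antipodal simplices of an apartment of the visual boundary. *)
Definition opposite (s s' : set (set (R -> B))) : Prop :=
  exists f (I : {set 'I_n}), [/\ chart B f, (I \proper [set: 'I_n])%SET,
    s = ideal_facet f (face M I) & s' = ideal_facet f (-%R @` face M I)].

Definition Opp (s : set (set (R -> B))) : set (set (set (R -> B))) :=
  [set s' | opposite s s'].

Definition ideal_act (g : aut) (xi : set (R -> B)) : set (R -> B) :=
  [set aut_fun g \o r | r in xi].

Definition fixator (G : set aut) (s : set (set (R -> B))) : set aut :=
  [set g | G g /\ forall xi, s xi -> ideal_act g xi = xi].

Definition displacement (g : aut) : R := inf (range (fun x => dist x (g x))).
Definition Min (g : aut) : set B := [set x | dist x (g x) = displacement g].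
Definition hyperbolic (g : aut) : Prop :=
  0 < displacement g /\ Min g !=set0.

Definition axis (g : aut) (l : R -> B) : Prop :=
  (forall s t, dist (l s) (l t) = `|s - t|) /\
  forall t, g (l t) = l (t + displacement g).

Definition flat (k : nat) (F : set B) : Prop :=
  exists2 phi : 'rV[R]_k -> B,
    (forall x y, dist (phi x) (phi y) = edist x y) & F = range phi.

(* The opposition involution of (W, S) may be nontrivial, so the types of two
   opposite simplices may differ. *)
Definition strongly_regular (I : {set 'I_n}) (g : aut) : Prop :=
  [/\ hyperbolic g,
      exists2 F, flat (n - #|I|) F & F `<=` Min g
    & exists l s s', [/\ axis g l, opposite s s',
        ideal_type I s \/ ideal_type I s',
        s (endpoint l) & s' (endpoint (fun t => l (- t)))]].

Definition attracting_simplex (g : aut) (s : set (set (R -> B))) : Prop :=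
  ideal_simplex s /\ exists2 l, axis g l & s (endpoint l).

End Building.

Section Groups.
Local Open Scope group_scope.
Context {T : groupType}.

Definition subgroup (H : set T) : Prop :=
  H 1 /\ forall x y, H x -> H y -> H (x * y^-1).

Definition mulset (A B : set T) : set T := [set x * y | x in A & y in B].

Definition conjset (a : T) (H : set T) : set T :=
  [set a * h * a^-1 | h in H].

Definition normal_subgroup (N H : set T) : Prop :=
  [/\ subgroup N, N `<=` H & forall h, H h -> conjset h N `<=` N].

Definition semidirect (H N K : set T) : Prop :=
  [/\ normal_subgroup N H, subgroup K, H = mulset N K & N `&` K = [set 1]].

Definition acts_on (X : Type) (op : T -> X -> X) (U : set T) (O : set X) :=
  forall u x, U u -> O x -> O (op u x).

Definition transitive_on (X : Type) (op : T -> X -> X) (U : set T)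
    (O : set X) : Prop :=
  acts_on op U O /\
  forall x y, O x -> O y -> exists2 u, U u & op u x = y.

Definition simply_transitive_on (X : Type) (op : T -> X -> X) (U : set T)
    (O : set X) : Prop :=
  acts_on op U O /\
  forall x y, O x -> O y -> exists! u, U u /\ op u x = y.

End Groups.

(* The Chabauty topology, extended to all subsets of T.  For G closed in T, the
   space of closed subgroups of G is a subspace of [chabauty T]: the trace on G
   of a compact subset of T is compact, and that of an open one is open. *)
Definition chabauty (T : topologicalType) : Type := set T.

Section Chabauty.
Context {T : topologicalType}.
HB.instance Definition _ := Choice.copy (chabauty T) (set T).
HB.instance Definition _ := isSubBaseTopological.Build (chabauty T)
  [set W : set (chabauty T) |
     (exists2 K : set T, compact K & W = [set F : set T | F `&` K = set0]) \/
     (exists2 U : set T, open U & W = [set F : set T | F `&` U !=set0])] id.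

Definition chabauty_cvg (F : nat -> set T) (L : set T) : Prop :=
  (F : nat -> chabauty T) @ \oo --> (L : chabauty T).
End Chabauty.

Section Contraction.
Context {R : realType} {n : nat} {M : affine_coxeter R n} {B : building M}.
Local Open Scope group_scope.

Definition contraction_group (G : set (aut B)) (c : aut B) : set (aut B) :=
  [set g | G g /\ (fun k : nat => c ^- k * g * c ^+ k) @ \oo --> (1 : aut B)].

End Contraction.

(* Main.v *)
(* Write al x = gamma^-1 x gamma. An element x of L fixes the attracting end of
   an axis of gamma, hence displaces a half of that axis by a bounded amount.
   By local finiteness the sequence al^n x is relatively compact, and each of
   its limits displaces the whole axis by a bounded amount, so that it also
   fixes the repelling end. The directions of a flat fixed at infinity by an
   automorphism form a convex cone (convexity of the distance between two
   geodesics), so such a limit, which already fixes sigma_+ pointwise, fixes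
   sigma_- pointwise. Thus al^n x tends to L_{sigma_-} modulo L_{sigma_-}, and
   the theorem of Baumgartner and Willis on contraction groups relative to an
   al-stable closed subgroup gives x in U_gamma^+(L) L_{sigma_-}. The elements
   g_n of hypothesis (2) and the Chabauty convergence make L, hence
   U_gamma^+(L), transitive on Opp(sigma_+).

   The geometry rests on the retractions of the building onto its apartments:
   they do not increase distances, which yields the triangle inequality, the
   Bruhat-Tits inequality and convexity.  Local compactness of the automorphism
   group is the fact that the points occupying a given position in the charts
   with a given base point are finite in number, together with the closure of
   the complete apartment system under pointwise limits of charts. *)

(* The theorem on contraction groups is proved in an abstract group, where a decreasing sequence [V]
   of subgroups replaces the topology and clustering of sequences in [V 0] replaces compactness;
   this is why the automorphism group needs a countable basis at 1, obtained from points at rational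
   positions. Three obstacles shape the geometry. An automorphism of the building may permute the
   colors, so that in charts it is an automorphism of the Coxeter complex ([gam]), not always an
   element of the affine Weyl group. The chart in which sigma_+ and sigma_- are opposite faces need
   not contain an axis of gamma, so the axis and the lines of the chart are compared up to bounded
   distance only. Finally, that a pointwise limit q of automorphisms sending sigma_- to sigma' does
   the same is not formal: q also fixes sigma_+, a ray opposite to a nearly known one is itself
   nearly known, and convexity turns this into an equality of ideal points. *)
Require Import Defs.
From mathcomp Require Import all_boot all_order all_algebra ring lra.
From mathcomp Require Import all_classical all_reals topology normedtype.
Set Implicit Arguments.
Unset Strict Implicit.
Unset Printing Implicit Defensive.
Import Order.TTheory GRing.Theory Num.Theory.
Import numFieldNormedType.Exports.
Local Open Scope classical_set_scope.
Local Open Scope ring_scope.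
(* [normedtype] also exports an [edist]. *)
Local Notation edist := Defs.edist.

(** * Contraction modulo a closed subgroup *)

Section Contraction.
Local Open Scope group_scope.
(** [V] stands for a basis of neighborhoods of 1 made of open subgroups, with [V 0] compact:
    [Vconj], [alC] and [beC] express continuity at 1, [Vcluster] sequential compactness. The map
    [be] is the inverse of [al]. *)
Context {T : groupType} (V : nat -> set T) (al be : T -> T).
Hypothesis Vsub : forall j, subgroup (V j).
Hypothesis Vdec : forall i j, (i <= j)%N -> V j `<=` V i.
Hypothesis Vconj : forall g j, exists k, forall v, V k v -> V j (g * v * g^-1).
Hypothesis Vcluster : forall a : nat -> T, (forall n, V 0 (a n)) ->
  exists g, forall j N, exists2 n, (N <= n)%N & V j (g^-1 * a n).
Hypothesis alM : {morph al : x y / x * y}.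
Hypothesis beM : {morph be : x y / x * y}.
Hypothesis alK : cancel al be.
Hypothesis beK : cancel be al.
Hypothesis alC : forall j, exists k, forall v, V k v -> V j (al v).
Hypothesis beC : forall j, exists k, forall v, V k v -> V j (be v).

Lemma subgroup1 (H : set T) : subgroup H -> H 1. Proof. by case. Qed.
Lemma subgroupV (H : set T) x : subgroup H -> H x -> H x^-1.
Proof. by move=> [H1 Hd] /(Hd _ _ H1); rewrite mul1g. Qed.
Lemma subgroupM (H : set T) x y : subgroup H -> H x -> H y -> H (x * y).
Proof.
by move=> sH Hx Hy; rewrite -[y]invgK; apply: sH.2 => //; apply: subgroupV.
Qed.

Lemma morph_inv (f : T -> T) x : {morph f : x y / x * y} -> f x^-1 = (f x)^-1.
Proof.
move=> fM; apply: (mulgI (f x)); rewrite -fM !mulgV.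
by apply: (mulgI (f 1)); rewrite -fM !mulg1.
Qed.

Lemma iter_morph (f : T -> T) n : {morph f : x y / x * y} ->
  {morph iter n f : x y / x * y}.
Proof. by move=> fM x y; elim: n => //= n ->. Qed.

Lemma iter_morph1 (f : T -> T) n : {morph f : x y / x * y} -> iter n f 1 = 1.
Proof.
by move=> fM; apply: (mulgI (iter n f 1)); rewrite -iter_morph // !mulg1.
Qed.

Lemma iterK (f g : T -> T) n : cancel f g -> cancel (iter n f) (iter n g).
Proof. by move=> fK x; elim: n => //= n IH; rewrite -iterS iterSr fK. Qed.

Lemma iter_cont (f : T -> T) n :
  (forall j, exists k, forall v, V k v -> V j (f v)) ->
  forall j, exists k, forall v, V k v -> V j (iter n f v).
Proof.
move=> fC; elim: n => [|n IH] j; first by exists j.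
have [k hk] := fC j; have [i hi] := IH k.
by exists i => v /hi /hk.
Qed.

(** The left cosets [x * V j] serve as the basic neighborhoods of [x]. *)
Definition closedV (A : set T) :=
  forall x, (forall j, exists2 a, A a & V j (x^-1 * a)) -> A x.

Lemma closedV_V j : closedV (V j).
Proof.
move=> x /(_ j) [a Va Vxa].
have -> : x = a * (x^-1 * a)^-1 by rewrite invgM invgK mulgA mulgV mul1g.
exact: (Vsub j).2.
Qed.

Lemma closedV_preim (f : T -> T) A : {morph f : x y / x * y} ->
  (forall j, exists k, forall v, V k v -> V j (f v)) ->
  closedV A -> closedV [set x | A (f x)].
Proof.
move=> fM fC cA x hx /=; apply: cA => j; have [k hk] := fC j.
have [a Aa /hk] := hx k; rewrite fM morph_inv // => ?; by exists (f a).
Qed.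

Lemma closedV_setI A B : closedV A -> closedV B -> closedV (A `&` B).
Proof.
by move=> cA cB x hx; split; [apply: cA|apply: cB] => j;
  have [a [? ?] ?] := hx j; exists a.
Qed.

Lemma closedV_forall I (A : I -> set T) :
  (forall i, closedV (A i)) -> closedV [set x | forall i, A i x].
Proof.
by move=> cA x hx i; apply: cA => j; have [a Aa ?] := hx j; exists a.
Qed.

(** Inversion exchanges left and right cosets of [V k]; conjugation by [x^-1 * t] converts them
    back. *)
Lemma closedV_div A x : closedV A -> closedV [set t | A (t^-1 * x)].
Proof.
move=> cA t ht /=; apply: cA => j; have [k hk] := Vconj (x^-1 * t) j.
have [a Aa /= Vta] := ht k; exists (a^-1 * x) => //.
have -> : (t^-1 * x)^-1 * (a^-1 * x) =
   (x^-1 * t) * (t^-1 * a)^-1 * (x^-1 * t)^-1.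
  by rewrite !invgM !invgK !mulgA !mulgK.
by apply: hk; apply: subgroupV.
Qed.

Lemma closedV_coset A h : closedV A -> closedV [set t | A (h^-1 * t)].
Proof.
move=> cA t ht /=; apply: cA => j; have [a Aa Vta] := ht j.
exists (h^-1 * a) => //; by rewrite invgM invgK -!mulgA mulVKg.
Qed.

Lemma cluster_coset h (a : nat -> T) : (forall n, V 0 (h^-1 * a n)) ->
  exists g, forall j N, exists2 n, (N <= n)%N & V j (g^-1 * a n).
Proof.
move=> /Vcluster [g hg]; exists (h * g) => j N; have [n Nn Vn] := hg j N.
by exists n => //; rewrite invgM -mulgA.
Qed.

(** Cantor's intersection theorem in the compact coset [h * V 0]. *)
Lemma nested_closed (A : nat -> set T) h :
  (forall n, A n.+1 `<=` A n) -> (forall n, closedV (A n)) ->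
  (forall n, A n !=set0) -> (forall x, A 0 x -> V 0 (h^-1 * x)) ->
  exists x, forall n, A n x.
Proof.
move=> Adec Acl /choice [a Aa] A0.
have Amono n m x : (n <= m)%N -> A m x -> A n x.
  by move=> /subnK <-; elim: (m - n)%N => //= k IH /Adec.
have [g hg] := cluster_coset (fun n => A0 _ (Amono 0 n _ (leq0n n) (Aa n))).
exists g => n; apply: Acl => j; have [m nm Vm] := hg j n.
by exists (a m) => //; apply: Amono (Aa m).
Qed.

(** * Tidy subgroups and the shadowing of pseudo-orbits *)

Section Tidy.
Variable H : set T.
Hypothesis Hsub : subgroup H.
Hypothesis Hcl : closedV H.
Hypothesis Hal : forall x, H x -> H (al x).
Hypothesis Hbe : forall x, H x -> H (be x).

Lemma Hiter f n x : (forall x, H x -> H (f x)) -> H x -> H (iter n f x).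
Proof. by move=> Hf Hx; elim: n => //= n /Hf. Qed.

(* In Willis' terminology, [O] is tidy above for [al]. *)
Lemma tidy_above j : exists O : set T, [/\ subgroup O, O `<=` H, O `<=` V j,
   exists k, H `&` V k `<=` O &
   forall x, O x -> exists s t, [/\ x = s * t, forall i, O (iter i al s) &
     forall i, O (iter i be t)]].
Proof.
pose P := H `&` V j.
have Psub : subgroup P.
  split; first by split; apply: subgroup1.
  by move=> x y [? ?] [? ?]; split; [apply: Hsub.2|apply: (Vsub j).2].
have Pcl : closedV P by apply: closedV_setI => //; exact: closedV_V.
pose Vn n := [set x | forall k, (k <= n)%N -> P (iter k be x)].
pose Vp := [set x | forall k, P (iter k be x)].
have VpV n : Vp `<=` Vn n by move=> x hx k _.
have clVn n : closedV (Vn n).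
  apply: closedV_forall => k; apply: closedV_forall => _.
  by apply: closedV_preim => //; [exact: iter_morph|exact: iter_cont].
have clVp : closedV Vp.
  apply: closedV_forall => k.
  by apply: closedV_preim => //; [exact: iter_morph|exact: iter_cont].
have sVn n : subgroup (Vn n).
  split=> [k _|x y hx hy k kn].
    by rewrite iter_morph1 //; exact: subgroup1.
  rewrite iter_morph // morph_inv; last exact: iter_morph.
  by apply: Psub.2; [apply: hx|apply: hy].
have sVp : subgroup Vp.
  by split=> [k|x y hx hy k]; [exact: (sVn k).1|apply: ((sVn k).2 x y)] => //;
    exact: VpV.
(* The closed sets [Vn n] decrease to [Vp], and the products of [Vp] with the elements that [al]
   sends into [P] cover a neighborhood of [Vp]; by compactness they cover some [Vn n]. *)
have [n hn] : exists n, forall x, Vn n x ->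
    exists t s, [/\ Vp t, P (al s) & x = t * s].
  apply: contrapT => /forallNP hN.
  have {}hN n : exists x, Vn n x /\ ~ exists t s, [/\ Vp t, P (al s) & x = t * s].
    by have /existsNP [x /not_implyP] := hN n; exists x.
  have [a Ha] := choice hN.
  have [|x hx] := @Vcluster a.
    move=> n; apply: (Vdec (leq0n j)); exact: ((Ha n).1 0%N (leq0n n)).2.
  have Vpx : Vp x.
    move=> k; apply: (@closedV_preim (iter k be) P) => //; [exact: iter_morph|
      exact: iter_cont|] => i.
    have [m km Vm] := hx i k; exists (a m) => //; exact: (Ha m).1.
  have [k hk] := alC j; have [m _ Vm] := hx k 0%N.
  have [am] := Ha m; apply; exists x, (x^-1 * a m); split=> //; last first.
    by rewrite mulVKg.
  split; last exact: hk.
  apply/Hal/(subgroupM Hsub); first exact: (subgroupV Hsub (Vpx 0%N).1).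
  exact: (am 0%N (leq0n m)).1.
pose O := Vn n; exists O; have sO : subgroup O := sVn n.
have OP : O `<=` P by move=> x hx; exact: (hx 0%N (leq0n n)).
have hO x : O x -> exists t s, [/\ Vp t, O s, O (al s) & x = t * s].
  move=> Ox; have [t [s [Vt Ps xE]]] := hn x Ox; exists t, s.
  have Os : O s.
    have -> : s = t^-1 * x by rewrite xE mulKg.
    by apply: (subgroupM sO) => //; apply: (subgroupV sO); exact: VpV.
  split=> //; move=> [|k] kn //=; rewrite -iterS iterSr alK; apply: Os.
  exact: ltnW.
have Vpbe t : Vp t -> Vp (be t) by move=> ht k; rewrite -iterSr; exact: ht.
pose Om k := [set s | forall i, (i <= k)%N -> O (iter i al s)].
(* Splitting [al s] again as [t' * s'] lets [be t'], still in [Vp], move over to the left factor and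
   gains one forward iterate. *)
have hOm k x : O x -> exists t, Vp t /\ Om k (t^-1 * x).
  elim: k x => [|k IH] x Ox.
    exists 1; split; first exact: (subgroup1 sVp).
    by move=> i; rewrite leqn0 => /eqP ->; rewrite /= invg1 mul1g.
  have [t [s [Vt Os Oas xE]]] := hO x Ox.
  have [t' [Vt' Omt']] := IH _ Oas.
  exists (t * be t'); split; first by apply: (subgroupM sVp) => //; exact: Vpbe.
  have -> : (t * be t')^-1 * x = (be t')^-1 * s by rewrite xE invgM -!mulgA mulKg.
  move=> [_|i ik] /=.
    by apply: (subgroupM sO) => //; apply: (subgroupV sO); apply/VpV/Vpbe.
  rewrite -iterS iterSr alM morph_inv // beK; exact: Omt'.
have tid x : O x -> exists t, Vp t /\ forall i, O (iter i al (t^-1 * x)).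
  move=> Ox; have [||||t ht] := @nested_closed
     (fun k => [set t | Vp t /\ Om k (t^-1 * x)]) 1.
  - by move=> k t [Vt ht]; split=> // i ik; apply: ht; exact: leqW.
  - move=> k; apply: closedV_setI => //; apply: closedV_div.
    apply: closedV_forall => i; apply: closedV_forall => _.
    by apply: closedV_preim => //; [exact: iter_morph|exact: iter_cont|exact: clVn].
  - by move=> k; exact: hOm.
  - move=> t [Vt _]; rewrite invg1 mul1g; apply: (Vdec (leq0n j)).
    exact: (Vt 0%N).2.
  by exists t; split=> [|i]; [exact: (ht 0%N).1|exact: (ht i).2].
split=> //; first by move=> x /OP [].
- by move=> x /OP [].
- suff [k hk] : exists k, forall i, (i <= n)%N ->
      forall v, V k v -> V j (iter i be v).
    exists k => v [Hv Vv] i iN; split; first exact: Hiter.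
    exact: hk.
  elim: (n) => [|m [k hk]].
    by exists j => i; rewrite leqn0 => /eqP ->.
  have [k' hk'] := iter_cont m.+1 beC j.
  exists (maxn k k') => i; rewrite leq_eqVlt => /orP[/eqP ->|im] v Vv.
    by apply: hk'; apply: Vdec Vv; exact: leq_maxr.
  by apply: hk => //; apply: Vdec Vv; exact: leq_maxl.
(* [tid] puts the factor from [Vp] on the left; it is applied to [x^-1] because here that factor
   must be on the right. *)
- move=> x Ox; have [t [Vt ht]] := tid _ (subgroupV sO Ox).
  exists (t^-1 * x^-1)^-1, t^-1; split=> [|i|i].
  + by rewrite invgM !invgK mulgK.
  + rewrite morph_inv; last exact: iter_morph.
    by apply: (subgroupV sO); exact: ht.
  + rewrite morph_inv; last exact: iter_morph.
    apply: (subgroupV sO); apply: VpV => k; rewrite -iterD; exact: Vt.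
Qed.

Definition eventually_in (A : set T) (x : T) :=
  exists N, forall n, (N <= n)%N -> A (iter n al x).

(* A pseudo-orbit [h] of [al] in [H] with errors in [O] is followed up to [O] by
   a true orbit: the defect is kept in the part of [O] contracting to the future,
   the other part being absorbed by modifying the initial point. *)
Lemma shadowing_from0 (O : set T) (h : nat -> T) :
  subgroup O -> O `<=` H ->
  (forall x, O x -> exists s t, [/\ x = s * t, forall i, O (iter i al s) &
     forall i, O (iter i be t)]) ->
  (forall n, H (h n)) -> (forall n, O ((al (h n))^-1 * h n.+1)) ->
  forall N, exists2 c, H c & forall n, (n <= N)%N -> O ((h n)^-1 * iter n al c).
Proof.
move=> sO OH dec Hh he N.
(* The induction also keeps all forward iterates of the last defect in [O]; thus the next defect,
   the product of the inverse of an error with the image under [al] of this one, is again in [O]. *)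
suff [c [Hc hc _]] : exists c, [/\ H c,
    forall n, (n <= N)%N -> O ((h n)^-1 * iter n al c) &
    forall i, O (iter i al ((h N)^-1 * iter N al c))] by exists c.
elim: N => [|N [c [Hc hc hN]]].
  exists (h 0%N); split=> // [n|i].
    by rewrite leqn0 => /eqP -> /=; rewrite mulVg; exact: subgroup1.
  by rewrite mulVg iter_morph1 //; exact: subgroup1.
have ON : O ((h N.+1)^-1 * iter N.+1 al c).
  have -> : (h N.+1)^-1 * iter N.+1 al c =
      ((al (h N))^-1 * h N.+1)^-1 * al ((h N)^-1 * iter N al c).
    by rewrite alM morph_inv // invgM invgK -!mulgA mulVKg.
  by apply: subgroupM => //; [exact: subgroupV|exact: (hN 1%N)].
have [s [t [stE hs ht]]] := dec _ ON.
have alib i k : iter (i + k) al (iter k be t^-1) = iter i al t^-1.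
  by rewrite iterD iterK.
(* This factor cancels [t] at time [N.+1] and alters the earlier terms by backward iterates of
   [t^-1] only, which stay in [O]. *)
exists (c * iter N.+1 be t^-1); split.
- apply: subgroupM => //; apply: Hiter => //; apply: subgroupV => //.
  exact/OH/(ht 0%N).
- move=> n nN; rewrite iter_morph // mulgA.
  have -> : iter n al (iter N.+1 be t^-1) = iter (N.+1 - n) be t^-1.
    by rewrite -{1}(subnKC nN) iterD iterK.
  apply: subgroupM => //.
    by move: nN; rewrite leq_eqVlt => /orP[/eqP ->|/hc].
  rewrite morph_inv; last exact: iter_morph.
  exact: subgroupV.
- move=> i; rewrite iter_morph // mulgA (alib 0%N N.+1) stE mulgK; exact: hs.
Qed.

(** Elements [h n] of [H] that push the orbit of [x] into a small [V i] form a pseudo-orbit of [al].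
    A true orbit following it corrects [x] for all times at once; such orbits are found on finite
    stretches, then for all times by compactness. *)
Lemma shadowing j x : (forall i, exists N, forall n, (N <= n)%N ->
    mulset (V i) H (iter n al x)) ->
  exists2 c, H c & eventually_in (V j) (x * c).
Proof.
move=> hx; have [O [sO OH OV [k hk] dec]] := tidy_above j.
have [k' hk'] := alC k; pose i := maxn (maxn j k) k'.
have Vi_j : V i `<=` V j by apply: Vdec; rewrite /i !leq_max leqnn.
have Vi_k : V i `<=` V k by apply: Vdec; rewrite /i !leq_max leqnn orbT.
have Vi_k' : V i `<=` V k' by apply: Vdec; rewrite /i !leq_max leqnn !orbT.
have [N hN] := hx i.
have /choice [h hh] n : exists h, H h /\ V i (iter (n + N) al x * h).
  have [v Vv [m Hm xE]] := hN _ (leq_addl n N).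
  by exists m^-1; split; [exact: subgroupV|rewrite -xE mulgK].
have he n : O ((al (h n))^-1 * h n.+1).
  apply: hk; split.
    by apply: subgroupM => //; [apply: subgroupV => //; apply: Hal|];
      exact: (hh _).1.
  have -> : (al (h n))^-1 * h n.+1 =
    (al (iter (n + N) al x * h n))^-1 * (iter (n.+1 + N) al x * h n.+1).
    by rewrite alM invgM -!mulgA mulKg.
  apply: subgroupM => //; last exact/Vi_k/(hh _).2.
  by apply: subgroupV => //; apply/hk'/Vi_k'/(hh _).2.
have {}hsh := shadowing_from0 sO OH dec (fun n => (hh n).1) he.
have [||||c hc] := @nested_closed (fun M => [set c | H c /\
     V 0 ((h 0%N)^-1 * c) /\ forall n, (n <= M)%N ->
     V j (iter n al (iter N al x * c))]) (h 0%N).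
- by move=> M c [? [? hc]]; split=> //; split=> // n nM; apply: hc; exact: leqW.
- move=> M; apply: closedV_setI => //; apply: closedV_setI.
    by apply: closedV_coset; exact: closedV_V.
  apply: closedV_forall => n; apply: closedV_forall => nM.
  have : closedV [set c | V j ((iter n al (iter N al x))^-1^-1 * iter n al c)].
    apply: (@closedV_preim (iter n al) [set c | V j (_^-1^-1 * c)]).
    - exact: iter_morph.
    - exact: iter_cont.
    - by apply: (@closedV_coset _ (iter n al (iter N al x))^-1); exact: closedV_V.
  by under eq_set do rewrite invgK -iter_morph //.
- move=> M; have [c Hc hc] := hsh M; exists c; split=> //; split.
    by apply: (Vdec (leq0n j)); apply: OV; exact: (hc 0%N).
  move=> n nM; rewrite iter_morph // -iterD.
  have -> : iter (n + N) al x * iter n al c =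
     (iter (n + N) al x * h n) * ((h n)^-1 * iter n al c).
    by rewrite -!mulgA mulVKg.
  by apply: subgroupM => //; [exact/Vi_j/(hh _).2|apply: OV; exact: hc].
- by move=> c [_ []].
(* The shadowing started at time [N]; [be] carries the corrector back to time 0. *)
exists (iter N be c); first by apply: Hiter => //; exact: (hc 0%N).1.
exists N => n Nn; have [_ [_ /(_ (n - N)%N (leqnn _))]] := hc (n - N)%N.
by rewrite -{1}(iterK N beK c) -iter_morph // -iterD subnK.
Qed.

End Tidy.

(* A theorem of Baumgartner and Willis: [x] belongs to [U M], where [U] is the
   contraction group of [al]. *)
Theorem contraction_mod (M : set T) (x : T) :
  subgroup M -> closedV M -> (forall y, M y -> M (al y)) ->
  (forall y, M y -> M (be y)) ->
  (forall i, exists N, forall n, (N <= n)%N -> mulset (V i) M (iter n al x)) ->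
  exists2 c, M c & forall j, eventually_in (V j) (x * c).
Proof.
move=> sM cM Mal Mbe hx.
(* The elements of [M] with their two-sided orbit in [V j]: once an orbit stays in [V j], its limits
   in [M] lie here, so the next correction can be taken from this smaller group. *)
pose Hj j := [set h | [/\ M h, forall n, V j (iter n al h) &
  forall n, V j (iter n be h)]].
pose HH j := if j is i.+1 then Hj i else M.
have sHj j : subgroup (Hj j).
  split=> [|y z [My ay by_] [Mz az bz]].
    by split=> [|n|n]; [|rewrite iter_morph1 //..]; exact: subgroup1.
  split; first exact: sM.2.
  - move=> n; rewrite iter_morph // morph_inv; last exact: iter_morph.
    exact: (Vsub j).2.
  - move=> n; rewrite iter_morph // morph_inv; last exact: iter_morph.
    exact: (Vsub j).2.
have cHj j : closedV (Hj j).
  have -> : Hj j = M `&` ([set h | forall n, V j (iter n al h)] `&`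
      [set h | forall n, V j (iter n be h)]).
    by apply/seteqP; split=> h; [move=> [] | move=> [? []]].
  apply: closedV_setI => //; apply: closedV_setI; apply: closedV_forall => n.
    exact: (closedV_preim (iter_morph n alM) (iter_cont n alC) (@closedV_V j)).
  exact: (closedV_preim (iter_morph n beM) (iter_cont n beC) (@closedV_V j)).
have Hjal j y : Hj j y -> Hj j (al y).
  move=> [My ay by_]; split; [exact: Mal|by move=> n; rewrite -iterSr; exact: ay|].
  by move=> [|n]; [exact: (ay 1%N)|rewrite iterSr alK; exact: by_].
have Hjbe j y : Hj j y -> Hj j (be y).
  move=> [My ay by_]; split; [exact: Mbe| |by move=> n; rewrite -iterSr; exact: by_].
  by move=> [|n]; [exact: (by_ 1%N)|rewrite iterSr beK; exact: ay].
have sHH j : subgroup (HH j) by case: j.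
have cHH j : closedV (HH j) by case: j.
have HHal j y : HH j y -> HH j (al y) by case: j => [/Mal|j /Hjal].
have HHbe j y : HH j y -> HH j (be y) by case: j => [/Mbe|j /Hjbe].
have HHM j : HH j `<=` M by case: j => // j y [].
have HHdec j : HH j.+1 `<=` HH j.
  case: j => [|j] y [] // My ay by_; split=> // n.
    exact: (Vdec (leqnSn j)).
  exact: (Vdec (leqnSn j)).
pose good j z := M z /\ (forall i, exists N, forall n, (N <= n)%N ->
   mulset (V i) (HH j) (iter n al (x * z))).
(* One step: correct [x z] by an element of [HH j] so that its orbit ends up in
   [V j], hence near [HH j.+1] by compactness. *)
have step j z : good j z -> exists c, [/\ HH j c, good j.+1 (z * c) &
    eventually_in (V j) (x * (z * c))].
  move=> [Mz gz]; have [c Hc [N hN]] :=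
    @shadowing (HH j) (sHH j) (cHH j) (HHal j) (HHbe j) j (x * z) gz.
  exists c; rewrite mulgA; split=> //; last by exists N.
  split; first by apply: subgroupM => //; exact: HHM Hc.
  rewrite mulgA; set y := x * z * c in hN *.
  have gy i : exists N, forall n, (N <= n)%N -> mulset (V i) (HH j) (iter n al y).
    have [K hK] := gz i; exists K => n Kn.
    have [v Vv [m Hm vmE]] := hK n Kn.
    exists v => //; exists (m * iter n al c).
      apply: (subgroupM (sHH j)) => //; apply: (@Hiter (HH j)) => //; exact: HHal.
    by rewrite mulgA vmE -iter_morph.
  (* Otherwise the orbit leaves [mulset (V i) (Hj j)] at arbitrarily late times; a cluster point [h]
     of these terms is in [M] and has its whole orbit in [V j], hence is in [Hj j]. *)
  move=> i; apply: contrapT => /forallNP hbad.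
  have /choice [a ha] n : exists m, [/\ (n + N <= m)%N &
      ~ mulset (V i) (Hj j) (iter m al y)].
    have /existsNP [m /not_implyP [? ?]] := hbad (n + N)%N.
    by exists m.
  have Na n : (N <= a n)%N by apply: leq_trans (ha n).1; exact: leq_addl.
  have na n : (n <= a n)%N by apply: leq_trans (ha n).1; exact: leq_addr.
  have [|h hh] := @Vcluster (fun n => iter (a n) al y).
    by move=> n; apply: (Vdec (leq0n j)); apply: hN; exact: Na.
  have Mh : M h.
    apply: cM => k; have [k1 hk1] := Vconj h^-1 k.
    have [k2 hk2] := Vconj 1 k.
    have [K hK] := gy (maxn k k1).
    have [n Kn Vn] := hh k K.
    have [v Vv [m Hm vmE]] := hK _ (leq_trans Kn (na n)).
    exists m; first exact: HHM Hm.
    have -> : h^-1 * m = h^-1 * v^-1 * h^-1^-1 * (h^-1 * iter (a n) al y).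
      by rewrite -vmE invgK -!mulgA mulVKg mulKg.
    apply: (subgroupM (Vsub k)) => //; apply/hk1/(subgroupV (Vsub k1)).
    by apply: Vdec Vv; exact: leq_maxr.
  have Hh : Hj j h.
    split=> // k; [have fM := iter_morph k alM; have fC := iter_cont k alC|
      have fM := iter_morph k beM; have fC := iter_cont k beC].
      apply: (closedV_preim fM fC (@closedV_V j)) => l.
      have [n _ Vn] := hh l 0%N; exists (iter (a n) al y) => //=.
      by rewrite -iterD; apply: hN; apply: leq_trans (Na n) (leq_addl _ _).
    (* For backward iterates the index is taken beyond [k], so that [k] steps back from time [a n]
       still leave a time after [N]. *)
    apply: (closedV_preim fM fC (@closedV_V j)) => l.
    have [n kn Vn] := hh l k; exists (iter (a n) al y) => //=.
    have kan : (k + N <= a n)%N.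
      by apply: leq_trans (ha n).1; rewrite leq_add2r.
    rewrite -(subnKC (leq_trans (leq_addr _ _) kan)) iterD.
    by rewrite iterK //; apply: hN; rewrite leq_subRL // (leq_trans (leq_addr _ _) kan).
  have [k hk] := Vconj h i; have [n _ Vn] := hh k 0%N.
  have [_] := ha n; apply; exists (h * (h^-1 * iter (a n) al y) * h^-1).
    exact: hk.
  by exists h => //; rewrite mulVKg mulgVK.
have good0 : good 0%N 1 by split; [exact: subgroup1|rewrite mulg1].
have [z [z0 hz]] : exists z : nat -> T, z 0%N = 1 /\
    forall j, [/\ HH j ((z j)^-1 * z j.+1), good j.+1 (z j.+1) &
      eventually_in (V j) (x * z j.+1)].
  have /choice [f hf] (p : nat * T) : exists c, good p.1 p.2 ->
     [/\ HH p.1 c, good p.1.+1 (p.2 * c) &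
       eventually_in (V p.1) (x * (p.2 * c))].
    have [/step [c ?]|ng] := pselect (good p.1 p.2); first by exists c.
    by exists 1.
  pose fix z n := if n is m.+1 then z m * f (m, z m) else 1.
  have gz n : good n (z n).
    by elim: n => //= n /(hf (n, z n)) [].
  exists z; split=> // j; have [? ? ?] := hf (j, z j) (gz j).
  by split=> //=; rewrite mulKg.
have HHmono j k : HH (j + k)%N `<=` HH j.
  by elim: k => [|k IH] y; [rewrite addn0|rewrite addnS => /HHdec /IH].
have zj j n : (j <= n)%N -> HH j ((z j)^-1 * z n).
  move=> /subnKC <-; elim: (n - j)%N => [|k IH].
    by rewrite addn0 mulVg; exact: subgroup1.
  rewrite addnS -(mulVKg (z (j + k)%N) (z _.+1)) mulgA; apply: (subgroupM (sHH j)) => //.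
  by apply: (HHmono j k); have [] := hz (j + k)%N.
(* Modulo [HH j] the terms no longer change after [z j], so a cluster point [c] differs from
   [z j.+1] by an element whose orbit stays in [V j]. The sequence starts at [z 1] because [HH 1] is
   inside the compact [V 0], while [HH 0] is [M]. *)
have [|c hc] := @cluster_coset (z 1%N) (fun n => z n.+1).
  by move=> n; have [_ /(_ 0%N)] := zj 1%N n.+1 isT.
have cz j : HH j ((z j)^-1 * c).
  apply: (closedV_coset (h := z j) (cHH j)) => i.
  have [n jn Vn] := hc i j; exists (z n.+1) => //=; apply: zj.
  exact: leqW.
exists c; first by have := cz 0%N; rewrite z0 invg1 mul1g.
move=> j; have [_ _ [N hN]] := hz j; exists N => n Nn.
have -> : x * c = x * z j.+1 * ((z j.+1)^-1 * c) by rewrite -mulgA mulVKg.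
rewrite iter_morph //; apply: subgroupM => //; first exact: hN.
by have [_ + _] := cz j.+1; apply.
Qed.

End Contraction.

(** * Euclidean space *)

Section Finite.

Lemma finite_set_ind T (Q : set T -> Prop) : Q set0 ->
  (forall x A, finite_set A -> Q A -> Q ([set x] `|` A)) -> forall A, finite_set A -> Q A.
Proof.
move=> Q0 QU A /(@finite_seqP {classic T}) [s ->].
elim: s => [|x s IH].
  by rewrite (_ : [set` _] = set0) //; apply/seteqP; split.
rewrite (_ : [set` _] = [set x] `|` [set` s]).
  by apply: QU => //; apply/(@finite_seqP {classic T}); exists s.
apply/seteqP; split=> y /=; rewrite inE; first by move=> /orP[/eqP|]; [left|right].
by move=> [->|->]; rewrite ?eqxx ?orbT.
Qed.

Lemma finite_filter I T (F : set_system T) {FF : Filter F} (A : set I)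
    (P : I -> set T) : finite_set A -> (forall i, A i -> F (P i)) ->
  F [set t | forall i, A i -> P i t].
Proof.
elim/finite_set_ind => [_|x {}A finA IH hP]; first by apply: filterS filterT => t _ i [].
have FA : F [set t | forall i, A i -> P i t] by apply: IH => i Ai; apply: hP; right.
have Fx := hP x (or_introl erefl).
by apply: filterS (filterI Fx FA) => t [Pt At] i [->//|/At].
Qed.

Lemma finite_small (R : realType) I (A : set I) (P : I -> R -> Prop) :
  finite_set A ->
  (forall i, A i -> exists2 e, 0 < e & forall t, 0 < t < e -> P i t) ->
  exists2 e, 0 < e & forall t, 0 < t < e -> forall i, A i -> P i t.
Proof.
elim/finite_set_ind => [_|x {}A finA IH hP]; first by exists 1.
have [e e0 he] := hP x (or_introl erefl).
have [|f f0 hf] := IH; first by move=> i Ai; apply: hP; right.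
exists (Num.min e f) => [|t]; first by rewrite lt_min e0.
by rewrite lt_min => /and3P[t0 te tf] i [->|/hf]; [apply: he|apply]; rewrite t0.
Qed.

Lemma finite_argmax (R : realType) I (A : set I) (f : I -> R) : finite_set A ->
  A !=set0 -> exists2 x, A x & forall y, A y -> f y <= f x.
Proof.
elim/finite_set_ind => [[]//|x {}A finA IH _].
have [/IH [y Ay hy]|/nonemptyPn A0] := pselect (A !=set0).
  have [xy|yx] := leP (f x) (f y).
    by exists y; [right|move=> z [->|/hy]].
  exists x; first by left.
  by move=> z [->//|/hy /le_trans]; apply; exact: ltW.
by exists x; [left|rewrite A0 => z [->|]].
Qed.

Lemma finite_funs n X (P : 'I_n -> set X) : (forall i, finite_set (P i)) ->
  finite_set [set f : 'I_n -> X | forall i, P i (f i)].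
Proof.
move=> Pfin; have : finite_set (\bigcup_i P i) by exact: bigcup_finite.
move=> /(@finite_seqP {classic X}) [s sE].
apply: (@sub_finite_set _ _ ((fun (e : {ffun 'I_n -> 'I_(size s)}) (i : 'I_n) =>
   tnth (in_tuple s) (e i) : X) @` setT)); last exact/finite_image/finite_finset.
move=> f hf /=.
have /choice [e he] (i : 'I_n) : exists k : 'I_(size s), tnth (in_tuple s) k = f i.
  have : (\bigcup_i P i) (f i) by exists i.
  by rewrite sE /= => /seq_tnthP [k ->]; exists k.
by exists (finfun e) => //; apply/funext => i; rewrite ffunE he.
Qed.

End Finite.

Section RealInduction.
Context {R : realType}.

(** Connectedness of the unit interval as an induction principle, proved at the supremum of the
    initial segments on which [Q] holds; it propagates local statements along a segment. *)
Lemma real_induction (Q : R -> Prop) : Q 0 ->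
  (forall t, 0 <= t < 1 -> Q t ->
     exists2 e, 0 < e & forall s, t < s < t + e -> Q s) ->
  (forall t, 0 < t <= 1 -> (forall s, 0 <= s < t -> Q s) -> Q t) ->
  Q 1.
Proof.
move=> Q0 Qr Ql.
pose S := [set t | 0 <= t <= 1 /\ forall s, 0 <= s <= t -> Q s].
have S0 : S 0.
  by split=> [|s]; rewrite ?lexx ?ler01// => /le_anti <-.
have S1 t : S t -> t <= 1 by move=> [/andP[]].
have supS : has_sup S by split; [exists 0|exists 1].
set t := sup S.
have t0 : 0 <= t by apply: ub_le_sup => //; exists 1.
have t1 : t <= 1 by apply: ge_sup => //; exists 0.
have Qlt s : 0 <= s < t -> Q s.
  move=> /andP[s0 st]; 
  have ts0 : 0 < t - s by rewrite subr_gt0.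
  have [u [_ Su] su] := sup_adherent ts0 supS.
  by apply: Su; rewrite s0/=; apply: ltW; move: su; rewrite -/t; lra.
have Qt : Q t.
  move: (t0); rewrite le_eqVlt => /orP[/eqP <- //|t_gt0].
  by apply: Ql => //; rewrite t_gt0.
have St : S t.
  split=> [|s]; first by rewrite t0.
  move=> /andP[s0]; rewrite le_eqVlt => /orP[/eqP ->//|st].
  by apply: Qlt; rewrite s0.
move: (t1); rewrite le_eqVlt => /orP[/eqP tE|tl1]; first by rewrite -tE.
have [e e0 he] := Qr t (ltac:(by rewrite t0)) Qt.
pose u := Num.min 1 (t + e / 2).
have tu : t < u by rewrite lt_min tl1 ltrDl divr_gt0.
suff /(ub_le_sup (ltac:(by exists 1) : has_ubound S)) : S u.
  by rewrite -/t leNgt tu.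
split=> [|s /andP[s0 su]].
  by rewrite (le_trans t0 (ltW tu))/= ge_min lexx.
have [st|ts] := leP s t; first by apply: St.2; rewrite s0.
apply: he; rewrite ts/=; apply: le_lt_trans su _.
by rewrite gt_min; apply/orP; right; lra.
Qed.

(** The function [e] is not assumed symmetric, whence two local estimates. They compare [t] with
    nearby [s] only, which suits maps that are isometric on each side of a point but may fold
    there. *)
Lemma lipschitz_local_global (X : Type) (e : X -> X -> R) (F : R -> X) (K : R) :
  0 <= K -> (forall x, e x x = 0) ->
  (forall x y z, e x z <= e x y + e y z) ->
  (forall t, 0 <= t <= 1 -> exists2 d, 0 < d & forall s, `|s - t| < d ->
     e (F t) (F s) <= K * `|s - t| /\ e (F s) (F t) <= K * `|s - t|) ->
  e (F 0) (F 1) <= K.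
Proof.
move=> K0 e0 tri loc; rewrite -[leRHS]mulr1.
apply: (@real_induction (fun t => e (F 0) (F t) <= K * t)).
- by rewrite mulr0 e0.
- move=> t /andP[t0 t1] Qt; have [|d d0 hd] := loc t; first by rewrite t0 ltW.
  exists d => // s /andP[ts std]; apply: le_trans (tri _ (F t) _) _.
  have [|+ _] := hd s; first by rewrite ger0_norm; lra.
  rewrite ger0_norm; last lra.
  rewrite mulrBr; lra.
- move=> t /andP[t0 t1] Qs; have [|d d0 hd] := loc t; first by rewrite t1 ltW.
  pose s := Num.max 0 (t - d / 2).
  have st : s < t by rewrite gt_max t0 gtrDl oppr_lt0 divr_gt0.
  have sd : t - d / 2 <= s by rewrite le_max lexx orbT.
  have s0 : 0 <= s by rewrite le_max lexx.
  apply: le_trans (tri _ (F s) _) _.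
  have := Qs s; rewrite s0 st => /(_ isT) Qss.
  have [|_] := hd s; first by rewrite ltr0_norm; lra.
  rewrite ltr0_norm; last lra.
  rewrite opprB mulrBr; lra.
Qed.

End RealInduction.

Section Dot.
Context {R : realType} {n : nat}.
Implicit Types (x y z u v a : 'rV[R]_n).

Lemma dotC x y : dot x y = dot y x.
Proof. by apply: eq_bigr => i _; rewrite mulrC. Qed.
Lemma dotDl x y z : dot (x + y) z = dot x z + dot y z.
Proof. by rewrite /dot -big_split; apply: eq_bigr => i _; rewrite !mxE mulrDl. Qed.
Lemma dotDr x y z : dot z (x + y) = dot z x + dot z y.
Proof. by rewrite dotC dotDl !(dotC _ z). Qed.
Lemma dotZl c x y : dot (c *: x) y = c * dot x y.
Proof. by rewrite /dot mulr_sumr; apply: eq_bigr => i _; rewrite !mxE mulrA. Qed.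
Lemma dotZr c x y : dot x (c *: y) = c * dot x y.
Proof. by rewrite dotC dotZl dotC. Qed.
Lemma dotNl x y : dot (- x) y = - dot x y.
Proof. by rewrite -scaleN1r dotZl mulN1r. Qed.
Lemma dotNr x y : dot x (- y) = - dot x y.
Proof. by rewrite dotC dotNl dotC. Qed.
Lemma dotBl x y z : dot (x - y) z = dot x z - dot y z.
Proof. by rewrite dotDl dotNl. Qed.
Lemma dotBr x y z : dot z (x - y) = dot z x - dot z y.
Proof. by rewrite dotDr dotNr. Qed.
Lemma dot0l x : dot 0 x = 0.
Proof. by rewrite -(scale0r 0) dotZl mul0r. Qed.
Lemma dot0r x : dot x 0 = 0.
Proof. by rewrite dotC dot0l. Qed.

Definition dotE := (dotDl, dotDr, dotNl, dotNr, dotZl, dotZr, dot0l, dot0r).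

Lemma dot_ge0 x : 0 <= dot x x.
Proof. by apply: sumr_ge0 => i _; exact: sqr_ge0. Qed.

Lemma dot_eq0 x : dot x x = 0 -> x = 0.
Proof.
move=> /eqP; rewrite psumr_eq0 => [/allP hx|i _]; last exact: sqr_ge0.
apply/rowP => i; rewrite mxE; apply/eqP.
by have := hx i (mem_index_enum _); rewrite mulf_eq0 orbb.
Qed.

Lemma dot_gt0 x : x != 0 -> 0 < dot x x.
Proof.
by move=> x0; rewrite lt_neqAle dot_ge0 andbT eq_sym; apply: contra_neq x0 => /dot_eq0.
Qed.

Definition enorm x : R := Num.sqrt (dot x x).

Lemma enorm_ge0 x : 0 <= enorm x. Proof. exact: sqrtr_ge0. Qed.
Lemma sqr_enorm x : enorm x ^+ 2 = dot x x.
Proof. by rewrite sqr_sqrtr // dot_ge0. Qed.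
Lemma enorm0 : enorm 0 = 0. Proof. by rewrite /enorm dot0l sqrtr0. Qed.
Lemma enorm_eq0 x : enorm x = 0 -> x = 0.
Proof. by move=> h; apply: dot_eq0; rewrite -sqr_enorm h expr0n. Qed.
Lemma enormZ c x : enorm (c *: x) = `|c| * enorm x.
Proof. by rewrite /enorm !dotE mulrA -expr2 sqrtrM ?sqr_ge0 // sqrtr_sqr. Qed.
Lemma enormN x : enorm (- x) = enorm x.
Proof. by rewrite -scaleN1r enormZ normrN1 mul1r. Qed.

Lemma dot_le x y : dot x y <= enorm x * enorm y.
Proof.
have [->|x0] := eqVneq x 0; first by rewrite !dotE enorm0 mul0r.
have [->|y0] := eqVneq y 0; first by rewrite !dotE enorm0 mulr0.
have p z : z != 0 -> 0 < enorm z.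
  move=> z0; rewrite lt_neqAle enorm_ge0 andbT eq_sym.
  by apply: contra_neq z0 => /enorm_eq0.
have := dot_ge0 (enorm y *: x - enorm x *: y).
rewrite !dotE (dotC y x) -!sqr_enorm.
set a := enorm x; set b := enorm y; set d := dot x y => h.
have ab : 0 < a * b by rewrite mulr_gt0 ?p.
rewrite -subr_ge0 -(pmulr_rge0 _ ab); nra.
Qed.

Lemma enormD x y : enorm (x + y) <= enorm x + enorm y.
Proof.
rewrite -(@ler_pXn2r _ 2) ?nnegrE ?addr_ge0 ?enorm_ge0 // sqr_enorm !dotE.
by rewrite sqrrD !sqr_enorm (dotC y x); have := dot_le x y; lra.
Qed.

Lemma edistE x y : edist x y = enorm (x - y). Proof. by []. Qed.
Lemma edist_ge0 x y : 0 <= edist x y. Proof. exact: enorm_ge0. Qed.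
Lemma edistC x y : edist x y = edist y x.
Proof. by rewrite !edistE -enormN opprB. Qed.
Lemma edistxx x : edist x x = 0. Proof. by rewrite edistE subrr enorm0. Qed.
Lemma edist_eq0 x y : edist x y = 0 -> x = y.
Proof. by move=> /enorm_eq0 /eqP; rewrite subr_eq0 => /eqP. Qed.
Lemma edist_tri x y z : edist x z <= edist x y + edist y z.
Proof. by rewrite !edistE (le_trans _ (enormD _ _))// addrA subrK. Qed.
Lemma edistDl x y z : edist (x + y) (x + z) = edist y z.
Proof. by rewrite !edistE opprD addrACA subrr add0r. Qed.
Lemma edistr x u : edist x (x + u) = enorm u.
Proof. by rewrite edistE opprD addrA subrr sub0r enormN. Qed.
Lemma edistZr x s t : edist (s *: x) (t *: x) = `|s - t| * enorm x.
Proof. by rewrite edistE -scalerBl enormZ. Qed.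
Lemma sqr_edist x y : edist x y ^+ 2 = dot (x - y) (x - y).
Proof. by rewrite edistE sqr_enorm. Qed.

Definition iso (phi : 'rV[R]_n -> 'rV[R]_n) :=
  forall x y, edist (phi x) (phi y) = edist x y.
(* Locked because [dotE] would otherwise unfold it. *)
Definition lin (phi : 'rV[R]_n -> 'rV[R]_n) u := locked (phi u - phi 0).
Lemma linB0 phi u : lin phi u = phi u - phi 0. Proof. by rewrite /lin -lock. Qed.

Lemma lin_dot phi u v : iso phi -> dot (lin phi u) (lin phi v) = dot u v.
Proof.
move=> iphi.
have h w : dot (lin phi w) (lin phi w) = dot w w.
  by rewrite linB0 -sqr_edist iphi sqr_edist subr0.
have := iphi u v => /(congr1 (fun t => t ^+ 2)); rewrite !sqr_edist.
have -> : phi u - phi v = lin phi u - lin phi v by rewrite !linB0 opprB addrA subrK.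
rewrite !dotE !h (dotC (lin phi v)) (dotC v u); lra.
Qed.

(** Preservation of inner products suffices: the squared norm of the difference of both sides
    expands to 0. *)
Lemma linD phi u v : iso phi -> lin phi (u + v) = lin phi u + lin phi v.
Proof.
move=> i; apply/eqP; rewrite -subr_eq0; apply/eqP/dot_eq0.
rewrite !dotE !lin_dot // !dotE (dotC v u).
ring.
Qed.

Lemma linZ phi c u : iso phi -> lin phi (c *: u) = c *: lin phi u.
Proof.
move=> i; apply/eqP; rewrite -subr_eq0; apply/eqP/dot_eq0.
rewrite !dotE !lin_dot // !dotE; ring.
Qed.

Lemma lin0 phi : lin phi 0 = 0. Proof. by rewrite !linB0 subrr. Qed.
Lemma linN phi u : iso phi -> lin phi (- u) = - lin phi u.
Proof. by move=> i; rewrite -scaleN1r linZ // scaleN1r. Qed.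
Lemma linB phi u v : iso phi -> lin phi (u - v) = lin phi u - lin phi v.
Proof. by move=> i; rewrite linD // linN. Qed.

Lemma linE phi u : phi u = phi 0 + lin phi u.
Proof. by rewrite !linB0 addrCA subrr addr0. Qed.

Lemma isoD phi x u : iso phi -> phi (x + u) = phi x + lin phi u.
Proof. by move=> i; rewrite (linE _ (x + u)) linD // addrA -linE. Qed.

Lemma isoB phi x y : iso phi -> phi x - phi y = lin phi (x - y).
Proof. by move=> i; rewrite linB // !linB0 opprB addrA subrK. Qed.

Lemma iso_comp phi psi : iso phi -> iso psi -> iso (phi \o psi).
Proof. by move=> i j x y /=; rewrite i j. Qed.

Lemma lin_comp phi psi u : iso phi -> lin (phi \o psi) u = lin phi (lin psi u).
Proof. by move=> i; rewrite linB0 /= isoB // -linB0. Qed.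

Lemma iso_inj phi : iso phi -> injective phi.
Proof. by move=> i x y e; apply: edist_eq0; rewrite -i e edistxx. Qed.

Lemma iso_can phi psi : iso phi -> cancel psi phi -> iso psi.
Proof. by move=> i c x y; rewrite -i !c. Qed.

Lemma lin_can phi psi u : iso phi -> cancel psi phi -> lin phi (lin psi u) = u.
Proof.
move=> i c; rewrite -lin_comp // !linB0 /= !c subr0 //.
Qed.

End Dot.

(** * The Coxeter complex *)

Section Hyperplanes.
Context {R : realType} {n : nat}.
Implicit Types (x y z u v a : 'rV[R]_n).

Lemma hyperplaneN a b : hyperplane (- a) (- b) = hyperplane a b.
Proof.
apply/seteqP; split=> x; rewrite /hyperplane /= !dotE; last by move=> ->.
exact: oppr_inj.
Qed.

(** Adding to a point of the first hyperplane the component [u] of [a'] orthogonal to [a] stays in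
    it, hence in the second; this forces [u] to vanish. *)
Lemma hyperplane_sub a b a' b' : a != 0 -> a' != 0 ->
  hyperplane a b `<=` hyperplane a' b' ->
  exists2 c, c != 0 & a' = c *: a /\ b' = c * b.
Proof.
move=> a0 a'0 sub; have daa := dot_gt0 a0.
pose c := dot a a' / dot a a; pose p := (b / dot a a) *: a.
have pH : hyperplane a b p by rewrite /hyperplane /= !dotE divfK ?gt_eqF.
have [u uE] : exists u, u = a' - c *: a by exists (a' - c *: a).
have au : dot a u = 0 by rewrite uE !dotE /c divfK ?gt_eqF // subrr.
have := sub (p + u); rewrite /hyperplane /= dotDr au addr0 => /(_ pH).
rewrite dotDr (sub p pH) => /eqP; rewrite -subr_eq0 addrC addKr => /eqP a'u.
have u0 : u = 0 by apply: dot_eq0; rewrite {1}uE dotBl dotZl a'u au mulr0 subr0.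
have a'E : a' = c *: a by apply/eqP; rewrite -subr_eq0 -uE u0.
exists c; first by apply: contraNneq a'0 => c0; rewrite a'E c0 scale0r.
split=> //; rewrite -(sub p pH) a'E dotZl; congr (_ * _); exact: pH.
Qed.

Lemma hyperplane_sub_eq a b a' b' : a != 0 -> a' != 0 ->
  hyperplane a b `<=` hyperplane a' b' -> hyperplane a b = hyperplane a' b'.
Proof.
move=> a0 a'0 /(hyperplane_sub a0 a'0) [c c0 [-> ->]].
apply/seteqP; split=> x; rewrite /hyperplane /= !dotE; first by move=> ->.
exact: mulfI.
Qed.

Lemma hyperplane_same_norm a b a' b' : a != 0 -> a' != 0 ->
  hyperplane a b = hyperplane a' b' -> dot a a = dot a' a' ->
  (a', b') = (a, b) \/ (a', b') = (- a, - b).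
Proof.
move=> a0 a'0 hE; have [c c0 [-> ->]] : exists2 c, c != 0 & a' = c *: a /\ b' = c * b.
  by apply: hyperplane_sub => //; rewrite hE.
rewrite !dotE mulrA -{1}[dot a a]mul1r => /(mulIf (lt0r_neq0 (dot_gt0 a0)))/esym/eqP.
rewrite -expr2 sqrf_eq1.
by move=> /orP[/eqP ->|/eqP ->]; [left|right]; rewrite ?scale1r ?mul1r ?scaleN1r ?mulN1r.
Qed.

(** Each further hyperplane is left by a move inside [hyperplane a b] that is too small to meet
    those already avoided. *)
Lemma hyperplane_avoid (a : 'rV[R]_n) b (A : set (set 'rV[R]_n)) :
  a != 0 -> finite_set A ->
  (forall K, A K -> exists a' b', a' != 0 /\ K = hyperplane a' b') ->
  (forall K, A K -> K <> hyperplane a b) ->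
  forall x e, hyperplane a b x -> 0 < e ->
  exists y, [/\ hyperplane a b y, edist x y < e & forall K, A K -> ~ K y].
Proof.
move=> a0; elim/finite_set_ind => [_ _ x e Hx e0|K A' finA' IH hK nK x e Hx e0].
  by exists x; split=> //; rewrite edistxx.
have [|||y [Hy xy hy]] := IH _ _ x (e / 2) Hx.
- by move=> L AL; apply: hK; right.
- by move=> L AL; apply: nK; right.
- by rewrite divr_gt0.
have [Ky|nKy] := pselect (K y); last first.
  by exists y; split=> //; [lra|move=> L [->|/hy]].
have [k [c [k0 KE]]] := hK K (or_introl erefl).
have [z [Hz nKz]] : exists z, hyperplane a b z /\ ~ K z.
  apply: contrapT => /forallNP hz; apply: (nK K (or_introl erefl)).
  rewrite KE; apply/esym/hyperplane_sub_eq => // z Hz.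
  by apply: contrapT => Kz; apply: (hz z); rewrite KE.
have [d d0 hd] : exists2 d, 0 < d & forall t, 0 < t < d ->
    forall L, A' L -> ~ L (y + t *: (z - y)).
  apply: finite_small => // L AL.
  have [l [m [l0 LE]]] := hK L (or_intror AL).
  have nLy : dot l y - m != 0.
    by apply/eqP => /eqP; rewrite subr_eq0 => /eqP Ly; apply: (hy L AL); rewrite LE.
  pose q := dot l (z - y).
  exists (`|dot l y - m| / (`|q| + 1)) => [|t].
    by rewrite divr_gt0 ?normr_gt0 ?ltr_wpDl.
  move=> /andP[t0]; rewrite ltr_pdivlMr ?ltr_wpDl // => tq.
  rewrite LE /hyperplane /= dotDr dotZr -/q => h.
  have : `|dot l y - m| = t * `|q|.
    by rewrite -(gtr0_norm t0) -normrM -[LHS]normrN; congr `|_|; lra.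
  by move: tq; rewrite mulrDr mulr1; lra.
pose w := z - y; pose f := Num.min d (e / 2 / (enorm w + 1)).
have w1 : 0 < enorm w + 1 by rewrite ltr_wpDl ?enorm_ge0.
have f0 : 0 < f by rewrite lt_min d0 divr_gt0 // divr_gt0.
pose t := f / 2.
have t0 : 0 < t by rewrite divr_gt0.
have tf : t < f by rewrite /t; lra.
have td : t < d by apply: lt_le_trans tf _; rewrite ge_min lexx.
have te : t * enorm w < e / 2.
  have : t < e / 2 / (enorm w + 1).
    by apply: lt_le_trans tf _; rewrite ge_min lexx orbT.
  by rewrite ltr_pdivlMr // mulrDr mulr1; lra.
exists (y + t *: w); split.
- by rewrite /hyperplane /= dotDr dotZr /w dotBr Hy Hz subrr mulr0 addr0.
- apply: le_lt_trans (edist_tri _ y _) _.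
  rewrite edistr enormZ gtr0_norm //; lra.
- move=> L [->|AL]; last by apply: hd; rewrite // t0.
  rewrite KE /hyperplane /= dotDr dotZr /w dotBr.
  move: nKz Ky; rewrite KE /hyperplane /= => nKz -> => /eqP.
  rewrite -subr_eq0 addrC addKr mulf_eq0 (gt_eqF t0) /= subr_eq0.
  by move/eqP.
Qed.

End Hyperplanes.

Section Facets.
Context {R : realType} {n : nat} (M : affine_coxeter R n).
Implicit Types (x y z u v a : 'rV[R]_n).

Lemma normal_solve (c : 'I_n -> R) : exists v, forall i, dot (normal M i) v = c i.
Proof.
exists (invmx (\matrix_i normal M i) *m \col_i c i)^T => i.
have -> v : dot (normal M i) v = ((\matrix_i normal M i) *m v^T) i ord0.
  by rewrite mxE; apply: eq_bigr => j _; rewrite !mxE.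
by rewrite trmxK mulKVmx ?normal_free // mxE.
Qed.

Lemma normal_inj v : (forall i, dot (normal M i) v = 0) -> v = 0.
Proof.
move=> h; apply: trmx_inj; rewrite trmx0 -(mulKmx (normal_free M) v^T).
rewrite (_ : _ *m v^T = 0) ?mulmx0 //; apply/colP => i; rewrite !mxE -[RHS](h i).
by apply: eq_bigr => j _; rewrite !mxE.
Qed.

Lemma normal_neq0 i : normal M i != 0.
Proof.
apply/eqP => n0; have [v /(_ i)] := normal_solve (fun=> 1).
by rewrite n0 dot0l => /eqP; rewrite eq_sym oner_eq0.
Qed.

Lemma facet_refl x : facet M x x.
Proof. by []. Qed.

Lemma facet_sym x y : facet M x y -> facet M y x.
Proof.
move=> h a b a0 wH; have [h1 h2] := h a b a0 wH.
have [_ h3] : (dot (- a) x = - b -> dot (- a) y = - b) /\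
   (- b < dot (- a) x -> - b < dot (- a) y).
  by apply: h; rewrite ?oppr_eq0 // hyperplaneN.
rewrite !dotNl !ltrN2 in h3.
have [xb|bx|xb] := ltgtP (dot a x) b.
- have yb := h3 xb; split=> e; first by rewrite e ltxx in yb.
  by have := lt_trans e yb; rewrite ltxx.
- by split=> [yb|//]; have := h2 bx; rewrite yb ltxx.
- by split=> //; rewrite (h1 xb) ltxx.
Qed.

Lemma facet_trans x y z : facet M x y -> facet M y z -> facet M x z.
Proof.
move=> xy yz a b a0 wH; have [h1 h2] := xy a b a0 wH.
by have [h3 h4] := yz a b a0 wH; split; [move/h1/h3|move/h2/h4].
Qed.

Lemma facet_eq x y : facet M x y -> facet M x = facet M y.
Proof.
move=> xy; apply/seteqP; split=> z; last exact: facet_trans.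
by apply: facet_trans; exact: facet_sym.
Qed.

Lemma closed_facet_refl x : closed_facet M x x.
Proof. by move=> a b _ _; split=> // /ltW. Qed.

Lemma facet_closed x : facet M x `<=` closed_facet M x.
Proof.
by move=> y xy a b a0 wH; have [h1 h2] := xy a b a0 wH; split=> // /h2/ltW.
Qed.

Lemma closed_facet_trans x y z :
  closed_facet M x y -> closed_facet M y z -> closed_facet M x z.
Proof.
move=> xy yz a b a0 wH; have [h1 h2] := xy a b a0 wH.
have [h3 h4] := yz a b a0 wH; split; first by move/h1/h3.
by move/h2; rewrite le_eqVlt => /orP[/eqP /esym /h3 ->|/h4].
Qed.

(** By local finiteness a small ball around [x] meets no walls but those through [x]; a wall
    strictly separating [x] from [y] would meet the segment between them inside this ball. *)
Lemma closed_facet_nbhd x :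
  exists2 e, 0 < e & forall y, edist x y < e -> closed_facet M y x.
Proof.
have Wfin := wall_locally_finite M x 1.
have [e e0 he] : exists2 e, 0 < e & forall t, 0 < t < e -> forall H,
    (wall M H /\ exists2 y, H y & edist x y <= 1) ->
    forall y, edist x y <= t -> H y -> H x.
  apply: finite_small => // H [wH _].
  have [Hx|nHx] := pselect (H x); first by exists 1.
  have [a [b [a0 HE]]] := wall_hyperplane wH.
  have c0 : 0 < `|b - dot a x|.
    rewrite normr_gt0 subr_eq0; apply/eqP => bE.
    by apply: nHx; rewrite HE /hyperplane /=.
  have na : 0 < enorm a.
    by rewrite lt_neqAle enorm_ge0 andbT eq_sym; apply: contra_neq a0 => /enorm_eq0.
  exists (`|b - dot a x| / enorm a) => [|t /andP[t0]]; first by rewrite divr_gt0.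
  rewrite ltr_pdivlMr // => te y xy; rewrite HE /hyperplane /= => Hy; exfalso.
  have : `|b - dot a x| <= enorm a * edist x y.
    rewrite -Hy -dotBr edistC edistE ler_norml dot_le andbT.
    by rewrite lerNl -dotNr; apply: le_trans (dot_le _ _) _; rewrite enormN.
  have := ler_wpM2l (enorm_ge0 a) xy.
  lra.
exists (Num.min e 1) => [|y]; first by rewrite lt_min e0 ltr01.
rewrite lt_min => /andP[ye y1].
have {}he H z : wall M H -> edist x z <= edist x y -> H z -> H x.
  move=> wH zy Hz; apply: (he ((edist x y + e) / 2) _ H _ z) => //.
  - by have := edist_ge0 x y; move=> ?; apply/andP; split; lra.
  - by split=> //; exists z => //; apply: le_trans zy _; exact: ltW.
  - by apply: le_trans zy _; lra.
move=> a b a0 wH; split; first by move=> ?; exact: (he _ y wH).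
move=> by_; rewrite leNgt; apply/negP => xb.
pose s := (b - dot a x) / (dot a y - dot a x).
have den : 0 < dot a y - dot a x by lra.
have s01 : 0 <= s <= 1.
  by rewrite divr_ge0 /= ?ler_pdivrMr; lra.
pose z := x + s *: (y - x).
have Hz : hyperplane a b z.
  by rewrite /hyperplane /= dotDr dotZr dotBr divfK ?gt_eqF // addrC subrK.
have : hyperplane a b x.
  apply: he Hz => //; rewrite /z edistr enormZ (edistC x y) ger0_norm; last lra.
  by apply: ler_piMl; rewrite ?enorm_ge0 //; lra.
by rewrite /hyperplane /= => xE; rewrite xE ltxx in xb.
Qed.

Lemma closed_facet_segment x u t0 : exists2 e, 0 < e &
  forall t, `|t - t0| < e -> closed_facet M (x + t *: u) (x + t0 *: u).
Proof.
have [e e0 he] := closed_facet_nbhd (x + t0 *: u).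
have u1 : 0 < enorm u + 1 by rewrite ltr_wpDl ?enorm_ge0.
exists (e / (enorm u + 1)) => [|t]; first by rewrite divr_gt0.
rewrite ltr_pdivlMr // => te; apply: he.
rewrite edistDl edistZr distrC; apply: le_lt_trans te.
by rewrite ler_wpM2l // lerDl.
Qed.

Lemma in_chamber_nbhd x : in_chamber M x ->
  exists2 e, 0 < e & forall y, edist x y < e -> facet M x y.
Proof.
move=> cx; have [e e0 he] := closed_facet_nbhd x; exists e => // y /he yx.
move=> a b a0 wH; have [h1 _] := yx a b a0 wH.
split=> [xb|bx]; first by case: (cx _ wH).
rewrite ltNge; apply/negP; rewrite le_eqVlt => /orP[/eqP /h1 xb|yb].
  by rewrite xb ltxx in bx.
have [_] : (dot (- a) y = - b -> dot (- a) x = - b) /\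
   (- b < dot (- a) y -> - b <= dot (- a) x).
  by apply: yx; rewrite ?oppr_eq0 // hyperplaneN.
by rewrite !dotNl ltrN2 lerN2 => /(_ yb); rewrite leNgt bx.
Qed.

(** With the previous lemma, this characterizes chambers as the open facets, a property that
    isometries can transport. *)
Lemma nbhd_in_chamber x e : 0 < e ->
  (forall y, edist x y < e -> facet M x y) -> in_chamber M x.
Proof.
move=> e0 he H wH Hx; have [a [b [a0 HE]]] := wall_hyperplane wH.
have na : 0 < enorm a.
  by rewrite lt_neqAle enorm_ge0 andbT eq_sym; apply: contra_neq a0 => /enorm_eq0.
pose t := e / 2 / enorm a.
have t0 : 0 < t by rewrite !divr_gt0.
have wHab : wall M (hyperplane a b) by rewrite -HE.
have [|+ _] := he (x + t *: a) _ a b a0 wHab.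
- by rewrite edistr enormZ gtr0_norm // divfK ?gt_eqF //; lra.

- move: Hx; rewrite HE /hyperplane /= => Hx /(_ Hx).
  rewrite dotDr dotZr Hx => /eqP; rewrite -subr_eq0 addrC addKr mulf_eq0 (gt_eqF t0) /=.
  by rewrite gt_eqF ?dot_gt0.
Qed.

Lemma cone_vector : exists v, forall i, 0 < dot (normal M i) v.
Proof. by have [v h] := normal_solve (fun=> 1); exists v => i; rewrite h. Qed.

(** By [normal_chamber], a vector of the open vectorial chamber is parallel to no wall, so a small
    move along it leaves all the walls through [x] and crosses no other. *)
Lemma chamber_near x : exists2 c, in_chamber M c & closed_facet M c x.
Proof.
have [v v0] := cone_vector; have [e e0 he] := closed_facet_segment x v 0.
have t0 : 0 < e / 2 by rewrite divr_gt0.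
have xc : closed_facet M (x + (e / 2) *: v) x.
  by have := he (e / 2); rewrite subr0 gtr0_norm // scale0r addr0; apply; lra.
exists (x + (e / 2) *: v) => // H wH Hc.
have [a [b [a0 HE]]] := wall_hyperplane wH; rewrite HE in wH Hc.
have [/(_ Hc) xb _] := xc a b a0 wH.
have := normal_chamber a0 wH v0; move: Hc; rewrite /hyperplane /= dotDr dotZr xb.
by move=> /eqP; rewrite -subr_eq0 addrC addKr mulf_eq0 (gt_eqF t0) /= => ->.
Qed.

(* The automorphisms of the Coxeter complex; unlike the elements of the affine
   Weyl group, they need not preserve the colors of the vertices. *)
Definition gam (phi : 'rV[R]_n -> 'rV[R]_n) := [/\ iso phi,
  exists psi, cancel phi psi /\ cancel psi phi &
  forall H, wall M (phi @` H) <-> wall M H].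

Lemma gam_iso phi : gam phi -> iso phi. Proof. by case. Qed.

Lemma gam_inv phi : gam phi ->
  exists psi, [/\ gam psi, cancel phi psi & cancel psi phi].
Proof.
move=> [i [psi [c1 c2]] w]; exists psi; split=> //.
split; [exact: iso_can c2|by exists phi|move=> H].
rewrite -w image_comp (_ : phi \o psi = id) ?image_id //.
by apply/funext => x /=; rewrite c2.
Qed.

Lemma gam_id : gam id.
Proof. by split=> // [|H]; [exists id|rewrite image_id]. Qed.

Lemma gam_comp phi psi : gam phi -> gam psi -> gam (phi \o psi).
Proof.
move=> [i [p [p1 p2]] w] [j [q [q1 q2]] v]; split; first exact: iso_comp.
  by exists (q \o p); split; exact: can_comp.
by move=> H; rewrite -image_comp w v.
Qed.

Lemma image_hyperplane phi a b : iso phi ->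
  (exists psi, cancel phi psi /\ cancel psi phi) ->
  phi @` hyperplane a b = hyperplane (lin phi a) (b + dot (lin phi a) (phi 0)).
Proof.
move=> i [psi [c1 c2]]; apply/seteqP; split=> x; rewrite /hyperplane /=.
  by move=> [y <- <-]; rewrite (linE _ y) dotDr lin_dot // addrC.
move=> hx; exists (psi x); rewrite ?c2 //.
apply: (addIr (dot (lin phi a) (phi 0))); rewrite -hx -{2}(c2 x).
by rewrite (linE _ (psi x)) dotDr lin_dot // addrC.
Qed.

Lemma lin_neq0 phi a : iso phi -> a != 0 -> lin phi a != 0.
Proof.
move=> i; apply: contra_neq => h; apply: dot_eq0.
by rewrite -(lin_dot _ _ i) h dot0l.
Qed.

Lemma gam_wall phi a b : gam phi -> wall M (hyperplane a b) ->
  wall M (hyperplane (lin phi a) (b + dot (lin phi a) (phi 0))).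
Proof. by move=> [i c w]; rewrite -image_hyperplane // w. Qed.

(* [lin phi a] and the constant make up the wall [phi @` hyperplane a b]. *)
Lemma gam_side phi a b x : iso phi ->
  dot (lin phi a) (phi x) - (b + dot (lin phi a) (phi 0)) = dot a x - b.
Proof. by move=> i; rewrite (linE _ x) dotDr lin_dot //; ring. Qed.

Lemma gam_facet phi x y : gam phi -> facet M x y -> facet M (phi x) (phi y).
Proof.
move=> gp xy a b a0 wH; have [psi [gq c1 c2]] := gam_inv gp.
have iq := gam_iso gq.
have [h1 h2] := xy _ _ (lin_neq0 iq a0) (gam_wall gq wH).
have e z : dot (lin psi a) z - (b + dot (lin psi a) (psi 0)) = dot a (phi z) - b.
  by rewrite -(gam_side a b (phi z) iq) c1.
split=> [/eqP|]; last by rewrite -subr_gt0 -e subr_gt0 => /h2; rewrite -subr_gt0 e subr_gt0.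
by rewrite -subr_eq0 -e subr_eq0 => /eqP /h1 /eqP; rewrite -subr_eq0 e subr_eq0 => /eqP.
Qed.

Lemma gam_closed_facet phi x y : gam phi ->
  closed_facet M x y -> closed_facet M (phi x) (phi y).
Proof.
move=> gp xy a b a0 wH; have [psi [gq c1 c2]] := gam_inv gp.
have iq := gam_iso gq.
have [h1 h2] := xy _ _ (lin_neq0 iq a0) (gam_wall gq wH).
have e z : dot (lin psi a) z - (b + dot (lin psi a) (psi 0)) = dot a (phi z) - b.
  by rewrite -(gam_side a b (phi z) iq) c1.
split=> [/eqP|]; last by rewrite -subr_gt0 -e subr_gt0 => /h2; rewrite -subr_ge0 e subr_ge0.
by rewrite -subr_eq0 -e subr_eq0 => /eqP /h1 /eqP; rewrite -subr_eq0 e subr_eq0 => /eqP.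
Qed.

Lemma gam_image_facet phi x : gam phi -> phi @` facet M x = facet M (phi x).
Proof.
move=> gp; have [psi [gq c1 c2]] := gam_inv gp.
apply/seteqP; split=> [_ [y xy <-]|y xy]; first exact: gam_facet.
by exists (psi y); rewrite ?c2 //; rewrite -(c1 x); exact: gam_facet.
Qed.

Lemma gam_image_closed_facet phi x :
  gam phi -> phi @` closed_facet M x = closed_facet M (phi x).
Proof.
move=> gp; have [psi [gq c1 c2]] := gam_inv gp.
apply/seteqP; split=> [_ [y xy <-]|y xy]; first exact: gam_closed_facet.
by exists (psi y); rewrite ?c2 //; rewrite -(c1 x); exact: gam_closed_facet.
Qed.

Lemma reflectionE a b x : reflection a b x =
  x - (2 * (dot a x - b) / dot a a) *: a.
Proof. by []. Qed.

Lemma reflection_iso a b : a != 0 -> iso (reflection a b).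
Proof.
move=> /dot_gt0 /lt0r_neq0 a0 x y.
rewrite /Defs.edist; congr Num.sqrt.
set k := 2 * (dot a x - b) / dot a a; set l := 2 * (dot a y - b) / dot a a.
have -> : reflection a b x - reflection a b y = (x - y) - (k - l) *: a.
  by rewrite !reflectionE -/k -/l; apply/rowP => i; rewrite !mxE; ring.
have kl : (k - l) * dot a a = 2 * dot a (x - y).
  by rewrite /k /l dotBr; field.
move: (x - y) kl => w kl.
rewrite dotBl !dotBr !dotZl !dotZr (dotC w a) kl; ring.
Qed.

Lemma reflectionK a b : a != 0 -> involutive (reflection a b).
Proof.
move=> /dot_gt0 /lt0r_neq0 a0 x.
rewrite {1}reflectionE; set r := reflection a b x.
have -> : dot a r = 2 * b - dot a x by rewrite /r reflectionE dotBr dotZr; field.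
by rewrite /r reflectionE; apply/rowP => i; rewrite !mxE; field.
Qed.

Lemma reflection_gam a b : a != 0 -> wall M (hyperplane a b) ->
  gam (reflection a b).
Proof.
move=> a0 wH; have rK := @reflectionK a b a0; split; first exact: reflection_iso.
  by exists (reflection a b).
move=> H; split=> [wr|]; last exact: wall_reflection.
have := wall_reflection a0 wH wr; rewrite image_comp.
by rewrite (_ : _ \o _ = id) ?image_id //; apply/funext => x /=; rewrite rK.
Qed.

Lemma weyl_gam w : weyl M w -> gam w.
Proof.
elim=> [|a b {}w a0 wH _ IH]; first exact: gam_id.
by apply: gam_comp => //; exact: reflection_gam.
Qed.

Lemma weyl_comp w w' : weyl M w -> weyl M w' -> weyl M (w \o w').
Proof.
move=> h h'; elim: h => //= a b {}w a0 wH _ IH.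
by rewrite -compA; exact: weyl_reflection.
Qed.

Lemma weyl_inv w : weyl M w ->
  exists w', [/\ weyl M w', cancel w w' & cancel w' w].
Proof.
elim=> [|a b {}w a0 wH _ [w' [hw c1 c2]]].
  by exists id; split=> //; exact: weyl_id.
exists (w' \o reflection a b); split=> [|x|x] /=; rewrite ?reflectionK ?c1 ?c2 //.
  apply: weyl_comp => //; rewrite -[reflection a b]/(reflection a b \o id).
  by apply: weyl_reflection => //; exact: weyl_id.
by rewrite reflectionK.
Qed.

End Facets.

Section Frames.
Context {R : realType} {n : nat}.
Implicit Types (x y z u v a : 'rV[R]_n) (phi psi : 'rV[R]_n -> 'rV[R]_n).

Lemma lin_sum phi I (r : seq I) (P : pred I) (F : I -> 'rV[R]_n) : iso phi ->
  lin phi (\sum_(i <- r | P i) F i) = \sum_(i <- r | P i) lin phi (F i).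
Proof.
by move=> i; apply: (big_morph (lin phi)) => [x y|]; [exact: linD|exact: lin0].
Qed.

Lemma iso_frame phi psi y (d : R) : iso phi -> iso psi -> d != 0 -> phi y = psi y ->
  (forall i, phi (y + d *: delta_mx ord0 i) = psi (y + d *: delta_mx ord0 i)) ->
  phi = psi.
Proof.
move=> ip iq d0 e h; apply/funext => x.
have {}h i : lin phi (delta_mx ord0 i) = lin psi (delta_mx ord0 i).
  by apply: (scalerI d0); rewrite -!linZ //; apply: (addrI (phi y));
    rewrite -isoD // h isoD // e.
suff hu u : phi (y + u) = psi (y + u) by have := hu (x - y); rewrite addrC subrK.
rewrite !isoD // e; congr (_ + _).
rewrite (row_sum_delta u) !lin_sum //; apply: eq_bigr => i _.
by rewrite !linZ // h.
Qed.

Lemma enorm_le_sum u : enorm u <= \sum_i `|u ord0 i|.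
Proof.
rewrite {1}(row_sum_delta u).
apply: (@le_trans _ _ (\sum_j enorm (u ord0 j *: delta_mx ord0 j : 'rV[R]_n))).
  elim/big_rec2: _ => [|j y1 y2 _ h]; first by rewrite enorm0.
  by apply: le_trans (enormD _ _) _; rewrite lerD2l.
apply: ler_sum => i _; rewrite enormZ [X in _ * X](_ : _ = 1) ?mulr1 //.
rewrite /enorm /dot (bigD1 i) //= big1 ?mxE ?eqxx ?mulr1 ?addr0 ?sqrtr1 // => j ji.
by rewrite !mxE eqxx (negPf ji) mulr0.
Qed.

End Frames.

(** * Discreteness of the automorphisms of the Coxeter complex, and their action on faces at
    infinity *)

Section Discrete.
Context {R : realType} {n : nat} (M : affine_coxeter R n).
Implicit Types (x y z u v a : 'rV[R]_n) (phi psi : 'rV[R]_n -> 'rV[R]_n).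

Lemma special_vertex : exists (b : 'I_n -> R) x,
  forall i, wall M (hyperplane (normal M i) (b i)) /\ dot (normal M i) x = b i.
Proof.
have /choice [b hb] i := normal_wall M i.
by have [x hx] := normal_solve M b; exists b, x.
Qed.

Lemma finite_hyperplane_normals (A : set (set 'rV[R]_n)) c : 0 < c ->
  finite_set A ->
  finite_set [set p : 'rV[R]_n * R | dot p.1 p.1 = c /\ A (hyperplane p.1 p.2)].
Proof.
move=> c0 Afin.
have nz a : dot a a = c -> a != 0.
  by apply: contra_eqN => /eqP ->; rewrite dot0l lt_eqF.
apply: (@sub_finite_set _ _ (\bigcup_(H in A)
   [set p | dot p.1 p.1 = c /\ hyperplane p.1 p.2 = H])).
  by move=> p [pc Ap]; exists (hyperplane p.1 p.2).
apply: bigcup_finite => // H _.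
have [[[a b] /= [ac aH]]|/forallNP h] := pselect (exists p : 'rV[R]_n * R,
    dot p.1 p.1 = c /\ hyperplane p.1 p.2 = H); last first.
  by rewrite (_ : [set _ | _] = set0) //; apply/seteqP; split=> p // /h.
apply: (@sub_finite_set _ _ ([set (a, b)] `|` [set (- a, - b)])).
  move=> [a' b'] /= [a'c a'H].
  by apply: hyperplane_same_norm; rewrite ?nz // ?ac ?aH.
by rewrite finite_setU.
Qed.

(** Such a map is determined by the images of [n] walls through one point [x0] with independent
    normals. These images meet a fixed ball, so there are finitely many of them, and each has only
    two normals of a given length. *)
Lemma gam_finite y z K : finite_set [set phi | gam M phi /\ edist (phi y) z <= K].
Proof.
have [b [x0 hx0]] := special_vertex.
pose A := [set H | wall M H /\ exists2 p, H p & edist z p <= K + edist y x0].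
have Afin : finite_set A by exact: wall_locally_finite.
pose F phi (i : 'I_n) := (lin phi (normal M i),
  b i + dot (lin phi (normal M i)) (phi 0)).
set S := [set _ | _].
suff FS : finite_set (F @` S).
  rewrite -(eq_finite_set (inj_card_eq (f := F) _)) // => phi psi.
  rewrite !inE => -[gp _] [gq _] FE; apply/funext => x.
  have h i : lin phi (normal M i) = lin psi (normal M i) /\
     dot (lin phi (normal M i)) (phi 0) = dot (lin psi (normal M i)) (psi 0).
    by have := congr1 (fun f => f i) FE => -[? /addrI].
  have [p' [gp' c1 c2]] := gam_inv gp.
  have ip := gam_iso gp; have iq := gam_iso gq.
  have orth w : (forall i, dot (lin phi (normal M i)) w = 0) -> w = 0.
    move=> hw; rewrite -(lin_can w ip c2) (_ : lin p' w = 0) ?lin0 //.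
    by apply: (@normal_inj _ _ M) => i; rewrite -(lin_dot _ _ ip) lin_can.
  rewrite (linE phi) (linE psi); congr (_ + _).
    apply/eqP; rewrite -subr_eq0; apply/eqP/orth => i.
    by rewrite dotBr (h i).2 (h i).1 subrr.
  apply/eqP; rewrite -subr_eq0; apply/eqP/orth => i.
  by rewrite dotBr {2}(h i).1 !lin_dot // subrr.
pose P i := [set p : 'rV[R]_n * R |
   dot p.1 p.1 = dot (normal M i) (normal M i) /\ A (hyperplane p.1 p.2)].
apply: (@sub_finite_set _ _ [set f | forall i, P i (f i)]).
  move=> _ [phi [gp hp] <-] i; have ip := gam_iso gp; rewrite /F /=.
  split; first by rewrite /= lin_dot.
  split; first exact: gam_wall (hx0 i).1.
  exists (phi x0).
    rewrite /hyperplane /= (linE phi x0) dotDr lin_dot // (hx0 i).2; exact: addrC.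
  apply: le_trans (edist_tri _ (phi y) _) _; rewrite ip lerD2r edistC.
  exact: hp.
apply: (@finite_funs _ _ P) => i; apply: finite_hyperplane_normals => //.
exact/dot_gt0/normal_neq0.
Qed.

(** If the image of a wall were not a wall, it would contain a point on no wall, hence interior to
    its facet; pulled back, a point of the wall would be interior to its own facet. *)
Lemma facets_wall phi psi : iso phi -> cancel phi psi -> cancel psi phi ->
  (forall x y, facet M (phi x) (phi y) -> facet M x y) ->
  forall H, wall M H -> wall M (phi @` H).
Proof.
move=> ip c1 c2 hf H wH; have [a [b [a0 HE]]] := wall_hyperplane wH.
have iE : phi @` H = hyperplane (lin phi a) (b + dot (lin phi a) (phi 0)).
  by rewrite HE image_hyperplane //; exists psi.
have la0 := lin_neq0 ip a0.
set a' := lin phi a in iE la0; set b' := (X in hyperplane _ X) in iE.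
apply: contrapT => nwH.
pose x := (b' / dot a' a') *: a'.
have Hx : hyperplane a' b' x.
  by rewrite /hyperplane /= dotZr divfK // gt_eqF // dot_gt0.
have Afin := wall_locally_finite M x 1.
have [||y [Hy xy hy]] := hyperplane_avoid la0 Afin _ _ Hx (@ltr01 R).
- by move=> K [/wall_hyperplane].
- by move=> K [wK _] KE; apply: nwH; rewrite iE -KE.
move: (Hy); rewrite -iE => -[z Hz zE].
have [cy|/existsNP [K /existsNP [wK /contrapT Ky]]] := pselect (in_chamber M y).
  have [e e0 he] := in_chamber_nbhd cy.
  suff /(_ H wH) : in_chamber M z by [].
  by apply: (nbhd_in_chamber e0) => t zt; apply: hf; rewrite zE; apply: he; rewrite -zE ip.
by apply: (hy K) => //; split=> //; exists y => //; exact: ltW.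
Qed.

Lemma facets_gam phi psi : iso phi -> cancel phi psi -> cancel psi phi ->
  (forall x, phi @` facet M x = facet M (phi x)) -> gam M phi.
Proof.
move=> ip c1 c2 hf; have iq := iso_can ip c2.
have h1 x y : facet M (phi x) (phi y) -> facet M x y.
  by rewrite -hf => -[z xz /(iso_inj ip) <-].
have h2 x y : facet M (psi x) (psi y) -> facet M x y.
  move=> xy; rewrite -(c2 x) -(c2 y) -hf; by exists (psi y).
split=> //; first by exists psi.
move=> H; split=> [wH|]; last exact: facets_wall.
have := facets_wall iq c2 c1 h2 wH; rewrite image_comp.
by rewrite (_ : psi \o phi = id) ?image_id //; apply/funext => x /=; rewrite c1.
Qed.

(** A rational point near [c] together with its translates along the coordinate axes. Rationality
    leaves countably many such points, which the countable basis [fix_test] relies on. *)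
Lemma rational_frame c : in_chamber M c -> exists s : seq 'rV[rat]_n,
  [/\ exists q, q \in s, forall q, q \in s -> facet M c (map_mx ratr q) &
  forall phi psi, iso phi -> iso psi ->
    (forall q, q \in s -> phi (map_mx ratr q) = psi (map_mx ratr q)) -> phi = psi].
Proof.
move=> /in_chamber_nbhd [e e0 he].
(* The sum of [n] coordinate errors below [eta] is less than [e / 2], which leaves room for the
   translation by [d], also below [eta]. *)
pose eta := e / 2 / n.+1%:R.
have n0 : 0 < n.+1%:R :> R by rewrite ltr0n.
have eta0 : 0 < eta by rewrite !divr_gt0.
have /choice [y hy] (i : 'I_n) : exists q : rat, `|ratr q - c ord0 i| < eta.
  have [q] := @rat_in_itvoo R (c ord0 i - eta) (c ord0 i + eta) (ltac:(lra)).
  by rewrite in_itv /= => qi; exists q; rewrite ltr_norml; lra.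
have [d] := @rat_in_itvoo R 0 eta eta0; rewrite in_itv /= => /andP[d0 de].
pose q0 : 'rV[rat]_n := \row_i y i.
pose qi i : 'rV[rat]_n := q0 + d *: delta_mx ord0 i.
have qiE i : map_mx ratr (qi i) = map_mx ratr q0 + ratr d *: delta_mx ord0 i :> 'rV[R]_n.
  by apply/rowP => j; rewrite !mxE rmorphD rmorphM /= rmorph_nat.
have q0c : edist c (map_mx ratr q0) < e / 2.
  rewrite edistC edistE; apply: le_lt_trans (enorm_le_sum _) _.
  apply: (@le_lt_trans _ _ (\sum_(i < n) eta)).
    by apply: ler_sum => i _; rewrite !mxE; exact: ltW.
  rewrite sumr_const card_ord -(mulr_natr eta).
  have <- : eta * n.+1%:R = e / 2 by rewrite /eta divfK ?gt_eqF.
  by rewrite ltr_pM2l // ltr_nat.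
have etae : eta <= e / 2.
  by rewrite ler_pdivrMr //; apply: ler_peMr; [lra|rewrite ler1n].
exists (q0 :: [seq qi i | i <- enum 'I_n]); split=> [|q|phi psi ip iq h].
- by exists q0; rewrite mem_head.
- rewrite inE => /orP[/eqP ->|/mapP [i _ ->]]; apply: he; first lra.
  rewrite qiE; apply: le_lt_trans (edist_tri _ (map_mx ratr q0) _) _.
  rewrite edistr enormZ gtr0_norm // [enorm _](_ : _ = 1).
    by rewrite mulr1; lra.
  rewrite /enorm /dot (bigD1 i) //= big1 ?mxE ?eqxx ?mulr1 ?addr0 ?sqrtr1 // => j ji.
  by rewrite !mxE eqxx (negPf ji) mulr0.
apply: (@iso_frame _ _ _ _ (map_mx ratr q0) (ratr d)) => //.
- by rewrite gt_eqF.
- by apply: h; rewrite mem_head.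
- move=> i; rewrite -qiE; apply: h; rewrite inE; apply/orP; right.
  by apply/mapP; exists i => //; rewrite mem_enum.
Qed.

Lemma iso_eq_chamber c phi psi : in_chamber M c -> iso phi -> iso psi ->
  (forall x, facet M c x -> phi x = psi x) -> phi = psi.
Proof.
move=> /rational_frame [s [_ hs1 hs2]] ip iq h.
by apply: hs2 => // q /hs1; exact: h.
Qed.

(** Among the finitely many elements fixing [x0], take one maximizing the inner product of [lin w v]
    with a vector of the cone: on the wrong side of a wall of the cone, the reflection in it would
    increase this product. *)
Lemma cone_transitive v :
  (forall a b, a != 0 -> wall M (hyperplane a b) -> dot a v != 0) ->
  exists2 w, weyl M w & forall i, 0 < dot (normal M i) (lin w v).
Proof.
move=> vreg; have [b [x0 hx0]] := special_vertex; have [v0 hv0] := cone_vector M.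
pose S := [set w | weyl M w /\ w x0 = x0].
have Sfin : finite_set S.
  apply: sub_finite_set (gam_finite x0 x0 0) => w [/weyl_gam gw wx].
  by split=> //; rewrite wx edistxx.
have [|w [ww wx0] wmax] := finite_argmax (fun w => dot (lin w v) v0) Sfin.
  by exists id; split=> //; exact: weyl_id.
exists w => // i; set ni := normal M i; set u := lin w v.
have iw := gam_iso (weyl_gam ww).
have [w' [ww' c1 c2]] := weyl_inv ww; have iw' := gam_iso (weyl_gam ww').
have [wi xi] := hx0 i.
have d0 : dot ni u != 0.
  have -> : dot ni u = dot (lin w' ni) v by rewrite -[RHS](lin_dot _ _ iw) lin_can.
  apply: (vreg _ (b i + dot (lin w' ni) (w' 0))).
    by apply: lin_neq0 => //; exact: normal_neq0.
  by apply: gam_wall => //; exact: weyl_gam.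
rewrite ltNge; apply/negP => dle.
have dlt : dot ni u < 0 by rewrite lt_neqAle d0.
pose r := reflection ni (b i).
have ir : iso r by apply: reflection_iso; exact: normal_neq0.
have Sr : S (r \o w).
  split; first by apply: weyl_reflection => //; exact: normal_neq0.
  by rewrite /= wx0 /r reflectionE -/ni xi subrr mulr0 mul0r scale0r subr0.
have := wmax _ Sr; rewrite lin_comp // -/u; apply/negP; rewrite -ltNge.
have nn : 0 < dot ni ni by apply/dot_gt0/normal_neq0.
have -> : lin r u = u - (2 * dot ni u / dot ni ni) *: ni.
  rewrite linB0 /r !reflectionE dot0r; apply/rowP => j; rewrite !mxE.
  by field; exact: lt0r_neq0.
rewrite dotBl dotZl ltrDl oppr_gt0.
by rewrite pmulr_llt0 ?hv0 // pmulr_llt0 ?invr_gt0 // pmulr_rlt0.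
Qed.

Definition cone : set 'rV[R]_n := [set v | forall i, 0 < dot (normal M i) v].
Definition ccone : set 'rV[R]_n := [set v | forall i, 0 <= dot (normal M i) v].

(** A linear form that changed sign between [v1] and [v] would vanish at a positive combination of
    them, against [normal_chamber]. *)
Lemma gam_cone phi v1 v : gam M phi -> cone v1 -> cone (lin phi v1) -> cone v ->
  cone (lin phi v).
Proof.
move=> gp Cv1 Cpv1 Cv i; have [psi [gq c1 c2]] := gam_inv gp.
have ip := gam_iso gp; have iq := gam_iso gq.
set a := lin psi (normal M i).
have aE u : dot (normal M i) (lin phi u) = dot a u.
  by rewrite -(lin_dot _ _ iq) lin_can.
have [b wb] := normal_wall M i.
have areg u : cone u -> dot a u != 0.
  apply: (normal_chamber _ (gam_wall gq wb)).
  exact/lin_neq0/normal_neq0.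
have p1 : 0 < dot a v1 by rewrite -aE.
rewrite aE ltNge; apply/negP => neg.
have {}neg : dot a v < 0 by rewrite lt_neqAle areg.
have /areg : cone (dot a v1 *: v - dot a v *: v1).
  move=> j; rewrite dotBr !dotZr; have := Cv1 j; have := Cv j => h1 h2.
  by rewrite -mulNr addr_gt0 // mulr_gt0 // oppr_gt0.
by rewrite dotBr !dotZr mulrC subrr eqxx.
Qed.

Lemma gam_ccone phi v1 v : gam M phi -> cone v1 -> cone (lin phi v1) -> ccone v ->
  ccone (lin phi v).
Proof.
move=> gp Cv1 Cpv1 Cv i; have ip := gam_iso gp.
set d := dot _ _; set d1 := dot (normal M i) (lin phi v1).
rewrite leNgt; apply/negP => dn; have d10 : 0 < d1 by exact: Cpv1.
(* With this [e] the value at [v + e *: v1] is [d / 2], still negative. *)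
pose e := - d / d1 / 2.
have e0 : 0 < e by rewrite !divr_gt0 ?oppr_gt0.
have : cone (v + e *: v1).
  by move=> j; rewrite dotDr dotZr ltr_wpDl // mulr_gt0.
move=> /(gam_cone gp Cv1 Cpv1) /(_ i).
rewrite linD // linZ // dotDr dotZr -/d -/d1 /e.
have -> : d + - d / d1 / 2 * d1 = d / 2 by field; exact: lt0r_neq0.
by lra.
Qed.

Lemma face_ccone J : face M J `<=` ccone.
Proof. by move=> v hv i; have := hv i; case: ifP => _ => [->|/ltW]. Qed.

(* The faces of the closed cone are described without reference to the normals,
   so that every linear automorphism of the cone permutes them. *)
Lemma faceP J z v : face M J z -> face M J v <->
  ccone v /\ exists2 e, 0 < e & ccone (v - e *: z) /\ ccone (z - e *: v).
Proof.
move=> Jz; split=> [Jv|[Cv [e e0 [h1 h2]]] i].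
  split; first exact: face_ccone Jv.
  have [e e0 he] : exists2 e, 0 < e & forall t, 0 < t < e -> forall i, [set: 'I_n] i ->
      0 <= dot (normal M i) (v - t *: z) /\ 0 <= dot (normal M i) (z - t *: v).
    apply: finite_small; first exact: finite_finset.
    move=> i _; have := Jz i; have := Jv i; case: ifP => _ vi zi.
      by exists 1 => // t _; rewrite !dotBr !dotZr vi zi mulr0 subrr.
    set p := dot _ v in vi *; set q := dot _ z in zi *.
    exists (Num.min (p / q) (q / p)) => [|t]; first by rewrite lt_min !divr_gt0.
    move=> /andP[t0]; rewrite lt_min => /andP[]; rewrite !ltr_pdivlMr // => tq tp.
    by rewrite !dotBr !dotZr -/p -/q; split; lra.
  have e2 : 0 < e / 2 < e by rewrite divr_gt0 //=; lra.
  exists (e / 2); first by case/andP: e2.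
  by split=> i; have [] := he _ e2 i I.
have := Jz i; have := h1 i; have := h2 i; have := Cv i; rewrite !dotBr !dotZr.
set p := dot _ v; set q := dot _ z; case: ifP => _ p0 ep eq zi.
  have : e * p <= 0 by rewrite zi sub0r oppr_ge0 in ep.
  by rewrite pmulr_rle0 // => p0'; apply/le_anti; rewrite p0 p0'.
by apply: lt_le_trans (_ : e * q <= p); [rewrite mulr_gt0|rewrite -subr_ge0].
Qed.

Lemma face_nonempty J : face M J !=set0.
Proof.
have [z hz] := normal_solve M (fun i => if i \in J then 0 else 1).
by exists z => i; rewrite hz; case: (i \in J).
Qed.

(** Once [w] has brought the image of the cone back to the cone, the linear part preserves the
    closed cone, hence permutes its faces by [faceP]; types may change, as for a diagram
    automorphism. *)
Lemma face_transport phi : gam M phi -> exists2 w, weyl M w &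
  forall J : {set 'I_n}, (J \proper [set: 'I_n])%SET ->
  exists2 J' : {set 'I_n}, (J' \proper [set: 'I_n])%SET &
    lin (w \o phi) @` face M J = face M J'.
Proof.
move=> gp; have ip := gam_iso gp; have [p' [gp' p1 p2]] := gam_inv gp.
have [v0 hv0] := cone_vector M.
have [a b a0 wH|w ww hw] := @cone_transitive (lin phi v0).
  have -> : dot a (lin phi v0) = dot (lin p' a) v0.
    by rewrite -[RHS](lin_dot _ _ ip) lin_can.
  apply: (normal_chamber _ (gam_wall gp' wH)) => //.
  exact: lin_neq0 (gam_iso gp') a0.
exists w => // J Jp.
have iw := gam_iso (weyl_gam ww).
have gpsi : gam M (w \o phi) by apply: gam_comp => //; exact: weyl_gam.
have {hw} : cone (lin (w \o phi) v0) by move=> i; rewrite lin_comp.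
move: (w \o phi) gpsi => psi gpsi Cpsi.
have [q [gq c1 c2]] := gam_inv gpsi.
have ipsi := gam_iso gpsi; have iq := gam_iso gq.
have Cq : cone (lin q (lin psi v0)) by rewrite lin_can.
have CC v : ccone v <-> ccone (lin psi v).
  split; first exact: gam_ccone Cpsi.
  by move=> /(gam_ccone gq Cpsi Cq); rewrite lin_can.
have [z Jz] := face_nonempty J.
pose J' := [set i | dot (normal M i) (lin psi z) == 0]%SET.
have J'z : face M J' (lin psi z).
  move=> i; rewrite inE; case: eqP => // /eqP d0.
  by rewrite lt_neqAle eq_sym d0 ((CC z).1 (face_ccone Jz) i).
have key v : face M J v <-> face M J' (lin psi v).
  rewrite (faceP _ Jz) (faceP _ J'z) -CC.
  by split=> -[? [e e0 [h1 h2]]]; split=> //; exists e => //; split;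
   move: h1 h2; rewrite -?linZ // -?linB // -?CC.
exists J'.
  rewrite properE finset.subsetT /=; apply/negP => /fintype.subsetP J'T.
  move: Jp; rewrite properE => /andP[_ /fintype.subsetPn [i _ iJ]].
  have : lin psi z = 0.
    apply: (@normal_inj _ _ M) => k; have := J'z k.
    by rewrite J'T // finset.in_setT.
  move=> /(congr1 (lin q)); rewrite lin_can // lin0 => z0.
  by have := Jz i; rewrite z0 dot0r (negPf iJ) ltxx.
apply/seteqP; split=> [_ [v /key ? <-] //|v Jv].
by exists (lin q v); [apply/key|]; rewrite lin_can.
Qed.

End Discrete.

(** * Retractions and the geometry of the building *)

Section Retraction.
Context {R : realType} {n : nat} {M : affine_coxeter R n} (B : building M).
Implicit Types (x y z u v : 'rV[R]_n) (f g h k : 'rV[R]_n -> B) (p q : B).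

Let sys := chart_system B.

Lemma chart_dist f x y : chart B f -> dist (f x) (f y) = edist x y.
Proof. exact: charts_isometry sys f x y. Qed.

Lemma chart_inj f : chart B f -> injective f.
Proof.
move=> cf x y e; apply: edist_eq0.
by rewrite -(chart_dist _ _ cf) e chart_dist // edistxx.
Qed.

Lemma chart_weyl f w : chart B f -> weyl M w -> chart B (f \o w).
Proof. exact: charts_weyl sys f w. Qed.

Lemma chart_at p : exists f x, chart B f /\ f x = p.
Proof. by have [f cf [x _ fx]] := charts_cover sys p; exists f, x. Qed.

(** [charts_compat] relates common points only; [charts_subcomplex] puts the whole closed facet into
    the overlap. *)
Lemma chart_overlap f g : chart B f -> chart B g -> exists2 w, weyl M w &
  (forall x y, f x = g y -> y = w x) /\
  (forall x, range g (f x) -> forall z, closed_facet M x z -> f z = g (w z)).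
Proof.
move=> cf cg; have [w ww h] := charts_compat sys cf cg; exists w => //; split=> //.
move=> x [y _ /esym fxy] z xz.
have [z' _ /esym e] : range g (f z).
  by apply: (charts_subcomplex sys cf cg fxy); exists z.
by rewrite e (h z z').
Qed.

Lemma chart_join f g x y : chart B f -> chart B g -> exists k w,
  [/\ chart B k, weyl M w, forall z, closed_facet M x z -> k z = f z &
    forall z, closed_facet M y z -> g z = k (w z)].
Proof.
move=> cf cg; have [h [ch fh gh]] := charts_join sys x y cf cg.
have [w ww [_ wE]] := chart_overlap cf ch.
have [w' ww' [_ wE']] := chart_overlap cg ch.
have [v [wv c1 c2]] := weyl_inv ww.
exists (h \o w), (v \o w'); split; first exact: chart_weyl.
- exact: weyl_comp.
- move=> z xz; rewrite (wE x) //; apply: fh; exists x => //; exact: facet_refl.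
- move=> z yz /=; rewrite c2 (wE' y) //; apply: gh; exists y => //; exact: facet_refl.
Qed.

Lemma chart_join_pt f x q : chart B f -> exists k y,
  [/\ chart B k, forall z, closed_facet M x z -> k z = f z & k y = q].
Proof.
move=> cf; have [g [y [cg gy]]] := chart_at q.
have [k [w [ck ww kf gk]]] := chart_join x y cf cg.
exists k, (w y); split=> //; rewrite -gk //; exact: closed_facet_refl.
Qed.

Lemma chart_pair p q : exists f x y, [/\ chart B f, f x = p & f y = q].
Proof.
have [f [x [cf fx]]] := chart_at p; have [k [y [ck kf ky]]] := chart_join_pt x q cf.
by exists k, x, y; split=> //; rewrite kf //; exact: closed_facet_refl.
Qed.

(* [retr f c q y]: the retraction onto the apartment of [f] centered at the
   chamber of [c] sends [q] to [f y]. *)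
Definition retr f c q y := exists k, [/\ chart B k,
  forall z, closed_facet M c z -> k z = f z & k y = q].

Lemma chart_eq k k' c : in_chamber M c -> chart B k -> chart B k' ->
  (forall z, facet M c z -> k z = k' z) -> forall y y', k y = k' y' -> y = y'.
Proof.
move=> cc ck ck' e y y' yy'; have [w ww [h _]] := chart_overlap ck ck'.
suff wE : w = id by rewrite (h _ _ yy') wE.
apply: (iso_eq_chamber cc); [exact: gam_iso (weyl_gam ww)|by []|].
by move=> x /e /h.
Qed.

Section Center.
Variables (f : 'rV[R]_n -> B) (c : 'rV[R]_n).
Hypotheses (cf : chart B f) (cc : in_chamber M c).

Lemma retr_exists q : exists y, retr f c q y.
Proof. by have [k [y [ck kf ky]]] := chart_join_pt c q cf; exists y, k. Qed.

Lemma retr_unique q y y' : retr f c q y -> retr f c q y' -> y = y'.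
Proof.
move=> [k [ck kf <-]] [k' [ck' kf' /esym e]].
apply: (chart_eq cc ck ck' _ e) => z /facet_closed cz; rewrite kf ?kf' //.
Qed.

Lemma retr_chart y : retr f c (f y) y. Proof. by exists f. Qed.

Lemma retr_center z q y : closed_facet M c z -> retr f c q y ->
  dist (f z) q = edist z y.
Proof. by move=> cz [k [ck kf <-]]; rewrite -kf // chart_dist. Qed.

(** On a segment from [q] to [q'] in an apartment, each point near time [t] shares a closed facet
    with the point at [t]. A chart containing this facet and the central chamber shows that the
    retraction preserves their distance. *)
Lemma retr_lipschitz q q' y y' : retr f c q y -> retr f c q' y' ->
  edist y y' <= dist q q'.
Proof.
move=> hq hq'; have [h [x0 [x1 [ch h0 h1]]]] := chart_pair q q'.
have [rho hrho] := choice retr_exists.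
pose u := x1 - x0; pose F t := rho (h (x0 + t *: u)).
have <- : F 0 = y.
  apply: (@retr_unique q) => //.
  by have := hrho (h (x0 + 0 *: u)); rewrite -/(F 0) scale0r addr0 h0.
have <- : F 1 = y'.
  apply: (@retr_unique q') => //.
  by have := hrho (h (x0 + 1 *: u)); rewrite -/(F 1) scale1r /u addrC subrK h1.
have -> : dist q q' = enorm u by rewrite -h0 -h1 chart_dist // edistC.
apply: lipschitz_local_global; first exact: enorm_ge0.
- exact: edistxx.
- exact: edist_tri.
move=> t _; have [d d0 hd] := closed_facet_segment M x0 u t.
exists d => // s /hd hs.
have [k [w [ck ww kf hk]]] := chart_join c (x0 + s *: u) cf ch.
have FE r : closed_facet M (x0 + s *: u) (x0 + r *: u) -> F r = w (x0 + r *: u).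
  move=> hr; apply: retr_unique (hrho _) _; exists k; split=> //; rewrite hk //.
rewrite !FE //; last exact: closed_facet_refl.
by rewrite !(gam_iso (weyl_gam ww)) !edistDl !edistZr (distrC t s) mulrC lexx.
Qed.

End Center.

Lemma dist_ge0 p q : 0 <= dist p q.
Proof.
by have [f [x [y [cf <- <-]]]] := chart_pair p q; rewrite chart_dist // edist_ge0.
Qed.

Lemma dist_eq0 p q : dist p q = 0 -> p = q.
Proof.
have [f [x [y [cf <- <-]]]] := chart_pair p q; rewrite chart_dist //.
by move=> /edist_eq0 ->.
Qed.

Lemma distxx p : dist p p = 0.
Proof. by have [f [x [cf <-]]] := chart_at p; rewrite chart_dist // edistxx. Qed.

Lemma dist_sym p q : dist p q = dist q p.
Proof.
by have [f [x [y [cf <- <-]]]] := chart_pair p q; rewrite !chart_dist // edistC.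
Qed.

(** Nothing is assumed of [dist] beyond isometric charts; retracting [q] onto an apartment through
    [p] and [r] reduces to the Euclidean inequality. *)
Lemma dist_tri p q r : dist p r <= dist p q + dist q r.
Proof.
have [f [x [z [cf <- <-]]]] := chart_pair p r.
have [c cc _] := chamber_near M x; have [y hy] := retr_exists c cf q.
rewrite chart_dist //; apply: le_trans (edist_tri x y z) _.
by apply: lerD; apply: (retr_lipschitz cf cc) => //; exact: retr_chart.
Qed.

(* The midpoint is forced because the retraction centered at the midpoint in an
   apartment is distance nonincreasing and preserves distances from there. *)
Lemma chart_midpoint f x y p : chart B f ->
  dist (f x) p = dist (f x) (f y) / 2 -> dist p (f y) = dist (f x) (f y) / 2 ->
  p = f (2^-1 *: (x + y)).
Proof.
move=> cf; rewrite chart_dist // => h1 h2; set m := 2^-1 *: (x + y).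
have [c cc cm] := chamber_near M m; have [z hz] := retr_exists c cf p.
have := retr_lipschitz cf cc (retr_chart _ cf x) hz.
have := retr_lipschitz cf cc hz (retr_chart _ cf y).
rewrite h1 h2 => zy xz.
suff zm : z = m.
  by apply/esym/dist_eq0; rewrite (retr_center cm hz) zm edistxx.
apply: edist_eq0; apply/eqP; rewrite -sqrf_eq0 eq_le sqr_ge0 andbT sqr_edist.
have e0 := edist_ge0 x y.
have : edist x z ^+ 2 <= (edist x y / 2) ^+ 2.
  by rewrite ler_pXn2r ?nnegrE ?edist_ge0 ?divr_ge0.
have : edist z y ^+ 2 <= (edist x y / 2) ^+ 2.
  by rewrite ler_pXn2r ?nnegrE ?edist_ge0 ?divr_ge0.
rewrite !expr_div_n !sqr_edist /m !dotE (dotC y x) (dotC z x) (dotC z y).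
lra.
Qed.

(** Retract [q] from a chamber at the midpoint: the distance to the midpoint is kept, the other two
    do not grow, and the Euclidean identity for medians concludes. *)
Lemma CN_inequality (x y m q : B) : dist x m = dist x y / 2 -> dist m y = dist x y / 2 ->
  4 * dist q m ^+ 2 <= 2 * dist q x ^+ 2 + 2 * dist q y ^+ 2 - dist x y ^+ 2.
Proof.
have [f [x0 [y0 [cf <- <-]]]] := chart_pair x y => h1 h2.
rewrite (chart_midpoint cf h1 h2) chart_dist //; set m0 := 2^-1 *: _.
have [c cc cm] := chamber_near M m0; have [z hz] := retr_exists c cf q.
rewrite (dist_sym q (f m0)) (retr_center cm hz).
have l t : edist z t ^+ 2 <= dist q (f t) ^+ 2.
  rewrite ler_pXn2r ?nnegrE ?edist_ge0 ?dist_ge0 //.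
  exact: (retr_lipschitz cf cc hz (retr_chart _ cf t)).
have := l x0; have := l y0; rewrite !sqr_edist /m0 !dotE.
rewrite (dotC y0 x0) (dotC z x0) (dotC z y0); lra.
Qed.

Lemma dist_midpoints (a b c m m' : B) :
  dist a m = dist a b / 2 -> dist m b = dist a b / 2 ->
  dist a m' = dist a c / 2 -> dist m' c = dist a c / 2 ->
  dist m m' <= dist b c / 2.
Proof.
move=> h1 h2 h3 h4.
have := CN_inequality m h3 h4; have := CN_inequality c h1 h2.
rewrite (dist_sym m a) h1 (dist_sym c m) (dist_sym c a) (dist_sym c b) => i1 i2.
rewrite -(@ler_pXn2r _ 2) ?nnegrE ?divr_ge0 ?dist_ge0 //; nra.
Qed.

(** Cut the quadrilateral along the diagonal from [a] to [b'] and pass through its midpoint. *)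
Lemma dist_midpoints4 (a b a' b' m m' : B) :
  dist a m = dist a b / 2 -> dist m b = dist a b / 2 ->
  dist a' m' = dist a' b' / 2 -> dist m' b' = dist a' b' / 2 ->
  dist m m' <= (dist a a' + dist b b') / 2.
Proof.
move=> h1 h2 h3 h4.
have [f [x [y [cf xa yb]]]] := chart_pair a b'.
pose z := 2^-1 *: (x + y).
have half t : t \in [:: x; y] -> dist (f z) (f t) = dist a b' / 2.
  rewrite -xa -yb !chart_dist // /z !inE => /orP[/eqP ->|/eqP ->].
    rewrite (_ : edist x y = enorm (y - x)); last by rewrite edistC.
    rewrite edistE [X in enorm X](_ : _ = 2^-1 *: (y - x)) ?enormZ.
      by rewrite ger0_norm ?invr_ge0 // mulrC.
    by apply/rowP => i; rewrite !mxE; lra.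
  rewrite edistE [X in enorm X](_ : _ = 2^-1 *: (x - y)) ?enormZ.
    by rewrite ger0_norm ?invr_ge0 // mulrC.
  by apply/rowP => i; rewrite !mxE; lra.
have h5 : dist a (f z) = dist a b' / 2.
  by rewrite -{1}xa dist_sym half // mem_head.
have h6 : dist (f z) b' = dist a b' / 2.
  by rewrite -{1}yb half // !inE eqxx orbT.
have := dist_midpoints h1 h2 h5 h6.
have h7 : dist b' (f z) = dist b' a / 2 by rewrite dist_sym h6 (dist_sym a).
have h8 : dist (f z) a = dist b' a / 2 by rewrite dist_sym h5 (dist_sym a).
have h9 : dist b' m' = dist b' a' / 2 by rewrite dist_sym h4 (dist_sym a').
have h10 : dist m' a' = dist b' a' / 2 by rewrite dist_sym h3 (dist_sym a').
have := dist_midpoints h7 h8 h9 h10.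
have := dist_tri m (f z) m'; lra.
Qed.

End Retraction.

(** * Rays and ideal simplices *)

(** Midpoint convexity doubles an excess over [F 0] at each doubling of the argument, which forces
    linear growth. *)
Lemma midconvex_sublinear (R : realType) (F : R -> R) : 0 <= F 0 ->
  (forall t, 0 <= t -> 2 * F t <= F 0 + F (2 * t)) ->
  (forall e, 0 < e -> exists T, forall t, T <= t -> F t <= e * t) ->
  forall t, 0 <= t -> F t <= F 0.
Proof.
move=> F0 conv sub t; rewrite le_eqVlt => /orP[/eqP <- //|t0].
rewrite leNgt; apply/negP => lt; pose d := F t - F 0.
have d0 : 0 < d by rewrite subr_gt0.
have growth k : 2 ^+ k * d <= F (2 ^+ k * t) - F 0.
  elim: k => [|k IH]; first by rewrite !expr0 !mul1r.
  have : 0 <= 2 ^+ k * t by rewrite mulr_ge0 ?exprn_ge0 // ltW.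
  by move=> /conv; rewrite !exprS -!mulrA; lra.
have e0 : 0 < d / (2 * t) by rewrite divr_gt0 // mulr_gt0.
have [T hT] := sub _ e0.
pose k := Num.bound (T / t).
have Tk : T <= 2 ^+ k * t.
  by rewrite -ler_pdivrMr //; apply/ltW/upper_nthrootP.
have := growth k; have := hT _ Tk.
have -> : d / (2 * t) * (2 ^+ k * t) = 2 ^+ k * d / 2 by field; exact: lt0r_neq0.
have : 0 < 2 ^+ k * d by rewrite mulr_gt0 // exprn_gt0.
lra.
Qed.

Section Rays.
Context {R : realType} {n : nat} {M : affine_coxeter R n} {B : building M}.
Implicit Types (x y z u v : 'rV[R]_n) (f : 'rV[R]_n -> B) (g : aut B) (r : R -> B).

Lemma asymptotic_refl r : asymptotic r r.
Proof. by exists 0 => t _; rewrite distxx. Qed.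

Lemma asymptotic_sym r r' : asymptotic r r' -> asymptotic r' r.
Proof. by move=> [K hK]; exists K => t t0; rewrite dist_sym hK. Qed.

Lemma asymptotic_trans r r' r'' :
  asymptotic r r' -> asymptotic r' r'' -> asymptotic r r''.
Proof.
move=> [K hK] [L hL]; exists (K + L) => t t0.
by apply: le_trans (dist_tri _ (r' t) _) _; rewrite lerD ?hK ?hL.
Qed.

Lemma endpoint_eq r r' : asymptotic r r' -> endpoint r = endpoint r'.
Proof.
move=> h; apply/seteqP; split=> s [rs as_]; split=> //.
  exact: asymptotic_trans (asymptotic_sym h) as_.
exact: asymptotic_trans h as_.
Qed.

Lemma endpointP r r' : ray r' -> endpoint r = endpoint r' <-> asymptotic r r'.
Proof.
move=> rr'; split=> [e|]; last exact: endpoint_eq.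
have : endpoint r' r' by split=> //; exact: asymptotic_refl.
by rewrite -e => -[].
Qed.

Lemma aut_dist g (p q : B) : dist (g p) (g q) = dist p q.
Proof. by have [] := autP g. Qed.

Lemma aut1E (p : B) : (1%g : aut B) p = p. Proof. by []. Qed.
Lemma autME g g' (p : B) : (g * g')%g p = g (g' p). Proof. by []. Qed.
Lemma autVK g : cancel g (g^-1)%g.
Proof. by move=> p; rewrite -autME mulVg. Qed.
Lemma autKV g : cancel (g^-1)%g g.
Proof. by move=> p; rewrite -autME mulgV. Qed.

Lemma aut_ray g r : ray r -> ray (g \o r).
Proof. by move=> h s t s0 t0; rewrite /= aut_dist h. Qed.

Lemma ideal_act_endpoint g r : ideal_act g (endpoint r) = endpoint (g \o r).
Proof.
apply/seteqP; split=> [_ [s [rs [K hK]] <-]|s [rs [K hK]]].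
  by split; [exact: aut_ray|exists K => t t0 /=; rewrite aut_dist hK].
exists ((g^-1)%g \o s); last by apply/funext => t /=; rewrite autKV.
split; first exact: aut_ray.
by exists K => t t0 /=; rewrite -(aut_dist g) autKV; exact: hK.
Qed.

Lemma ideal_act1 (xi : set (R -> B)) : ideal_act (1 : aut B)%g xi = xi.
Proof. by apply/seteqP; split=> [_ [r xr <-]//|r xr]; exists r. Qed.

Lemma ideal_actM g g' (xi : set (R -> B)) :
  ideal_act (g * g')%g xi = ideal_act g (ideal_act g' xi).
Proof. by rewrite /ideal_act image_comp. Qed.

Lemma ray_dist_le r r' : ray r -> ray r' ->
  (forall e, 0 < e -> exists T, forall t, T <= t -> dist (r t) (r' t) <= e * t) ->
  forall t, 0 <= t -> dist (r t) (r' t) <= dist (r 0) (r' 0).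
Proof.
move=> rr rr' sub; apply: midconvex_sublinear sub; first exact: dist_ge0.
move=> t t0; have t20 : 0 <= 2 * t by rewrite mulr_ge0.
have h (s : R -> B) : ray s -> dist (s 0) (s t) = dist (s 0) (s (2 * t)) / 2 /\
    dist (s t) (s (2 * t)) = dist (s 0) (s (2 * t)) / 2.
  move=> rs; rewrite !rs // !sub0r !normrN (ger0_norm t0) (ger0_norm t20).
  by rewrite distrC ger0_norm; lra.
have [h1 h2] := h _ rr; have [h3 h4] := h _ rr'.
by have := dist_midpoints4 h1 h2 h3 h4; lra.
Qed.

Lemma asymptotic_dist_le r r' : ray r -> ray r' -> asymptotic r r' ->
  forall t, 0 <= t -> dist (r t) (r' t) <= dist (r 0) (r' 0).
Proof.
move=> rr rr' [K hK]; apply: ray_dist_le => // e e0.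
exists (Num.max 0 (K / e)) => t; rewrite ge_max => /andP[t0].
by rewrite ler_pdivrMr // mulrC; apply: le_trans; exact: hK.
Qed.

Lemma chart_ray f v : chart B f -> dot v v = 1 -> ray (fun t => f (t *: v)).
Proof.
move=> cf v1 s t _ _; rewrite chart_dist // edistZr.
by rewrite (_ : enorm v = 1) ?mulr1 // /enorm v1 sqrtr1.
Qed.

Lemma enorm1 v : dot v v = 1 -> enorm v = 1.
Proof. by rewrite /enorm => ->; rewrite sqrtr1. Qed.

Definition disp g f x := dist (f x) (g (f x)).

(* For unit [v] this means that [g] fixes the ideal point in the direction of
   [v] in the apartment of [f]. *)
Definition fixes_dir g f v := forall x t, 0 <= t -> disp g f (x + t *: v) <= disp g f x.

Lemma disp_lipschitz g f x y : chart B f -> disp g f x <= disp g f y + 2 * edist x y.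
Proof.
move=> cf; rewrite /disp; have := dist_tri (f x) (f y) (g (f x)).
have := dist_tri (f y) (g (f y)) (g (f x)).
by rewrite aut_dist !chart_dist // (edistC y x); lra.
Qed.

Lemma fixes_dirD g f u v : fixes_dir g f u -> fixes_dir g f v -> fixes_dir g f (u + v).
Proof.
by move=> hu hv x t t0; rewrite scalerDr addrA; apply: le_trans (hv _ _ t0) (hu _ _ t0).
Qed.

Lemma fixes_dirZ g f c v : 0 <= c -> fixes_dir g f v -> fixes_dir g f (c *: v).
Proof. by move=> c0 hv x t t0; rewrite scalerA; apply: hv; exact: mulr_ge0. Qed.

Lemma chart_mid f x y : chart B f ->
  dist (f x) (f (2^-1 *: (x + y))) = dist (f x) (f y) / 2 /\
  dist (f (2^-1 *: (x + y))) (f y) = dist (f x) (f y) / 2.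
Proof.
move=> cf; rewrite !chart_dist // !edistE.
have -> : x - 2^-1 *: (x + y) = 2^-1 *: (x - y).
  by apply/rowP => i; rewrite !mxE; lra.
have -> : 2^-1 *: (x + y) - y = 2^-1 *: (x - y).
  by apply/rowP => i; rewrite !mxE; lra.
by rewrite enormZ ger0_norm ?invr_ge0 // mulrC.
Qed.

(** The displacement is convex on each line and parallel lines stay at bounded distance, so
    sublinear growth on one of them makes it nonincreasing on all. *)
Lemma fixes_dir_sublinear g f v : chart B f ->
  (forall e, 0 < e -> exists T, forall t, T <= t -> disp g f (t *: v) <= e * t) ->
  fixes_dir g f v.
Proof.
move=> cf sub x t t0; rewrite -{2}(addr0 x) -(scale0r v).
apply: (midconvex_sublinear (F := fun t => disp g f (x + t *: v))) t0.
- exact: dist_ge0.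
- move=> {}t t0; set a := x + 0 *: v; set b := x + (2 * t) *: v.
  have -> : x + t *: v = 2^-1 *: (a + b).
    by rewrite /a /b; apply/rowP => i; rewrite !mxE; lra.
  have [h1 h2] := chart_mid a b cf.
  have h3 : dist (g (f a)) (g (f (2^-1 *: (a + b)))) = dist (g (f a)) (g (f b)) / 2.
    by rewrite !aut_dist.
  have h4 : dist (g (f (2^-1 *: (a + b)))) (g (f b)) = dist (g (f a)) (g (f b)) / 2.
    by rewrite !aut_dist.
  by have := dist_midpoints4 h1 h2 h3 h4; rewrite /disp; lra.
- move=> e e0; have [|T hT] := sub (e / 2); first by rewrite divr_gt0.
  exists (Num.max T (4 * enorm x / e)) => {}t; rewrite ge_max => /andP[/hT h].
  rewrite ler_pdivrMr // => h'.
  have := disp_lipschitz g (x + t *: v) (t *: v) cf.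
  by rewrite edistC addrC edistr; lra.
Qed.

Lemma fixes_dirP g f v : chart B f -> dot v v = 1 ->
  ideal_act g (endpoint (fun t => f (t *: v))) = endpoint (fun t => f (t *: v)) <->
  fixes_dir g f v.
Proof.
move=> cf v1; rewrite ideal_act_endpoint; have rf := chart_ray cf v1; split.
  move=> /esym /endpointP => /(_ (aut_ray g rf)) [K hK].
  apply: fixes_dir_sublinear => // e e0.
  exists (Num.max 0 (K / e)) => t; rewrite ge_max => /andP[t0].
  by rewrite ler_pdivrMr // mulrC; apply: le_trans; exact: hK.
move=> h; apply/esym/endpoint_eq; exists (disp g f 0) => t t0.
by have := h 0 t t0; rewrite add0r.
Qed.

Definition conic (F : set 'rV[R]_n) :=
  (forall v, F v -> v != 0) /\ (forall c v, 0 < c -> F v -> F (c *: v)).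

Lemma fixes_facet g f F : chart B f -> conic F ->
  (forall xi, ideal_facet f F xi -> ideal_act g xi = xi) <->
  (forall v, F v -> fixes_dir g f v).
Proof.
move=> cf [F0 FZ]; split=> [h v Fv|h _ [v [Fv v1] <-]]; last first.
  by apply/fixes_dirP => //; exact: h.
have v0 : 0 < enorm v.
  rewrite lt_neqAle enorm_ge0 andbT eq_sym.
  by apply: contra_neq (F0 v Fv) => /enorm_eq0.
rewrite -(scale1r v) -(mulfV (lt0r_neq0 v0)) -scalerA.
apply: fixes_dirZ; first exact: ltW.
have u1 : dot ((enorm v)^-1 *: v) ((enorm v)^-1 *: v) = 1.
  rewrite !dotE -sqr_enorm; field; exact: lt0r_neq0.
apply/fixes_dirP => //; apply: h; exists ((enorm v)^-1 *: v) => //; split=> //.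
by apply: FZ => //; rewrite invr_gt0.
Qed.

Lemma face_conic (J : {set 'I_n}) : (J \proper [set: 'I_n])%SET -> conic (face M J).
Proof.
rewrite properE => /andP[_ /fintype.subsetPn [i _ iJ]]; split=> [v Jv|c v c0 Jv j].
  by apply/eqP => v0; have := Jv i; rewrite (negPf iJ) v0 dot0r ltxx.
rewrite dotZr; have := Jv j; case: ifP => _ h; first by rewrite h mulr0.
exact: mulr_gt0.
Qed.

Lemma conicN (F : set 'rV[R]_n) : conic F -> conic (-%R @` F).
Proof.
move=> [F0 FZ]; split=> [_ [v Fv <-]|c _ c0 [v Fv <-]]; first by rewrite oppr_eq0 F0.
by exists (c *: v); [exact: FZ|rewrite scalerN].
Qed.

(** Fixed directions form a closed set: [v] is a limit of the vectors [v + d *: v'] of the open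
    cone, with [d] chosen so that the error grows at rate at most [e / 2]. *)
Lemma fixes_sub_face g f (J : {set 'I_n}) : chart B f ->
  (forall v, face M finset.set0 v -> fixes_dir g f v) ->
  forall v, face M J v -> fixes_dir g f v.
Proof.
move=> cf h v Jv; apply: fixes_dir_sublinear => // e e0.
have [v' hv'] := cone_vector M.
have n0 : 0 < 4 * (enorm v' + 1) by rewrite mulr_gt0 // ltr_wpDl ?enorm_ge0.
pose d := e / (4 * (enorm v' + 1)).
have d0 : 0 < d by rewrite divr_gt0.
have hd : fixes_dir g f (v + d *: v').
  apply: h => i; rewrite finset.in_set0 dotDr dotZr.
  by apply: ltr_wpDl; [exact: (@face_ccone _ _ M J v Jv i)|apply: mulr_gt0].
exists (Num.max 0 (2 * disp g f 0 / e)) => t; rewrite ge_max => /andP[t0].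
rewrite ler_pdivrMr // => hT.
have := disp_lipschitz g (t *: v) (t *: (v + d *: v')) cf.
have := hd 0 t t0; rewrite add0r scalerDr edistr !enormZ.
rewrite (ger0_norm t0) (gtr0_norm d0).
have : d * enorm v' <= e / 4.
  have : d * (enorm v' + 1) = e / 4.
    rewrite /d; field; apply: lt0r_neq0; exact: ltr_wpDl (enorm_ge0 _) ltr01.
  by rewrite mulrDr mulr1; lra.
move=> /(ler_wpM2l t0); lra.
Qed.

(* The fixed directions form a convex cone; together with the open face [J] and
   the opposite of one of its points, it contains the opposite face. *)
Lemma fixes_opposite_face g f (J : {set 'I_n}) v0 : chart B f ->
  (forall v, face M J v -> fixes_dir g f v) -> face M J v0 -> fixes_dir g f (- v0) ->
  forall v, face M J v -> fixes_dir g f (- v).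
Proof.
move=> cf h Jv0 hN v Jv.
have [_ [e e0 [_ hc]]] := (faceP v Jv0).1 Jv.
have hw : fixes_dir g f (v0 - (e / 2) *: v).
  apply: h => i; have := hc i; have := Jv0 i; have := Jv i; rewrite !dotBr !dotZr.
  case: ifP => _ Ji J0i; first by move=> _; rewrite Ji J0i mulr0 subrr.
  have : 0 < e * dot (normal M i) v by exact: mulr_gt0.
  lra.
have -> : - v = (2 / e) *: (v0 - (e / 2) *: v + - v0).
  rewrite addrC addKr scalerN scalerA (_ : 2 / e * (e / 2) = 1) ?scale1r //.
  by field; exact: lt0r_neq0.
by apply: fixes_dirZ; [rewrite divr_ge0 // ltW|exact: fixes_dirD].
Qed.

End Rays.

(** * Automorphisms and local compactness *)

Section Automorphisms.
Context {R : realType} {n : nat} {M : affine_coxeter R n} {B : building M}.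
Implicit Types (x y z u v : 'rV[R]_n) (f h k : 'rV[R]_n -> B) (g : aut B) (p q : B).

Let sys := chart_system B.

Lemma chart_image_facet f k x z w : chart B f -> chart B k -> weyl M w ->
  (forall u, closed_facet M x u -> f u = k (w u)) ->
  f @` facet M x = k @` facet M (w x).
Proof.
move=> cf ck ww e; rewrite -(gam_image_facet _ (weyl_gam ww)) image_comp.
by apply: eq_imagel => u /facet_closed /e.
Qed.

(** Automorphisms preserve simplices and apartments but perhaps not colors, so [phi] is only an
    isometry permuting facets; [facets_gam] recovers the walls. *)
Lemma aut_chart g f : chart B f -> exists h phi,
  [/\ chart B h, gam M phi & forall x, g (f x) = h (phi x)].
Proof.
move=> cf; have [_ gd gs ga] := autP g.
have [h ch hE] : apartment (g @` range f) by apply/ga; exists f.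
have /choice [phi hphi] x : exists y, g (f x) = h y.
  have [y _ <-] : range h (g (f x)) by rewrite -hE; exists (f x) => //; exists x.
  by exists y.
have ip : iso phi.
  by move=> x y; rewrite -(chart_dist _ _ ch) -!hphi gd chart_dist.
have /choice [psi hpsi] y : exists x, phi x = y.
  have : range h (h y) by exists y.
  rewrite -hE => -[_ [x _ <-] e]; exists x; apply: (chart_inj ch).
  by rewrite -hphi.
have c1 : cancel phi psi by move=> x; apply: (iso_inj ip).
exists h, phi; split=> //; apply: (facets_gam ip c1 hpsi) => x.
have [k [z [ck kE]]] : simplex (g @` (f @` facet M x)) by apply/gs; exists f, x.
have [z' zz' kz'] : (k @` facet M z) (g (f x)).
  by rewrite -kE; exists (f x) => //; exists x.
have [w ww [_ wE]] := chart_overlap ck ch.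
have {}wE : forall u, closed_facet M z' u -> k u = h (w u).
  by apply: wE; rewrite kz' hphi; exists (phi x).
have wz' : w z' = phi x.
  by apply: (chart_inj ch); rewrite -hphi -kz' wE //; exact: closed_facet_refl.
have := chart_image_facet z' ck ch ww wE; rewrite -(facet_eq zz') -kE wz' image_comp.
rewrite (_ : g \o f = h \o phi); last by apply/funext => u /=.
rewrite -image_comp => e.
have sub A A' : h @` A = h @` A' -> A `<=` A'.
  move=> AE u Au; have : (h @` A) (h u) by exists u.
  by rewrite AE => -[u' + /(chart_inj ch) <-].
by apply/seteqP; split; apply: sub.
Qed.

Definition frame (c : 'rV[R]_n) (s : seq 'rV[rat]_n) :=
  [/\ exists t, t \in s, forall t, t \in s -> facet M c (map_mx ratr t) &
  forall phi psi : 'rV[R]_n -> 'rV[R]_n, iso phi -> iso psi ->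
    (forall t, t \in s -> phi (map_mx ratr t) = psi (map_mx ratr t)) -> phi = psi].

Lemma aut_agree g g' f c s : chart B f -> frame c s ->
  (forall t, t \in s -> g (f (map_mx ratr t)) = g' (f (map_mx ratr t))) ->
  forall z, closed_facet M c z -> g (f z) = g' (f z).
Proof.
move=> cf [[q qs] hs det] e z cz.
have [h [phi [ch gp hE]]] := aut_chart g cf.
have [h' [phi' [ch' gp' hE']]] := aut_chart g' cf.
have [w ww [w1 w2]] := chart_overlap ch ch'.
have pE : phi' = w \o phi.
  apply: det; [exact: gam_iso gp'| |].
    exact: iso_comp (gam_iso (weyl_gam ww)) (gam_iso gp).
  by move=> r rs; apply: w1; rewrite -hE -hE' e.
rewrite hE hE' pE /= (w2 (phi (map_mx ratr q))) //.
  by exists (phi' (map_mx ratr q)) => //; rewrite -hE' -hE e.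
apply: gam_closed_facet => //; apply: closed_facet_trans cz.
exact/facet_closed/facet_sym/hs.
Qed.

(** * Finiteness of the set of points in a given position *)

Section Finiteness.
Hypothesis hlf : locally_finite B.
Variables (f0 : 'rV[R]_n -> B) (y0 : 'rV[R]_n).
Hypothesis cf0 : chart B f0.
Let o := f0 y0.

Definition at_type y := [set p | exists f, [/\ chart B f, f y0 = o & f y = p]].

(** Each point in position [x] is in the closure of finitely many chambers. Given the image of [c]
    and the value at [x], two charts differ on the closed chamber by one of the finitely many
    automorphisms of the complex fixing [x]. *)
Lemma at_type_step c x y : closed_facet M c x -> closed_facet M c y ->
  in_chamber M c -> finite_set (at_type x) -> finite_set (at_type y).
Proof.
move=> cx cy cc finx.
apply: (@sub_finite_set _ _ (\bigcup_(p in at_type x)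
   [set q | exists f, [/\ chart B f, f x = p & f y = q]])).
  by move=> q [f [cf fo fy]]; exists (f x); exists f.
apply: bigcup_finite => // p [fp [cfp _ fpx]].
have sF : simplex (fp @` facet M x) by exists fp, x.
apply: (@sub_finite_set _ _
  (\bigcup_(C in [set C | chamber C /\ is_face (fp @` facet M x) C])
   [set q | exists f, [/\ chart B f, f x = p, f @` facet M c = C & f y = q]])).
  move=> q [f [cf fx fy]]; exists (f @` facet M c); last by exists f.
  split; first by exists f, c.
  exists f, x, c; split=> //.
  have [w ww [_ wE]] := chart_overlap cf cfp.
  have {}wE : forall u, closed_facet M x u -> f u = fp (w u).
    by apply: wE; rewrite fx -fpx; exists x.
  have wx : w x = x.
    by apply: (chart_inj cfp); rewrite -wE ?fx ?fpx //; exact: closed_facet_refl.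
  by rewrite (chart_image_facet x cf cfp ww wE) wx.
apply: bigcup_finite; first exact: hlf.
move=> C _; set S := [set q | _].
have [[_ [fC [cfC fCx fCc _]]]|S0] := pselect (S !=set0); last first.
  by rewrite (_ : S = set0) //; apply/nonemptyPn.
apply: (@sub_finite_set _ _ ((fun w => fC (w y)) @`
   [set w | gam M w /\ edist (w x) x <= 0])); last exact/finite_image/gam_finite.
move=> q [f [cf fx fc <-]].
have [w ww [_ wE]] := chart_overlap cf cfC.
have {}wE : forall u, closed_facet M c u -> f u = fC (w u).
  apply: wE; have : (f @` facet M c) (f c) by exists c.
  by rewrite fc -fCc => -[u _ <-]; exists u.
have wx : w x = x by apply: (chart_inj cfC); rewrite -wE // fx fCx.
by exists w; [split; [exact: weyl_gam|rewrite wx edistxx]|rewrite -wE].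
Qed.

Lemma at_type_finite y : finite_set (at_type y).
Proof.
pose X t := y0 + t *: (y - y0).
have near t : exists2 e, 0 < e & forall s, `|s - t| < e ->
    finite_set (at_type (X s)) <-> finite_set (at_type (X t)).
  have [e e0 he] := closed_facet_segment M y0 (y - y0) t.
  exists e => // s /he st; have [c cc cs] := chamber_near M (X s).
  by split; apply: (at_type_step _ _ cc) => //; exact: closed_facet_trans cs st.
have <- : X 1 = y by rewrite /X scale1r addrC subrK.
apply: (@real_induction _ (fun t => finite_set (at_type (X t)))).
- rewrite /X scale0r addr0 (_ : at_type y0 = [set o]) //.
  apply/seteqP; split=> [p [f [_ + fp]]|p ->]; first by rewrite fp.
  by exists f0.
- move=> t _ Qt; have [e e0 he] := near t; exists e => // s /andP[ts se].
  by apply/he => //; rewrite ger0_norm; lra.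
- move=> t /andP[t0 _] Qs; have [e e0 he] := near t.
  pose s := Num.max 0 (t - e / 2).
  have st : s < t by rewrite gt_max t0 gtrDl oppr_lt0 divr_gt0.
  have sd : t - e / 2 <= s by rewrite le_max lexx orbT.
  have s0 : 0 <= s by rewrite le_max lexx.
  apply/(he s); first by rewrite ltr0_norm; lra.
  by apply: Qs; rewrite s0.
Qed.

Lemma chart_from_base q : exists k y, [/\ chart B k, k y0 = o & k y = q].
Proof.
have [k [y [ck e ky]]] := chart_join_pt y0 q cf0.
by exists k, y; split=> //; rewrite e //; exact: closed_facet_refl.
Qed.

(** The position of [g p] in a chart based at [o] is the image of [y] under an automorphism of the
    complex and is at bounded distance from [y0]; this leaves finitely many positions. *)
Lemma bounded_orbit p K : finite_set [set q | exists2 g : aut B,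
  dist (g o) o <= K & g p = q].
Proof.
have [f [y [cf fy]]] := chart_at p.
apply: (@sub_finite_set _ _ (\bigcup_(y' in (fun phi => phi y) @`
    [set phi | gam M phi /\ edist (phi y) y0 <= K + dist o p]) at_type y')).
  move=> _ [g gK <-]; have [h [phi [ch gp hE]]] := aut_chart g cf.
  have [k [y' [ck ko ky']]] := chart_from_base (g p).
  have [w ww [wE _]] := chart_overlap ch ck.
  have y'E : y' = w (phi y) by apply: wE; rewrite -hE fy ky'.
  exists y'; last by exists k.
  exists (w \o phi) => //=; split; first by apply: gam_comp => //; exact: weyl_gam.
  rewrite -y'E edistC -(chart_dist _ _ ck) ko ky'.
  apply: le_trans (dist_tri _ (g o) _) _; rewrite aut_dist lerD2r dist_sym.
  exact: gK.
apply: bigcup_finite; first exact/finite_image/gam_finite.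
by move=> y' _; exact: at_type_finite.
Qed.

End Finiteness.

(** * Pointwise limits of charts and of automorphisms *)

Section Limit.
Context {I : Type} (F : set_system I) {FF : ProperFilter F}.

(* This is where the completeness of the apartment system is used: [k] and its
   translates by the affine Weyl group can be added to the charts. *)
Lemma chart_limit (k_ : I -> 'rV[R]_n -> B) k : F [set i | chart B (k_ i)] ->
  (forall x, F [set i | forall z, closed_facet M x z -> k_ i z = k z]) -> chart B k.
Proof.
move=> ck agr.
have pick x : exists i, chart B (k_ i) /\ forall z, closed_facet M x z -> k_ i z = k z.
  by have [i [ci hi]] := filter_ex (filterI ck (agr x)); exists i.
have pick2 x y : exists i, [/\ chart B (k_ i),
    forall z, closed_facet M x z -> k_ i z = k z &
    forall z, closed_facet M y z -> k_ i z = k z].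
  by have [i [ci [hi hj]]] := filter_ex (filterI ck (filterI (agr x) (agr y))); exists i.
have r x : closed_facet M x x by exact: closed_facet_refl.
have kd x y : dist (k x) (k y) = edist x y.
  by have [i [ci hx hy]] := pick2 x y; rewrite -hx // -hy // chart_dist.
have kinj : injective k by move=> x y e; apply: edist_eq0; rewrite -kd e distxx.
have compat (g : 'rV[R]_n -> B) : chart B g ->
    exists2 w, weyl M w & forall x y, k x = g y -> y = w x.
  move=> cg.
  have [[x1 [y1 e1]]|/forallNP none] := pselect (exists x y, k x = g y); last first.
    by exists id; [exact: weyl_id|move=> x y e; case: (none x); exists y].
  (* The candidates for [w] are finite in number. If each of them failed at some pair, a chart
     [k_ i] agreeing with [k] at [x1] and at all these pairs would violate its own compatibility
     with [g]. *)
  pose S := [set w | weyl M w /\ w x1 = y1].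
  have Sfin : finite_set S.
    apply: sub_finite_set (gam_finite M x1 y1 0) => w [/weyl_gam gw <-].
    by split=> //; rewrite edistxx.
  apply: contrapT => bad.
  have /choice [b hb] (w : 'rV[R]_n -> 'rV[R]_n) : exists xy : 'rV[R]_n * 'rV[R]_n,
      S w -> k xy.1 = g xy.2 /\ xy.2 <> w xy.1.
    have [[ww wx]|nS] := pselect (S w); last by exists (0, 0).
    apply: contrapT => /forallNP hw; apply: bad; exists w => // x y e.
    apply: contrapT => ne; by apply: (hw (x, y)).
  have FS : F [set i | forall w, S w -> k_ i (b w).1 = k (b w).1].
    apply: finite_filter => // w _; apply: filterS (agr (b w).1) => i; exact.
  have [i [ci [i1 iS]]] := filter_ex (filterI ck (filterI (agr x1) FS)).
  have [w ww [wE _]] := chart_overlap ci cg.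
  have Sw : S w by split=> //; rewrite -(wE x1 y1) // i1.
  have [e ne] := hb w Sw; apply: ne; apply: wE; rewrite iS //.
pose charts' := chart B `|` [set k' | exists2 w, weyl M w & k' = k \o w].
suff : charts' `<=` chart B.
  by apply; right; exists id => //; exact: weyl_id.
apply: chart_complete => [|f cf]; last by left.
have cE x w : weyl M w -> w @` closed_facet M x = closed_facet M (w x).
  by move=> /weyl_gam; exact: gam_image_closed_facet.
have fE x w : weyl M w -> w @` facet M x = facet M (w x).
  by move=> /weyl_gam; exact: gam_image_facet.
split.
- by have [f cf] := charts_nonempty sys; exists f; left.
- by move=> p; have [f cf fp] := charts_cover sys p; exists f => //; left.
- move=> f x y [cf|[w ww ->]]; first exact: chart_dist.
  by rewrite kd; exact: (gam_iso (weyl_gam ww)).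
- move=> f w [cf|[w' ww' ->]] ww; first by left; exact: chart_weyl.
  by right; exists (w' \o w) => //; exact: weyl_comp.
- move=> f g x y [cf|[w ww ->]] [cg|[w' ww' ->]] e.
  + exact: (charts_subcomplex sys cf cg e).
  + have [i [ci hi]] := pick (w' y).
    have e' : f x = k_ i (w' y) by rewrite hi.
    move=> _ [z xz <-]; have [v wv [vE1 vE2]] := chart_overlap cf ci.
    have vx : w' y = v x by exact: vE1.
    have cvz : closed_facet M (w' y) (v z) by rewrite vx -cE //; exists z.
    rewrite (vE2 x) //; last by rewrite e'; exists (w' y).
    rewrite hi //; move: cvz; rewrite -cE // => -[z' _ <-]; by exists z'.
  + have [i [ci hi]] := pick (w x).
    move=> _ [z xz <-] /=; have cwz : closed_facet M (w x) (w z) by rewrite -cE //; exists z.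
    rewrite -hi //; have e' : k_ i (w x) = g y by rewrite hi.
    by apply: (charts_subcomplex sys ci cg e'); exists (w z).
  + have [v [wv c1 c2]] := weyl_inv ww'.
    by move=> _ [z _ <-]; exists (v (w z)) => //=; rewrite c2.
- have tochart f x : charts' f -> exists2 f', chart B f' & f @` facet M x = f' @` facet M x.
    move=> [cf|[w ww ->]]; first by exists f.
    have [i [ci hi]] := pick (w x); exists (k_ i \o w); first exact: chart_weyl.
    rewrite -(image_comp w k) -(image_comp w (k_ i)) fE //.
    by apply: eq_imagel => z /facet_closed /hi.
  move=> f g x y /(tochart _ x) [f' cf' ->] /(tochart _ y) [g' cg' ->].
  by have [h [ch h1 h2]] := charts_join sys x y cf' cg'; exists h; split=> //; left.
- move=> f g [cf|[w ww ->]] [cg|[w' ww' ->]].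
  + exact: (charts_compat sys cf cg).
  + have [v wv vE] := compat f cf; have [v' [wv' c1 c2]] := weyl_inv wv.
    have [w1 [ww1 d1 d2]] := weyl_inv ww'.
    exists (w1 \o v'); first exact: weyl_comp.
    by move=> x y /= /esym /vE ->; rewrite c1 d1.
  + have [v wv vE] := compat g cg; exists (v \o w); first exact: weyl_comp.
    by move=> x y /= /vE.
  + have [v [wv c1 c2]] := weyl_inv ww'; exists (v \o w); first exact: weyl_comp.
    by move=> x y /= /kinj ->; rewrite c1.
Qed.

Variables (a : I -> aut B) (G : B -> B).
Hypothesis aG : forall p, F [set i | a i p = G p].

(** Pointwise convergence on a finite frame makes the [a i] agree with each other on a closed
    chamber, which turns it into simultaneous convergence there. *)
Lemma limit_agree f x : chart B f ->
  F [set i | forall z, closed_facet M x z -> a i (f z) = G (f z)].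
Proof.
move=> cf; have [c cc cx] := chamber_near M x.
have [s fs] := rational_frame cc.
have Fs : F [set i | forall t, [set` s] t ->
    a i (f (map_mx ratr t)) = G (f (map_mx ratr t))].
  by apply: finite_filter => [|t _]; [exact: finite_seq|exact: aG].
have agr i j : (forall t, [set` s] t -> a i (f (map_mx ratr t)) = G (f (map_mx ratr t))) ->
    (forall t, [set` s] t -> a j (f (map_mx ratr t)) = G (f (map_mx ratr t))) ->
    forall z, closed_facet M c z -> a i (f z) = a j (f z).
  move=> hi hj; apply: (aut_agree cf fs) => q qs; by rewrite hi // hj.
apply: filterS (Fs) => i hi z xz; have cz := closed_facet_trans cx xz.
have [j [hj jz]] := filter_ex (filterI Fs (aG (f z))).
by rewrite -jz; apply: agr cz.
Qed.

End Limit.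
End Automorphisms.

Section LimitAutomorphism.
Context {R : realType} {n : nat} {M : affine_coxeter R n} {B : building M}.
Context {I : Type} (F : set_system I) {FF : ProperFilter F}.
Implicit Types (f h k : 'rV[R]_n -> B) (p q : B).

Lemma limit_simplex (a : I -> aut B) (G : B -> B) S :
  (forall p, F [set i | a i p = G p]) -> simplex S -> simplex (G @` S).
Proof.
move=> aG [f [x [cf ->]]].
have Fx : F [set i | forall z, closed_facet M x z -> a i (f z) = G (f z)].
  exact: (limit_agree aG x cf).
have [i hi] := filter_ex Fx.
rewrite (_ : G @` _ = a i @` (f @` facet M x)).
  by have [_ _ gs _] := autP (a i); apply/gs; exists f, x.
by rewrite !image_comp; apply: eq_imagel => z /facet_closed /hi /= ->.
Qed.

Lemma limit_apartment (a : I -> aut B) (G : B -> B) A :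
  (forall p, F [set i | a i p = G p]) -> apartment A -> apartment (G @` A).
Proof.
move=> aG [f cf ->]; have [c cc _] := chamber_near M 0.
have Fc : F [set i | forall z, closed_facet M c z -> a i (f z) = G (f z)].
  exact: (limit_agree aG c cf).
have [i0 hi0] := filter_ex Fc.
have [h0 [phi [ch0 gp h0E]]] := aut_chart (a i0) cf.
have [psi [gq c1 c2]] := gam_inv gp.
(* The map of the complex induced by [a i] depends on [i], but as all these [a i] agree on one
   chamber, the inverse [psi] of a single one turns each of them into a chart. *)
have ck i : (forall z, closed_facet M c z -> a i (f z) = G (f z)) ->
    chart B (fun x => a i (f (psi x))).
  move=> hi; have [h [phi' [ch gp' hE]]] := aut_chart (a i) cf.
  have [w ww [wE _]] := chart_overlap ch0 ch.
  rewrite (_ : (fun _ => _) = h \o w); first exact: chart_weyl.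
  suff pE : phi' = w \o phi by apply/funext => x; rewrite hE pE /= c2.
  apply: (iso_eq_chamber cc); first exact: gam_iso gp'.
    exact: iso_comp (gam_iso (weyl_gam ww)) (gam_iso gp).
  move=> z /facet_closed cz; apply: wE; rewrite -h0E -hE.
  by rewrite (hi z cz); exact: hi0.
exists (fun x => G (f (psi x))).
  apply: (@chart_limit _ _ _ _ _ F _ (fun i x => a i (f (psi x)))).
    by apply: filterS Fc => i; exact: ck.
  move=> x; apply: filterS (limit_agree aG (psi x) cf) => i hi z xz.
  by apply: hi; exact: gam_closed_facet.
apply/seteqP; split=> [_ [_ [x _ <-] <-]|_ [x _ <-]].
  by exists (phi x) => //; rewrite c1.
by exists (f (psi x)) => //; exists (psi x).
Qed.

(** The limit of the inverses supplies bijectivity, as well as the converse implications for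
    simplices and apartments. *)
Lemma limit_aut (a : I -> aut B) (G G' : B -> B) :
  (forall p, F [set i | a i p = G p]) ->
  (forall p, F [set i | (a i)^-1%g p = G' p]) ->
  exists g : aut B, aut_fun g = G.
Proof.
move=> aG aG'.
have c1 : cancel G G'.
  move=> p; have [i [h1 h2]] := filter_ex (filterI (aG p) (aG' (G p))).
  by rewrite -h2 -h1 autVK.
have c2 : cancel G' G.
  move=> p; have [i [h1 h2]] := filter_ex (filterI (aG' p) (aG (G' p))).
  by rewrite -h2 -h1 autKV.
have imK A : G' @` (G @` A) = A.
  rewrite image_comp (_ : G' \o G = id) ?image_id //.
  by apply/funext => x /=; rewrite c1.
suff GP : automorphism G by exists (Aut GP).
split; first by exists G'.
- move=> p q; have [i [h1 h2]] := filter_ex (filterI (aG p) (aG q)).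
  by rewrite -h1 -h2 aut_dist.
- move=> S; split; last exact: limit_simplex aG.
  by move=> /(limit_simplex aG'); rewrite imK.
- move=> A; split; last exact: limit_apartment aG.
  by move=> /(limit_apartment aG'); rewrite imK.
Qed.

End LimitAutomorphism.

Lemma ultra_finite I T (F : set_system I) (f : I -> T) (Y : set T) :
  UltraFilter F -> finite_set Y -> (forall i, Y (f i)) ->
  exists y, F [set i | f i = y].
Proof.
move=> FU Yfin fY; apply: contrapT => /forallNP hN.
have FF : ProperFilter F by exact: ultra_proper.
have FY : F [set i | forall y, Y y -> f i <> y].
  by apply: finite_filter => // y _; have [/hN|] := in_ultra_setVsetC [set i | f i = y] FU.
by have [i /(_ (f i) (fY i))] := filter_ex FY.
Qed.

Section LocallyCompact.
Context {R : realType} {n : nat} {M : affine_coxeter R n} {B : building M}.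
Hypothesis hlf : locally_finite B.
Variables (f0 : 'rV[R]_n -> B) (y0 : 'rV[R]_n).
Hypothesis cf0 : chart B f0.
Let o := f0 y0.

(** Along an ultrafilter at infinity, a sequence of images or preimages of a point, confined to a
    finite set, is eventually constant. *)
Lemma aut_cluster K (a : nat -> aut B) : (forall m, dist (a m o) o <= K) ->
  exists g : aut B, forall E : set B, finite_set E ->
    forall N, exists2 m, (N <= m)%N & forall p, E p -> a m p = g p.
Proof.
move=> aK; have [F [FU Foo]] := ultraFilterLemma eventually_filter.
have FF : ProperFilter F by exact: ultra_proper.
have /choice [G aG] p : exists q, F [set i | a i p = q].
  apply: (@ultra_finite _ _ F (fun i => a i p) _ FU (bounded_orbit hlf y0 cf0 p K)).
  by move=> i; exists (a i).
have /choice [G' aG'] p : exists q, F [set i | (a i)^-1%g p = q].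
  apply: (@ultra_finite _ _ F (fun i => (a i)^-1%g p) _ FU
    (bounded_orbit hlf y0 cf0 p K)) => i; exists (a i)^-1%g => //.
  by rewrite -(aut_dist (a i)) autKV dist_sym.
have [g gE] := limit_aut aG aG'; exists g => E Efin N.
have FE : F [set i | forall p, E p -> a i p = G p] by apply: finite_filter => // p _; exact: aG.
have FN : F [set i | (N <= i)%N] by apply: Foo; exists N.
have [i [Ni Ei]] := filter_ex (filterI FN FE).
by exists i => // p Ep; rewrite gE Ei.
Qed.

(* Countably many points are enough to test the topology of the automorphism
   group, since finitely many rational points of a chamber determine the
   restriction of an automorphism to that chamber. *)
Definition test_points j : set B := [set o] `|`
  [set q | exists2 t : 'rV[rat]_n, (pickle t <= j)%N & at_type f0 y0 (map_mx ratr t) q].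

Definition fix_test j : set (aut B) := [set g | forall q, test_points j q -> g q = q].

Lemma test_points_finite j : finite_set (test_points j).
Proof.
rewrite /test_points finite_setU; split; first exact: finite_set1.
apply: (@sub_finite_set _ _ (\bigcup_(t in [set t : 'rV[rat]_n | (pickle t <= j)%N])
    at_type f0 y0 (map_mx ratr t))).
  by move=> q [t tj tq]; exists t.
apply: bigcup_finite => [|t _]; last exact: at_type_finite.
apply: (@finite_preimage _ _ `I_j.+1 (@pickle 'rV[rat]_n)) => //.
by move=> s t _ _; exact: (pcan_inj pickleK).
Qed.

Lemma test_pointsS i j : (i <= j)%N -> test_points i `<=` test_points j.
Proof.
move=> ij q [->|[t ti tq]]; [by left|right; exists t => //].
exact: leq_trans ti ij.
Qed.

Lemma fix_test_subgroup j : subgroup (fix_test j).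
Proof.
split=> [q _|g h hg hh q jq]; first by rewrite aut1E.
by rewrite autME -{1}(hh q jq) autVK hg.
Qed.

Lemma fix_testS i j : (i <= j)%N -> fix_test j `<=` fix_test i.
Proof. by move=> ij g hg q /(test_pointsS ij) /hg. Qed.

(** The point is in a closed chamber of some chart based at [o], on which the finitely many test
    points of a rational frame determine an automorphism. *)
Lemma fix_test_base p : exists j, forall g, fix_test j g -> g p = p.
Proof.
have [k [y [ck ko ky]]] := chart_from_base y0 cf0 p.
have [c cc cy] := chamber_near M y; have [s fs] := rational_frame cc.
exists (\max_(t <- s) pickle t)%N => g hg.
rewrite -ky -[RHS]/((1 : aut B)%g (k y)); apply: (aut_agree ck fs) cy => t ts.
rewrite aut1E; apply: hg; right; exists t; last by exists k.
by apply: leq_bigmax_seq.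
Qed.

Lemma fix_test_finite E : finite_set E ->
  exists j, forall g, fix_test j g -> forall p, E p -> g p = p.
Proof.
elim/finite_set_ind => [|p A finA [j hj]]; first by exists 0%N.
have [i hi] := fix_test_base p; exists (maxn i j) => g hg q [->|Aq].
  by apply: hi; apply: fix_testS hg; exact: leq_maxl.
by apply: hj Aq; apply: fix_testS hg; exact: leq_maxr.
Qed.

Lemma fix_test_conj (g : aut B) j : exists k, forall v, fix_test k v ->
  fix_test j (g * v * g^-1)%g.
Proof.
have [k hk] := fix_test_finite (finite_image (g^-1)%g (test_points_finite j)).
exists k => v /hk hv q jq; rewrite !autME hv ?autKV //.
Qed.

Lemma fix_test_cluster K (a : nat -> aut B) : (forall m, dist (a m o) o <= K) ->
  exists g : aut B, forall j N, exists2 m, (N <= m)%N & fix_test j (g^-1 * a m)%g.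
Proof.
move=> /aut_cluster [g hg]; exists g => j N.
have [m Nm hm] := hg _ (test_points_finite j) N; exists m => // q jq.
by rewrite autME hm // autVK.
Qed.

End LocallyCompact.

(** * The permutation and Chabauty topologies *)

Section PermutationTopology.
Context {R : realType} {n : nat} {M : affine_coxeter R n} {B : building M}.
Implicit Types (g x : aut B) (p q : B).

Lemma open_eval p q : open [set g : aut B | g p = q].
Proof.
exists [set [set g : aut B | g p = q]]; last by rewrite bigcup_set1.
by move=> _ ->; apply: (@finI_from1 _ _ _ id); exists p, q.
Qed.

(** A basic open set is a finite intersection of conditions [g p = q]; as it contains [x], each [q]
    is [x p]. *)
Lemma nbhs_aut x (U : set (aut B)) : nbhs x U -> exists2 E : set B, finite_set E &
  forall g, (forall p, E p -> g p = x p) -> U g.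
Proof.
rewrite nbhsE => -[V [[D' D'sub <-] [W D'W Wx]] VU].
have [D hD WE] := D'sub W D'W.
have := finite_fset D; set A := (X in finite_set X) => finA.
have /choice [pt hpt] (S : set (aut B)) : exists p, A S -> S = [set g | g p = x p].
  have [AS|nAS] := pselect (A S); last first.
    by have [f cf] := charts_nonempty (chart_system B); exists (f 0).
  have := hD S AS; rewrite inE => -[p [q SE]]; exists p => _.
  suff -> : x p = q by [].
  have : id S x by move: Wx; rewrite -WE; apply.
  by rewrite SE.
exists (pt @` A); first exact: finite_image.
move=> g hg; have Wg : W g.
  rewrite -WE => S SD; change (S g); rewrite (hpt S SD) /=.
  by apply: hg; exists S.
by apply: VU; exists W.
Qed.

Lemma cvg_aut (p : nat -> aut B) x : p @ \oo --> x ->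
  forall q, exists N, forall i, (N <= i)%N -> p i q = x q.
Proof.
move=> px q; have : nbhs x [set g : aut B | g q = x q].
  by apply: open_nbhs_nbhs; split; [exact: open_eval|].
by move=> /px [N _ hN]; exists N => i Ni; exact: hN.
Qed.

Lemma aut_cvg (p : nat -> aut B) x :
  (forall q, exists N, forall i, (N <= i)%N -> p i q = x q) -> p @ \oo --> x.
Proof.
move=> h U /nbhs_aut [E Efin EU].
have : \oo [set i | forall q, E q -> p i q = x q].
  by apply: finite_filter => // q _; have [N hN] := h q; exists N.
by apply: filterS => i /EU.
Qed.

Lemma closed_aut (A : set (aut B)) x : closed A ->
  (forall E : set B, finite_set E -> exists2 g, A g & forall p, E p -> g p = x p) ->
  A x.
Proof.
move=> cA h; apply: contrapT => nAx.
have : nbhs x (~` A) by apply: open_nbhs_nbhs; split => //; exact: closed_openC.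
by move=> /nbhs_aut [E Efin EA]; have [g Ag hg] := h E Efin; exact: EA hg Ag.
Qed.

End PermutationTopology.

Section ChabautyLimit.
Context {T : topologicalType}.

Lemma open_chabauty_compact (K : set T) : compact K ->
  @open (chabauty T) [set F : set T | F `&` K = set0].
Proof.
move=> cK; exists [set [set F : set T | F `&` K = set0]]; last by rewrite bigcup_set1.
by move=> _ ->; apply: (@finI_from1 _ _ _ id); left; exists K.
Qed.

Lemma compact_cvg_tail (p : nat -> T) q N : p @ \oo --> q ->
  compact ([set q] `|` [set p i | i in [set i | (N <= i)%N]]).
Proof.
move=> pq F FF FK.
have [cq|] := pselect (cluster F q); first by exists q; split=> //; left.
move=> /existsNP [A /existsNP [V /not_implyP [FA /not_implyP [Vq]]]].
move=> /nonemptyPn /eqP; rewrite -[_ `&` _]setIC => /eqP VA.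
have [N' _ hN'] := pq V Vq.
have cS : compact (p @` `I_(maxn N N')) by exact/finite_compact/finite_image.
have [||z [[i [/= iN Ni] <-] cz]] := @finite_compact T
   (p @` (`I_(maxn N N') `&` [set i | (N <= i)%N])) _ F FF.
- by apply/finite_image; apply: sub_finite_set (@subIsetl _ _ _) _; exact: finite_II.
- apply: filterS (filterI FA FK) => z [Az [zq|[i Ni iz]]].
    have : (V `&` A) z by split=> //; rewrite zq; exact: nbhs_singleton.
    by rewrite VA.
  exists i => //; split=> //=; rewrite leq_max; apply/orP; right.
  rewrite ltnNge; apply/negP => N'i; have : (V `&` A) z.
    by split=> //; rewrite -iz; exact: hN'.
  by rewrite VA.
- by exists (p i); split=> //; right; exists i.
Qed.

(** If [q] were outside [L], a tail of [p] with its limit would be a compact set disjoint from [L],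
    hence from [F k] for all large [k]. *)
Lemma chabauty_limit_mem (F : nat -> set T) (L : set T) (m : nat -> nat)
    (p : nat -> T) q : chabauty_cvg F L -> closed L ->
  (forall i j, (i < j)%N -> (m i < m j)%N) -> (forall i, F (m i) (p i)) ->
  p @ \oo --> q -> L q.
Proof.
move=> FL cL minc Fp pq; apply: contrapT => nLq.
have : nbhs q (~` L) by apply: open_nbhs_nbhs; split => //; exact: closed_openC.
move=> /pq [N _ hN].
pose K := [set q] `|` [set p i | i in [set i | (N <= i)%N]].
have : nbhs (L : chabauty T) [set F : set T | F `&` K = set0].
  apply: open_nbhs_nbhs; split; first exact/open_chabauty_compact/compact_cvg_tail.
  apply/seteqP; split=> // z [Lz [zq|[i Ni iz]]]; first by apply: nLq; rewrite -zq.
  by apply: (hN i Ni); rewrite /= iz.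
move=> /FL [N' _ hN'].
have mi i : (i <= m i)%N.
  by elim: i => // i IH; apply: leq_ltn_trans IH (minc _ _ _).
pose i := maxn N N'.
have : (F (m i) `&` K) (p i).
  by split=> //; right; exists i => //; exact: leq_maxl.
by rewrite (hN' (m i)) //=; apply: leq_trans (leq_maxr N N') (mi i).
Qed.

End ChabautyLimit.

(** * Opposite ideal simplices *)

Section Boundary.
Context {R : realType} {n : nat} {M : affine_coxeter R n} {B : building M}.
Implicit Types (x y z u v : 'rV[R]_n) (f h k : 'rV[R]_n -> B) (g q : aut B).
Implicit Types (G : set (aut B)) (s sp sm : set (set (R -> B))).

Lemma fixator_subgroup G s : subgroup G -> subgroup (fixator G s).
Proof.
move=> [G1 GV]; split=> [|g h [Gg hg] [Gh hh]].
  by split=> // xi _; exact: ideal_act1.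
split; first exact: GV.
move=> xi sxi; have hV : ideal_act h^-1%g xi = xi.
  by rewrite -{1}(hh xi sxi) -ideal_actM mulVg ideal_act1.
by rewrite ideal_actM hV hg.
Qed.

Lemma subgroupX (T : groupType) (H : set T) (x : T) m : subgroup H -> H x -> H (x ^+ m)%g.
Proof.
move=> sH Hx; elim: m => [|m IH]; first exact: subgroup1.
by rewrite expgS; exact: subgroupM.
Qed.

Lemma face0_proper (J : {set 'I_n}) : (J \proper [set: 'I_n])%SET ->
  (finset.set0 \proper [set: 'I_n])%SET.
Proof. by move=> /(sub_proper_trans (finset.sub0set J)). Qed.

Lemma fixator_sub_simplex G s c g : sub_simplex s c -> fixator G c g -> fixator G s g.
Proof.
move=> [f [J [cf Jp -> ->]]] [Gg hg]; split=> //.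
apply: (fixes_facet g cf (face_conic Jp)).2; apply: fixes_sub_face => //.
exact: (fixes_facet g cf (face_conic (face0_proper Jp))).1.
Qed.

(** The translation part [psi 0] moves rays by a bounded amount, so only the linear part is seen at
    infinity. *)
Lemma ideal_facet_act g f h psi (F : set 'rV[R]_n) : chart B h -> iso psi ->
  (forall y, g (f y) = h (psi y)) ->
  ideal_act g @` ideal_facet f F = ideal_facet h (lin psi @` F).
Proof.
move=> ch ip e.
have key v : ideal_act g (endpoint (fun t => f (t *: v))) =
    endpoint (fun t => h (t *: lin psi v)).
  rewrite ideal_act_endpoint; apply: endpoint_eq; exists (enorm (psi 0)) => t _.
  rewrite /= e chart_dist // edistE (linE psi (t *: v)) linZ //.
  by rewrite addrK.
apply/seteqP; split=> [_ [_ [v [Fv v1] <-] <-]|_ [_ [[v Fv <-] v1] <-]].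
  by exists (lin psi v); rewrite ?key //; split; [exists v|rewrite lin_dot].
exists (endpoint (fun t => f (t *: v))); last exact: key.
by exists v => //; split=> //; rewrite -(lin_dot v v ip).
Qed.

(** The type of the faces may change under [g], but [face_transport] handles a face and its negative
    by the same linear map. *)
Lemma opposite_act g sp sm : opposite sp sm -> ideal_act g @` sp = sp ->
  opposite sp (ideal_act g @` sm).
Proof.
move=> [f [J [cf Jp spE ->]]] gsp.
have [h [phi [ch gp hE]]] := aut_chart g cf.
have [w ww hw] := face_transport gp; have [J' J'p JJ'] := hw J Jp.
have [w' [ww' c1 c2]] := weyl_inv ww.
have ip : iso (w \o phi).
  exact: iso_comp (gam_iso (weyl_gam ww)) (gam_iso gp).
have ch' := chart_weyl ch ww'.
have e y : g (f y) = (h \o w') ((w \o phi) y) by rewrite /= c1.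
exists (h \o w'), J'; split=> //.
  by rewrite -gsp spE (ideal_facet_act _ ch' ip e) JJ'.
rewrite (ideal_facet_act _ ch' ip e) -JJ' !image_comp; congr (ideal_facet _ _).
by apply: eq_imagel => v _ /=; rewrite linN.
Qed.

Lemma fixes_image g s : (forall xi, s xi -> ideal_act g xi = xi) ->
  ideal_act g @` s = s.
Proof.
move=> h; apply/seteqP; split=> [_ [xi sxi <-]|xi sxi]; first by rewrite h.
by exists xi => //; rewrite h.
Qed.

Lemma fixator_image G s g : fixator G s g -> ideal_act g @` s = s.
Proof. by move=> [_ /fixes_image]. Qed.

Lemma image_actM g q s :
  ideal_act (g * q)%g @` s = ideal_act g @` (ideal_act q @` s).
Proof. by rewrite image_comp; apply: eq_imagel => xi _; rewrite ideal_actM. Qed.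

Lemma axis_iter g (l : R -> B) m t : axis g l ->
  (g ^+ m)%g (l t) = l (t + displacement g *+ m).
Proof.
move=> [_ hl]; elim: m => [|m IH]; first by rewrite mulr0n addr0.
by rewrite expgS autME IH hl mulrS -addrA (addrC (_ *+ m)).
Qed.

Lemma axis_ray g l : axis g l -> ray l.
Proof. by move=> [h _] s t _ _; exact: h. Qed.

(* The powers of [g] move the line of direction [v] in the apartment by a bounded
   amount compared to the axis near its attracting end; by convexity, the same
   bound holds all along the line. *)
Lemma axis_opposite_end g f v (l : R -> B) : chart B f -> dot v v = 1 ->
  0 < displacement g -> axis g l ->
  (forall m, fixes_dir (g ^+ m)%g f (- v)) ->
  asymptotic l (fun t => f (t *: v)) ->
  asymptotic (fun t => l (- t)) (fun t => f (t *: - v)).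
Proof.
move=> cf v1 d0 al gfix [C hC]; set d := displacement g in d0.
have ld := al.1; pose rho t := f (t *: v).
have rhod (s t : R) : dist (rho s) (rho t) = `|s - t|.
  by rewrite /rho chart_dist // edistZr (enorm1 v1) mulr1.
(* Apply [g ^+ m], which sends [l (- T)] to [l 0]. The backward rays [r] and [r'] are asymptotic as
   [g ^+ m] fixes the direction [- v], so their distance at [T] is at most that at 0, namely [2 * C]
   through [l T]; a last [C] separates [l 0] from [rho 0]. *)
have key m : dist (l (- (d *+ m))) (rho (- (d *+ m))) <= 3 * C.
  set T := d *+ m; have T0 : 0 <= T by rewrite mulrn_wge0 // ltW.
  pose r (s : R) := (g ^+ m)%g (rho (- s)); pose r' (s : R) := rho (T - s).
  have gl : (g ^+ m)%g (l (- T)) = l 0 by rewrite (axis_iter _ _ al) addNr.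
  have rr : ray r.
    by move=> s t _ _; rewrite /r aut_dist rhod opprK addrC distrC.
  have rr' : ray r'.
    move=> s t _ _; rewrite /r' rhod (_ : _ - _ = t - s) 1?distrC //; ring.
  have as_ : asymptotic r r'.
    exists (disp (g ^+ m)%g f 0 + T) => s s0.
    apply: le_trans (dist_tri _ (rho (- s)) _) _; apply: lerD.
      have := gfix m 0 s s0; rewrite add0r /disp dist_sym /r /rho.
      by rewrite scalerN scaleNr.
    by rewrite rhod (_ : _ - _ = - T) ?normrN ?ger0_norm //; ring.
  have := asymptotic_dist_le rr rr' as_ T0.
  rewrite /r /r' subrr oppr0 addr0 => h1.
  have h2 : dist ((g ^+ m)%g (rho 0)) (rho T) <= 2 * C.
    apply: le_trans (dist_tri _ (l T) _) _.
    have -> : l T = (g ^+ m)%g (l 0) by rewrite (axis_iter _ _ al) add0r.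
    rewrite aut_dist; have := hC _ (lexx 0); have := hC _ T0.
    rewrite dist_sym -/(rho 0) -/(rho T) dist_sym.
    have -> : (g ^+ m)%g (l 0) = l T by rewrite (axis_iter _ _ al) add0r.
    rewrite (dist_sym (rho 0)); lra.
  rewrite -(aut_dist (g ^+ m)%g) gl.
  apply: le_trans (dist_tri _ (rho 0) _) _.
  have := hC _ (lexx 0); rewrite -/(rho 0) (dist_sym (rho 0)); lra.
(* Rounding [t] down to a multiple of [d] costs [d] on each of the two lines. *)
exists (3 * C + 2 * d) => t t0.
have [m /andP[m1 m2]] : exists m, d *+ m <= t < d *+ m.+1.
  exists (Num.truncn (t / d)).
  have td : 0 <= t / d by rewrite divr_ge0 // ltW.
  have := truncn_itv td; rewrite ler_pdivlMr // ltr_pdivrMr //.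
  by rewrite !mulr_natl.
apply: le_trans (dist_tri _ (l (- (d *+ m))) _) _.
apply: le_trans (lerD (lexx _) (dist_tri _ (rho (- (d *+ m))) _)) _.
have := key m; have -> : f (t *: - v) = rho (- t) by rewrite /rho scalerN scaleNr.
rewrite ld rhod !opprK.
rewrite (addrC (- t)) (addrC (- (d *+ m))).
rewrite mulrSr in m2.
rewrite distrC ger0_norm ?subr_ge0 //.
lra.
Qed.

(** The directions [- w i] vary with [i]: for each [t] only some [i] gives a ray passing within [D]
    of the image under [q]. Since [f (t *: v)] and [f (t *: - v)] are [2 * t] apart, [w i] is close
    to [u] for large [t]; this yields a sublinear bound, which convexity makes constant. *)
Lemma limit_opposite_dir f f' v u q (p : nat -> aut B) (w : nat -> 'rV[R]_n) :
  chart B f -> chart B f' -> dot v v = 1 -> dot u u = 1 ->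
  (forall i, dot (w i) (w i) = 1) ->
  (forall pt, exists N, forall i, (N <= i)%N -> p i pt = q pt) ->
  (forall i, ideal_act (p i) (endpoint (fun t => f (t *: - v))) =
     endpoint (fun t => f' (t *: - w i))) ->
  ideal_act q (endpoint (fun t => f (t *: v))) = endpoint (fun t => f' (t *: u)) ->
  ideal_act q (endpoint (fun t => f (t *: - v))) = endpoint (fun t => f' (t *: - u)).
Proof.
move=> cf cf' v1 u1 w1 pq hp hq.
have N1 z : dot z z = 1 -> dot (- z) (- z) = 1 by rewrite !dotE opprK.
have rf z : dot z z = 1 -> ray (fun t => f (t *: z)) by exact: chart_ray.
have rf' z : dot z z = 1 -> ray (fun t => f' (t *: z)) by exact: chart_ray.
have rN := N1 _ v1; have uN := N1 _ u1.
rewrite ideal_act_endpoint; apply: endpoint_eq.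
pose D := dist (q (f 0)) (f' 0).
have h1 t : 0 <= t -> dist (q (f (t *: v))) (f' (t *: u)) <= D.
  move: hq; rewrite ideal_act_endpoint => /(endpointP _ (rf' _ u1)) as_ t0.
  have := asymptotic_dist_le (aut_ray q (rf _ v1)) (rf' _ u1) as_ t0.
  by rewrite /= !scale0r.
have h2 t : 0 <= t -> exists i, dist (q (f (t *: - v))) (f' (t *: - w i)) <= D.
  move=> t0; have [N0 hN0] := pq (f 0); have [N hN] := pq (f (t *: - v)).
  exists (maxn N0 N); set i := maxn N0 N.
  have := hp i; rewrite ideal_act_endpoint => /(endpointP _ (rf' _ (N1 _ (w1 i)))) as_.
  have := asymptotic_dist_le (aut_ray (p i) (rf _ rN)) (rf' _ (N1 _ (w1 i))) as_ t0.
  by rewrite /= !scale0r hN0 ?leq_maxl // hN ?leq_maxr.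
have D0 : 0 <= D by exact: dist_ge0.
have sub e : 0 < e -> exists T, forall t, T <= t ->
    dist (q (f (t *: - v))) (f' (t *: - u)) <= e * t.
  (* The first bound makes [2 * t - 2 * D] nonnegative before squaring, the second absorbs [D] into
     [e * t / 2]; the parallelogram law bounds the remaining squared distance by [8 * D * t], at
     most [(e * t / 2) ^+ 2] by the third. *)
  move=> e0; exists (Num.max D (Num.max (2 * D / e) (32 * D / e ^+ 2))) => t.
  rewrite !ge_max => /and3P[tD]; have t0 := le_trans D0 tD.
  rewrite !ler_pdivrMr ?exprn_gt0 // => te tee.
  have [i hi] := h2 t t0.
  apply: le_trans (dist_tri _ (f' (t *: - w i)) _) _.
  suff : dist (f' (t *: - w i)) (f' (t *: - u)) <= e * t / 2 by lra.
  rewrite chart_dist //.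
  have big : 2 * t - 2 * D <= edist (t *: - w i) (t *: u).
    have := dist_tri (q (f (t *: - v))) (f' (t *: - w i)) (q (f (t *: v))).
    have := dist_tri (f' (t *: - w i)) (f' (t *: u)) (q (f (t *: v))).
    have := h1 t t0; rewrite (dist_sym _ (f' _)) aut_dist !chart_dist //.
    have -> : edist (t *: - v) (t *: v) = 2 * t.
      rewrite edistE scalerN -opprD enormN -mulr2n -scaler_nat enormZ enormZ (enorm1 v1).
      by rewrite !ger0_norm // mulr1.
    lra.
  have {}big : (2 * t - 2 * D) ^+ 2 <= edist (t *: - w i) (t *: u) ^+ 2.
    by rewrite ler_pXn2r ?nnegrE ?edist_ge0 //; lra.
  have et0 : 0 <= e * t / 2 by rewrite divr_ge0 // mulr_ge0 // ltW.
  rewrite -(@ler_pXn2r _ 2) ?nnegrE ?edist_ge0 //.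
  move: big; rewrite !sqr_edist !dotE w1 u1 (dotC u (w i)) => big.
  have : D * t <= e ^+ 2 * t ^+ 2 / 32.
    by have := ler_wpM2r t0 tee; lra.
  by have := sqr_ge0 D; lra.
exists (dist (q (f 0)) (f' 0)) => t t0.
have := ray_dist_le (aut_ray q (rf _ rN)) (rf' _ uN) sub t0.
by rewrite /= !scale0r.
Qed.

(** The charts [f] and [f'] need not overlap: the points of [sp] themselves pair directions of one
    with directions of the other, and [limit_opposite_dir] treats each pair. *)
Lemma limit_opposite sp sm s' q (p : nat -> aut B) : opposite sp sm ->
  opposite sp s' -> (forall xi, sp xi -> ideal_act q xi = xi) ->
  (forall pt, exists N, forall i, (N <= i)%N -> p i pt = q pt) ->
  (forall i, ideal_act (p i) @` sm = s') -> ideal_act q @` sm = s'.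
Proof.
move=> [f [J [cf Jp spE smE]]] [f' [J' [cf' J'p spE' sE']]] qfix pq ps.
have key v u : face M J v -> dot v v = 1 -> dot u u = 1 ->
    endpoint (fun t => f (t *: v)) = endpoint (fun t => f' (t *: u)) ->
    ideal_act q (endpoint (fun t => f (t *: - v))) = endpoint (fun t => f' (t *: - u)).
  move=> Jv v1 u1 e.
  have /choice [w hw] i : exists w, dot w w = 1 /\
      ideal_act (p i) (endpoint (fun t => f (t *: - v))) =
      endpoint (fun t => f' (t *: - w)).
    have : s' (ideal_act (p i) (endpoint (fun t => f (t *: - v)))).
      rewrite -(ps i); exists (endpoint (fun t => f (t *: - v))) => //.
      rewrite smE; exists (- v) => //; split; first by exists v.
      by rewrite !dotE opprK.
    rewrite sE' => -[_ [[w Jw <-] w1] <-]; exists w; split=> //.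
    by move: w1; rewrite !dotE opprK.
  apply: (limit_opposite_dir cf cf' v1 u1 (fun i => (hw i).1) pq (fun i => (hw i).2)).
  rewrite -e; apply: qfix; rewrite spE; by exists v.
apply/seteqP; split=> [_ [xi + <-]|xi].
  rewrite smE => -[_ [[v Jv <-] v1] <-].
  have {}v1 : dot v v = 1 by move: v1; rewrite !dotE opprK.
  have : sp (endpoint (fun t => f (t *: v))) by rewrite spE; exists v.
  rewrite spE' => -[u [Ju u1] /esym e]; rewrite (key v u) // sE'.
  by exists (- u) => //; split; [exists u|rewrite !dotE opprK].
rewrite sE' => -[_ [[u Ju <-] u1] <-].
have {}u1 : dot u u = 1 by move: u1; rewrite !dotE opprK.
have : sp (endpoint (fun t => f' (t *: u))) by rewrite spE'; exists u.
rewrite spE => -[v [Jv v1] e].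
exists (endpoint (fun t => f (t *: - v))); last exact: key.
rewrite smE; exists (- v) => //; split; first by exists v.
by rewrite !dotE opprK.
Qed.

End Boundary.

(** * The decomposition of the limit group *)

Section Decomposition.
Context {R : realType} {n : nat} {M : affine_coxeter R n} {B : building M}.
Hypothesis hlf : locally_finite B.
Variables (G : set (aut B)) (hG : subgroup G).
Variables (sp sm : set (set (R -> B))) (hs : opposite sp sm).
Variables (L : set (aut B)) (hL : subgroup L) (hLclosed : closed L).
Hypotheses (hLG : L `<=` G) (hLfix : L `<=` fixator G sp).
Variable gamma : aut B.
Hypotheses (gamma_sp : fixator G sp gamma) (gamma_sm : fixator G sm gamma).
Hypothesis gamma_hyp : 0 < displacement gamma.
Hypothesis gamma_attr : attracting_simplex gamma sp.
Hypothesis gammaL : conjset gamma L = L.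

Local Open Scope group_scope.
Let U := contraction_group G gamma.
Let UL := L `&` U.
Let Lsm := L `&` (fixator G sp `&` fixator G sm).
Let al (g : aut B) := gamma^-1 * g * gamma.
Let be (g : aut B) := gamma * g * gamma^-1.

Lemma alM : {morph al : x y / x * y}.
Proof. by move=> x y; rewrite /al -!mulgA mulVKg. Qed.

Lemma beM : {morph be : x y / x * y}.
Proof. by move=> x y; rewrite /be -!mulgA mulKg. Qed.

Lemma alK : cancel al be.
Proof. by move=> x; rewrite /al /be -!mulgA mulgV mulg1 mulVKg. Qed.

Lemma beK : cancel be al.
Proof. by move=> x; rewrite /al /be -!mulgA mulVg mulg1 mulKg. Qed.

Lemma iter_al m x : iter m al x = gamma ^- m * x * gamma ^+ m.
Proof.
elim: m => [|m IH]; first by rewrite expg0 invg1 mul1g mulg1.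
by rewrite iterS IH /al !expgSr invgM !mulgA.
Qed.

Lemma L_al x : L x -> L (al x).
Proof. by rewrite -{1}gammaL => -[y Ly <-]; rewrite -/(be y) beK. Qed.

Lemma L_be x : L x -> L (be x).
Proof. by move=> Lx; rewrite -gammaL; exists x. Qed.

Lemma fixator_al s x : fixator G s gamma -> fixator G s x -> fixator G s (al x).
Proof.
move=> hg hx; have sF := fixator_subgroup s hG.
by apply: (subgroupM sF) => //; apply: (subgroupM sF) => //; exact: (subgroupV sF).
Qed.

Lemma fixator_be s x : fixator G s gamma -> fixator G s x -> fixator G s (be x).
Proof.
move=> hg hx; have sF := fixator_subgroup s hG.
by apply: (subgroupM sF); [exact: (subgroupM sF)|exact: (subgroupV sF)].
Qed.

Lemma Lsm_subgroup : subgroup Lsm.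
Proof.
have sp_sub := fixator_subgroup sp hG; have sm_sub := fixator_subgroup sm hG.
split; first by split; [exact: subgroup1|split; exact: subgroup1].
move=> x y [Lx [px mx]] [Ly [py my]]; split; first exact: hL.2.
by split; [exact: sp_sub.2|exact: sm_sub.2].
Qed.

Lemma Lsm_al x : Lsm x -> Lsm (al x).
Proof.
by move=> [Lx [px mx]]; split; [exact: L_al|split; exact: fixator_al].
Qed.

Lemma Lsm_be x : Lsm x -> Lsm (be x).
Proof.
by move=> [Lx [px mx]]; split; [exact: L_be|split; exact: fixator_be].
Qed.

Section Chart.
Variables (f : 'rV[R]_n -> B) (J : {set 'I_n}).
Hypotheses (cf : chart B f) (Jp : (J \proper [set: 'I_n])%SET).
Hypotheses (spE : sp = ideal_facet f (face M J)).
Hypotheses (smE : sm = ideal_facet f (-%R @` face M J)).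
Variables (v : 'rV[R]_n) (l : R -> B).
Hypotheses (Jv : face M J v) (v1 : dot v v = 1%R).
Hypotheses (al_ : axis gamma l) (lE : endpoint (fun t => f (t *: v)) = endpoint l).

Let o := f 0%R.
Let V := fix_test f 0%R.

(** One direction is enough: as [x] fixes [sp], [fixes_opposite_face] spreads the fixed direction
    [- v] to the whole opposite face. *)
Lemma fixator_sm_bounded x : fixator G sp x ->
  (exists K, forall t : R, (0 <= t)%R -> (disp x f (t *: - v) <= K)%R) ->
  fixator G sm x.
Proof.
move=> [Gx hx] [K hK]; split=> //; rewrite smE.
apply: (fixes_facet x cf (conicN (face_conic (M := M) Jp))).2 => _ [u Ju <-].
apply: (fixes_opposite_face cf _ Jv) => //.
  by apply: (fixes_facet x cf (face_conic (M := M) Jp)).1; rewrite -spE.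
apply: fixes_dir_sublinear => // e e0.
exists (Num.max 0%R (K / e)%R) => t; rewrite ge_max => /andP[t0].
by rewrite ler_pdivrMr // mulrC; apply: le_trans; exact: hK.
Qed.

Lemma axis_asymptotic : asymptotic l (fun t => f (t *: v)).
Proof. by apply/endpointP; [exact: chart_ray|rewrite lE]. Qed.

Lemma axis_asymptoticN : asymptotic (fun t => l (- t)%R) (fun t => f (t *: - v)).
Proof.
apply: (axis_opposite_end cf v1 gamma_hyp al_) axis_asymptotic => m.
have [_ hm] := subgroupX m (fixator_subgroup sm hG) gamma_sm.
apply: (fixes_facet _ cf (conicN (face_conic (M := M) Jp))).1; first by rewrite -smE.
by exists v.
Qed.

(** Conjugation by [gamma ^+ m] shifts along the axis: the displacement at time [t] becomes that of
    [x] at a later time, bounded by its value at time 0 by convexity. *)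
Lemma axis_bound x : fixator G sp x -> exists K, forall m t,
  (0 <= t + displacement gamma *+ m)%R -> (dist (iter m al x (l t)) (l t) <= K)%R.
Proof.
move=> [_ hx]; exists (dist (x (l 0%R)) (l 0%R)) => m t t0.
have rl := axis_ray al_.
have : endpoint (x \o l) = endpoint l.
  by rewrite -ideal_act_endpoint; apply: hx; rewrite -lE spE; exists v.
move=> /(endpointP _ rl) as_; have := asymptotic_dist_le (aut_ray x rl) rl as_ t0.
rewrite iter_al !autME (axis_iter _ _ al_) /=.
rewrite -(aut_dist (gamma ^+ m) _ (l t)) (axis_iter _ _ al_).
by rewrite autKV.
Qed.

Lemma orbit_bounded x : fixator G sp x ->
  exists K, forall m, (dist (iter m al x o) o <= K)%R.
Proof.
move=> /axis_bound [K hK]; exists (K + 2 * dist o (l 0%R))%R => m.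
have := hK m 0%R; rewrite add0r => /(_ (mulrn_wge0 _ (ltW gamma_hyp))) h.
have := dist_tri (iter m al x o) (iter m al x (l 0%R)) o.
have := dist_tri (iter m al x (l 0%R)) (l 0%R) o.
by rewrite aut_dist (dist_sym (l 0%R) o); lra.
Qed.

Lemma L_closedV : closedV V L.
Proof.
move=> x hx; apply: closed_aut => // E Efin.
have [j hj] := fix_test_finite 0%R cf Efin.
have [a La Va] := hx j; exists a => // p Ep.
by have := hj _ Va p Ep; rewrite autME => /(congr1 x); rewrite autKV.
Qed.

(** For each [t], the bound on the displacement in the direction [- v] involves two points only, so
    it passes to limits. *)
Lemma Lsm_closedV : closedV V Lsm.
Proof.
move=> x hx; have Lx : L x.
  by apply: L_closedV => j; have [a [La _] Va] := hx j; exists a.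
split=> //; split; first exact: hLfix.
apply: fixator_sm_bounded; first exact: hLfix.
exists (disp x f 0%R) => t t0.
have fin : finite_set [set f 0%R; f (t *: - v)] by rewrite finite_setU.
have [j hj] := fix_test_finite 0%R cf fin.
have [a [_ [_ [_ ma]]] Va] := hx j.
have ax p : [set f 0%R; f (t *: - v)] p -> a p = x p.
  by move=> Ep; have := hj _ Va p Ep; rewrite autME => /(congr1 x); rewrite autKV.
have := (fixes_facet a cf (conicN (face_conic (M := M) Jp))).1; rewrite -smE => /(_ ma).
move=> /(_ (- v) (ex_intro2 _ _ v Jv erefl) 0%R t t0); rewrite add0r /disp.
by rewrite !ax; [|left|right].
Qed.

(* Otherwise the conjugates of [x] would cluster outside [Lsm], at an element
   of [L] displacing the whole axis by a bounded amount. *)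
Lemma iter_al_mod x : L x -> forall i, exists N, forall m, (N <= m)%N ->
  mulset (V i) Lsm (iter m al x).
Proof.
move=> Lx i; apply: contrapT => /forallNP bad.
have /choice [e he] N : exists m, (N <= m)%N /\ ~ mulset (V i) Lsm (iter m al x).
  by have /existsNP [m /not_implyP [? ?]] := bad N; exists m.
have [K hK] := orbit_bounded (hLfix Lx).
have [g hg] := fix_test_cluster hlf cf (fun m => hK (e m)).
have Le m : L (iter (e m) al x) by elim: (e m) => //= k; exact: L_al.
have Lg : L g.
  by apply: L_closedV => j; have [m _ Vm] := hg j 0%N; exists (iter (e m) al x).
have [K' hK'] := axis_bound (hLfix Lx).
(* For fixed [t] the bound of [axis_bound] applies as soon as [m] is large, so a limit obeys it on
   the whole axis. *)
have gl t : (dist (g (l t)) (l t) <= K')%R.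
  have [j hj] := fix_test_base 0%R cf (l t).
  have d0 : (0 <= `|t| / displacement gamma)%R by rewrite divr_ge0 // ltW.
  have [m Nm Vm] := hg j (Num.bound (`|t| / displacement gamma)%R).
  have := hj _ Vm; rewrite autME => /(congr1 g); rewrite autKV => <-.
  apply: hK'.
  have : (`|t| <= displacement gamma *+ e m)%R.
    rewrite -mulr_natl -ler_pdivrMr //; apply: le_trans (ltW (archi_boundP d0)) _.
    by rewrite ler_nat; apply: leq_trans Nm (he m).1.
  by rewrite ler_norml => /andP[+ _]; lra.
have Mg : Lsm g.
  split=> //; split; first exact: hLfix.
  apply: fixator_sm_bounded; first exact: hLfix.
  have [C hC] := axis_asymptoticN; exists (K' + 2 * C)%R => t t0.
  have := dist_tri (f (t *: - v)) (l (- t)%R) (g (f (t *: - v))).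
  have := dist_tri (l (- t)%R) (g (l (- t)%R)) (g (f (t *: - v))).
  have := hC t t0; have := gl (- t)%R.
  by rewrite /disp aut_dist (dist_sym (l (- t)%R) (g (l (- t)%R)));
    rewrite (dist_sym (f (t *: - v)) (l (- t)%R)); lra.
have [k hk] := fix_test_conj hlf 0%R cf g i.
have [m _ Vm] := hg k 0%N.
have [_] := he m; apply; exists (g * (g^-1 * iter (e m) al x) * g^-1).
  exact: hk.
by exists g => //; rewrite mulVKg mulgVK.
Qed.

Lemma al_cont j : exists k, forall y, V k y -> V j (al y).
Proof.
have [k hk] := fix_test_conj hlf 0%R cf gamma^-1 j.
by exists k => y /hk; rewrite invgK.
Qed.

Lemma be_cont j : exists k, forall y, V k y -> V j (be y).
Proof. exact: (fix_test_conj hlf 0%R cf gamma j). Qed.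

Lemma V_cluster (a : nat -> aut B) : (forall m, V 0 (a m)) ->
  exists g, forall j N, exists2 m, (N <= m)%N & V j (g^-1 * a m).
Proof.
move=> Va; apply: (fix_test_cluster hlf cf (K := 0%R)) => m.
by rewrite (Va m) ?distxx //; left.
Qed.

Lemma L_decomposition x : L x -> exists2 c, Lsm c & UL (x * c).
Proof.
move=> Lx; have [c Mc hc] := contraction_mod (fix_test_subgroup f 0%R)
  (@fix_testS _ _ _ _ f 0%R) (fix_test_conj hlf 0%R cf) V_cluster alM beM alK beK
  al_cont be_cont Lsm_subgroup Lsm_closedV Lsm_al Lsm_be (iter_al_mod Lx).
exists c => //; have Lxc : L (x * c) by apply: subgroupM => //; exact: Mc.1.
split=> //; split; first exact: hLG.
apply: aut_cvg => q; have [j hj] := fix_test_base 0%R cf q.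
have [N hN] := hc j; exists N => m Nm.
by rewrite -iter_al (hj _ (hN m Nm)).
Qed.

(** For stability under conjugation by [h]: the iterates of [h^-1] stay bounded, hence send [q] into
    a finite set, all of whose points are eventually fixed by the iterates of [u]. *)
Lemma UL_normal : normal_subgroup UL L.
Proof.
have Uiter u : U u -> forall q, exists N, forall m, (N <= m)%N -> iter m al u q = q.
  move=> [_ /cvg_aut h] q; have [N hN] := h q; exists N => m /hN.
  by rewrite -iter_al.
have Uof u : G u -> (forall q, exists N, forall m, (N <= m)%N -> iter m al u q = q) ->
    U u.
  move=> Gu h; split=> //; apply: aut_cvg => q; have [N hN] := h q.
  by exists N => m /hN; rewrite -iter_al.
have iterV m y : iter m al y^-1 = (iter m al y)^-1.
  by rewrite morph_inv //; apply: iter_morph; exact: alM.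
split.
- split=> [|x y [Lx Ux] [Ly Uy]].
    split; first exact: subgroup1.
    apply: Uof; first exact: subgroup1.
    by move=> q; exists 0%N => m _; rewrite (iter_morph1 m alM).
  have Lxy : L (x * y^-1) by exact: hL.2.
  split=> //; apply: Uof; first exact: hLG.
  move=> q; have [N hN] := Uiter x Ux q; have [N' hN'] := Uiter y Uy q.
  exists (maxn N N') => m; rewrite geq_max => /andP[Nm N'm].
  rewrite (iter_morph m alM) iterV autME.
  by rewrite -{1}(hN' m N'm) autVK hN.
- by move=> x [].
- move=> h Lh _ [u [Lu Uu] <-].
  have Lhu : L (h * u * h^-1).
    by apply: subgroupM => //; [exact: subgroupM|exact: subgroupV].
  split=> //; apply: Uof; first exact: hLG.
  move=> q; have [K hK] := orbit_bounded (hLfix (subgroupV hL Lh)).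
  have fin := bounded_orbit hlf 0%R cf q K.
  have : \oo [set m | forall p, (exists2 g : aut B, (dist (g o) o <= K)%R & g q = p) ->
      iter m al u p = p].
    by apply: (finite_filter fin) => p _; have [N hN] := Uiter u Uu p; exists N.
  move=> [N _ hN]; exists N => m Nm.
  rewrite !(iter_morph m alM) !autME hN ?iterV ?autKV //.
  by exists (iter m al h^-1); [exact: hK|rewrite iterV].
Qed.

End Chart.

(** The chart comes from the opposition of [sp] and [sm]; its ray in direction [v] is asymptotic to
    the axis, which may lie outside its apartment. *)
Lemma repelling_chart : exists (f : 'rV[R]_n -> B) (J : {set 'I_n}) v l,
  [/\ chart B f, (J \proper [set: 'I_n])%SET, sp = ideal_facet f (face M J) &
    sm = ideal_facet f (-%R @` face M J)] /\
  [/\ face M J v, dot v v = 1%R, axis gamma l &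
    endpoint (fun t => f (t *: v)) = endpoint l].
Proof.
have [f [J [cf Jp spE smE]]] := hs; have [_ [l al_ spl]] := gamma_attr.
move: (spl); rewrite spE => -[v [Jv v1] e].
by exists f, J, v, l.
Qed.

Lemma L_eq_mulset : L = mulset UL Lsm.
Proof.
have [f [J [v [l [[cf Jp spE smE] [Jv v1 al_ e]]]]]] := repelling_chart.
apply/seteqP; split=> [x Lx|_ [u [Lu _] [c [Lc _] <-]]]; last exact: subgroupM.
have [c Mc ULxc] := L_decomposition cf Jp spE smE Jv v1 al_ e Lx.
exists (x * c) => //; exists c^-1; last by rewrite mulgK.
exact: subgroupV Lsm_subgroup Mc.
Qed.

Lemma UL_normal_L : normal_subgroup UL L.
Proof.
have [f [J [v [l [[cf Jp spE smE] [Jv v1 al_ e]]]]]] := repelling_chart.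
exact: (UL_normal cf spE Jv v1 al_ e).
Qed.

Lemma L_acts : acts_on (fun (g : aut B) s => ideal_act g @` s) L (Opp sp).
Proof.
move=> u s' Lu os; apply: opposite_act => //; apply: fixator_image.
exact: hLfix.
Qed.

Hypothesis Ltrans : forall s', Opp sp s' -> exists2 q, L q & ideal_act q @` sm = s'.

Lemma UL_trans : transitive_on (fun (g : aut B) s => ideal_act g @` s) UL (Opp sp).
Proof.
split=> [u s' [Lu _]|]; first exact: L_acts.
have from s' : Opp sp s' -> exists2 u, UL u & ideal_act u @` sm = s'.
  move=> /Ltrans [q Lq <-]; move: Lq; rewrite {1}L_eq_mulset.
  move=> [u ULu [c [_ [_ mc]] <-]]; exists u => //.
  by rewrite image_actM (fixator_image mc).
move=> x y /from [u ULu <-] /from [w ULw <-]; exists (w * u^-1).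
  by have [[_ +] _ _] := UL_normal_L; apply.
rewrite -image_actM mulgVK //.
Qed.

(** An element of [U] is determined by the image of [sm], and [UL] already realizes every possible
    image. *)
Lemma simply_transitive_case :
  simply_transitive_on (fun (g : aut B) s => ideal_act g @` s) U (Opp sp) ->
  UL = U /\ semidirect L U Lsm.
Proof.
move=> [Uact Ust].
have osm : Opp sp sm by exact: hs.
have uniq u w : U u -> U w -> ideal_act u @` sm = ideal_act w @` sm -> u = w.
  move=> Uu Uw e; have [z [_ hz]] := Ust sm (ideal_act u @` sm) osm (Uact u sm Uu osm).
  by rewrite -(hz u) // -(hz w).
have ULU : UL = U.
  apply/seteqP; split=> [u []//|u Uu].
  have [_ tr] := UL_trans; have [w ULw e] := tr _ _ osm (Uact u sm Uu osm).
  by rewrite (uniq u w) //; exact: ULw.2.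
split=> //; split; first by rewrite -ULU; exact: UL_normal_L.
- exact: Lsm_subgroup.
- by rewrite -ULU; exact: L_eq_mulset.
- have [UL1 _ _] := UL_normal_L.
  have U1 : U 1 by rewrite -ULU; exact: subgroup1.
  apply/seteqP; split=> [z [Uz [_ [_ mz]]]|_ ->]; last first.
    by split=> //; exact: (subgroup1 Lsm_subgroup).
  apply: uniq => //; rewrite (fixator_image mz).
  apply/esym/fixes_image => xi _; exact: ideal_act1.
Qed.

End Decomposition.

Local Open Scope group_scope.

Theorem theorem4p12 (R : realType) (n : nat) (M : affine_coxeter R n)
  (B : building M) (hthick : thick B) (hlf : locally_finite B)
  (G : set (aut B)) (hG : subgroup G) (hGclosed : closed G)
  (hGtype : forall g, G g -> type_preserving g)
  (hGtrans : strongly_transitive G)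
  (cp cm : set (set (R -> B)))
  (hcp : ideal_chamber cp) (hcm : ideal_chamber cm) (hc : opposite cp cm)
  (A : set B) (hA : apartment A)
  (hAp : cp `<=` boundary A) (hAm : cm `<=` boundary A)
  (sm sp : set (set (R -> B)))
  (hsm : sub_simplex sm cm) (hsp : sub_simplex sp cp) (hs : opposite sp sm)
  (I : {set 'I_n}) (hI : ideal_type I sp)
  (T Tsigma : set (aut B))
  (hT : T = fixator G cp `&` fixator G cm)
  (hTsigma : Tsigma = [set g | T g /\ strongly_regular I g])
  (hTsigma0 : Tsigma !=set0)
  (H : set (aut B)) (hH : subgroup H) (hHG : H `<=` G) (hHclosed : closed H)
  (hHopen : exists2 U : set (aut B), open U &
     mulset H (fixator G sm) = G `&` U)
  (a : nat -> aut B) (ha : forall k, Tsigma (a k))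
  (ha_attr : forall k, attracting_simplex (a k) sp)
  (ha_lim : (fun k => displacement (a k)) @ \oo --> +oo%R)
  (L : set (aut B)) (hL : subgroup L) (hLclosed : closed L) (hLG : L `<=` G)
  (hLlim : @chabauty_cvg (aut B) (fun k => conjset (a k) H) L)
  (hLfix : L `<=` fixator G sp)
  (gamma : aut B) (hgamma : Tsigma gamma)
  (hgamma_attr : attracting_simplex gamma sp)
  (hgammaL : conjset gamma L = L)
  (h2 : forall s', Opp sp s' ->
     exists (N : nat) (g : nat -> aut B),
       [/\ (0 < N)%N,
           forall k, (N <= k)%N ->
             conjset (a k) H (g k) /\ ideal_act (g k) @` sm = s'
         & exists (m : nat -> nat) (p : nat -> aut B),
             [/\ forall i j, (i < j)%N -> (m i < m j)%N,
                 forall i, (N <= m i)%N,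
                 forall i, (exists2 x, conjset (a (m i)) (fixator H sm) x &
                              p i = g (m i) * x)
               & exists2 q, G q & p @ \oo --> q]]) :
  let U := contraction_group G gamma in
  let UL := L `&` U in
  let Lsm := L `&` (fixator G sp `&` fixator G sm) in
  let act := fun (g : aut B) (s : set (set (R -> B))) => ideal_act g @` s in
  [/\ L = mulset UL Lsm,
      normal_subgroup UL L,
      transitive_on act UL (Opp sp)
    & simply_transitive_on act U (Opp sp) ->
      UL = U /\ semidirect L U Lsm].
Proof.
move=> U UL Lsm act.
have sub_fix s c g : sub_simplex s c -> fixator G c g -> fixator G s g.
  exact: fixator_sub_simplex.
have Tfix g : Tsigma g -> fixator G sp g /\ fixator G sm g.
  by rewrite hTsigma hT => -[[gp gm] _]; split; [apply: sub_fix gp|apply: sub_fix gm].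
have [gamma_sp gamma_sm] := Tfix _ hgamma.
have gamma_hyp : (0 < displacement gamma)%R.
  by move: hgamma; rewrite hTsigma => -[_ [[+ _] _ _]].
have Ltrans s' : Opp sp s' -> exists2 q, L q & ideal_act q @` sm = s'.
  move=> os; have [N [g [_ hg [m [p [minc mN hp [q Gq pq]]]]]]] := h2 _ os.
  have Lq : L q.
    apply: (chabauty_limit_mem hLlim hLclosed minc _ pq) => i.
    have [_ [h [Hh _] <-] ->] := hp i; have [[h' Hh' <-] _] := hg _ (mN i).
    exists (h' * h); first exact: (subgroupM hH).
    by rewrite !mulgA mulgVK.
  have [_ qfix] := hLfix _ Lq.
  (* Each [p i] is [g (m i)] times a conjugate by [a (m i)] of an element fixing [sm]; as [a (m i)]
     fixes [sm] too, [p i] sends [sm] to [s'] like [g (m i)]. *)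
  exists q => //; apply: (limit_opposite hs os qfix (cvg_aut pq)) => i.
  have [x [h [_ hfix] xE] ->] := hp i; have [_ <-] := hg _ (mN i).
  rewrite image_actM; congr (_ @` _).
  have [_ am] := Tfix _ (ha (m i)).
  have aVm : fixator G sm (a (m i))^-1 by exact: (subgroupV (fixator_subgroup sm hG)).
  by rewrite -xE !image_actM (fixator_image aVm) (fixes_image hfix) (fixator_image am).
split.
- exact: (L_eq_mulset hlf hG hs hL hLclosed hLG hLfix gamma_sp gamma_sm).
- exact: (UL_normal_L hlf hG hs hL hLG hLfix gamma_hyp hgamma_attr).
- exact: (UL_trans hlf hG hs hL hLclosed hLG hLfix gamma_sp gamma_sm).
- exact: (simply_transitive_case hlf hG hs hL hLclosed hLG hLfix gamma_sp gamma_sm).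
Qed.
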